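(* Let $\Lambda$ be a finite set and let $A=(A_{xy})_{x,y\in\Lambda}$ be a real symmetric, positive definite matrix with $A_{xy}\le 0$ for all $x\neq y$ and spectral radius $\|A\|\le 1$. For every $\beta\ge 0$ and every $h\in\mathbb{R}^\Lambda$, the log-Sobolev constant $\gamma_{\beta,h}$ of the Ising model $\mu_{\beta,h}$ (defined in the context) satisfies \[ \frac{1}{\gamma_{\beta,h}} \le \frac12 + \int_0^\beta e^{2\int_0^t \chi_s\,ds}\,dt , \] where $\chi_s$ is the zero-field susceptibility at inverse temperature $s$.
   Context: $(\cdot,\cdot)$ is the standard inner product on $\mathbb{R}^\Lambda$. For $\beta\ge 0$ and $h\in\mathbb{R}^\Lambda$, the ferromagnetic Ising model $\mu_{\beta,h}$ is the probability measure on $\{\pm1\}^\Lambda$ with $\mu_{\beta,h}(\sigma)\propto e^{-\frac{\beta}{2}(\sigma,A\sigma)}e^{(h,\sigma)}$; write $\mathbb{E}_{\mu_{\beta,h}}$ for its expectation. For $x\in\Lambda$ and $\sigma\in\{\pm1\}^\Lambda$, $\sigma^x$ denotes the configuration obtained from $\sigma$ by flipping the sign of $\sigma_x$. The Dirichlet form is $D_{\mu_{\beta,h}}(F)=\frac12\sum_{x\in\Lambda}\mathbb{E}_{\mu_{\beta,h}}\big[(F(\sigma)-F(\sigma^x))^2\big]$. The entropy of $F\ge 0$ is $\mathrm{Ent}_{\mu_{\beta,h}}(F)=\mathbb{E}_{\mu_{\beta,h}}\Phi(F)-\Phi(\mathbb{E}_{\mu_{\beta,h}}F)$ with $\Phi(x)=x\log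 x$. The log-Sobolev constant $\gamma_{\beta,h}$ is the largest constant such that $\mathrm{Ent}_{\mu_{\beta,h}}(F)\le \frac{2}{\gamma_{\beta,h}}D_{\mu_{\beta,h}}(\sqrt F)$ for all nonnegative $F:\{\pm1\}^\Lambda\to\mathbb{R}$. The zero-field susceptibility at inverse temperature $s\ge0$ is $\chi_s=\sup_{x\in\Lambda}\sum_{y\in\Lambda}\mathbb{E}_{\mu_{s,0}}(\sigma_x\sigma_y)$. *)

(* Defs.v *)
From HB Require Import structures.
From mathcomp Require Import all_boot all_order all_algebra.
From mathcomp Require Import all_classical all_reals all_analysis.
Set Implicit Arguments. Unset Strict Implicit. Unset Printing Implicit Defensive.
Import Order.TTheory GRing.Theory Num.Theory.
Import numFieldNormedType.Exports.
Local Open Scope classical_set_scope.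
Local Open Scope ring_scope.

Section Ising.
Variables (R : realType) (L : finType).

Definition config := {ffun L -> bool}.
Definition spin (s : config) (x : L) : R := if s x then 1 else -1.

Definition flip (s : config) (x : L) : config :=
  [ffun y => if y == x then ~~ s y else s y].

Definition inner (u v : L -> R) : R := \sum_(x : L) u x * v x.
Definition matvec (A : L -> L -> R) (v : L -> R) : L -> R :=
  fun x => \sum_(y : L) A x y * v y.

Definition sym_mx (A : L -> L -> R) := forall x y, A x y = A y x.
Definition posdef_mx (A : L -> L -> R) :=
  forall v : L -> R, (exists x, v x != 0) -> 0 < inner v (matvec A v).
Definition offdiag_nonpos (A : L -> L -> R) := forall x y, x != y -> A x y <= 0.
(* spectral radius <= 1 : every eigenvalue has modulus <= 1
   (A sym_mx real, so all eigenvalues are real) *)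
Definition spec_rad_le1 (A : L -> L -> R) :=
  forall (lam : R) (v : L -> R), (exists x, v x != 0) ->
    (forall x, matvec A v x = lam * v x) -> `|lam| <= 1.

Definition ising_weight (A : L -> L -> R) (beta : R) (h : L -> R) (s : config) : R :=
  expR (- (beta / 2) * inner (spin s) (matvec A (spin s))) * expR (inner h (spin s)).
Definition partition_fn A beta h : R := \sum_(s : config) ising_weight A beta h s.
Definition expect A beta h (F : config -> R) : R :=
  (\sum_(s : config) F s * ising_weight A beta h s) / partition_fn A beta h.

Definition Phi (x : R) : R := x * ln x.
Definition Ent A beta h (F : config -> R) : R :=
  expect A beta h (fun s => Phi (F s)) - Phi (expect A beta h F).
Definition Dirichlet A beta h (F : config -> R) : R :=
  2^-1 * \sum_(x : L) expect A beta h (fun s => (F s - F (flip s x)) ^+ 2).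

Definition logsob_set A beta h : set R :=
  [set g : R | 0 < g /\ forall F : config -> R, (forall s, 0 <= F s) ->
      Ent A beta h F <= 2 / g * Dirichlet A beta h (fun s => Num.sqrt (F s))].
Definition logsob_const A beta h : R := sup (logsob_set A beta h).

Definition susceptibility A (s : R) : R :=
  \big[Num.max/0]_(x : L) \sum_(y : L) expect A s (fun _ => 0) (fun c => spin c x * spin c y).

End Ising.

(* Main.v *)
(* Write 1 - A = sum_k b_k b_k^T, possible since A <= 1, and let E_{s,y} be the Ising
   expectation at inverse temperature s with field h + sum_k y_k b_k.  Since
   sum_k (b_k, sigma)^2 = |Lambda| - (sigma, A sigma), every E_{s,y} f solves the drift heat
   equation d_s = sum_k (1/2 d_k^2 + E_{s,y}(b_k, sigma) d_k), a form of the Polchinski flow.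
   For G = E_{s,y} F the entropy of F increases along this flow at the rate |grad G|^2 / (2 G),
   and |grad G|^2 / G grows at most at the rate 2 chi_s: its growth is governed by the covariance
   matrix of the spins, whose entries are bounded in every field by the zero-field correlations
   (Ding, Song and Sun) and whose quadratic form is then controlled by the Schur test; since
   A >= 0, b is a contraction and no factor is lost between the y_k and the spins.  At s = 0 the measure is a
   product of two-point measures, where both quantities are bounded by the Dirichlet form, itself
   an expectation and hence a solution.  The maximum principle for the drift heat equation
   transports both bounds from s = 0 to s = beta. *)
Require Import Defs.
From HB Require Import structures.
From mathcomp Require Import all_boot all_order all_algebra.
From mathcomp Require Import all_classical all_reals all_analysis.
From mathcomp Require Import ring lra.
Import Order.TTheory GRing.Theory Num.Theory.
Import numFieldNormedType.Exports.
Local Open Scope classical_set_scope.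
Local Open Scope ring_scope.
Set Implicit Arguments. Unset Strict Implicit. Unset Printing Implicit Defensive.

(** * One-variable calculus *)

(** The covariance bound is needed in every field because the maximum principle runs over all tilts
    y. It is derived from a multiplicative statement: the odds ratio P(++)P(--) / (P(+-)P(-+)) of
    two spins is largest in zero field. This form is suited to induction on the graph: raising the
    strength j of one edge from 0 to infinity leads from the graph with the edge deleted to the
    graph with the edge contracted, and in between a minimum principle applies in j and in an extra
    field x on one endpoint. Gluing the two compared spins gives the third inductive input, used in
    the second-derivative test.

    The comparison function is the expectation of one fixed observable, the sum of the squared jumps
    of sqrt F. It does not depend on the measure, so the same function is the Dirichlet form of each
    tilted measure, at time 0 as at time beta.

    The constant 1/2 is the two-point constant, uniform in the bias. The factor 2 in the exponent
    appears because |grad G|^2 is quadratic in the gradient. *)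

Section derivation_rules.
Variable R : realType.
Implicit Types (f g : R -> R) (x : R).

Lemma dv_cst (c : R) x : is_derive x 1 (fun=> c) (0 : R).
Proof. exact: is_derive_cst. Qed.

Lemma dv_id x : is_derive x 1 (fun t : R => t) (1 : R).
Proof. exact: is_derive_id. Qed.

Lemma dv_add f g x (df dg : R) : is_derive x 1 f df -> is_derive x 1 g dg ->
  is_derive x 1 (fun t => f t + g t) (df + dg).
Proof. exact: is_deriveD. Qed.

Lemma dv_sub f g x (df dg : R) : is_derive x 1 f df -> is_derive x 1 g dg ->
  is_derive x 1 (fun t => f t - g t) (df - dg).
Proof. exact: is_deriveB. Qed.

Lemma dv_mul f g x (df dg : R) : is_derive x 1 f df -> is_derive x 1 g dg ->
  is_derive x 1 (fun t => f t * g t) (df * g x + f x * dg).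
Proof.
move=> hf hg; have := is_deriveM hf hg.
by move/is_derive_eq; apply; rewrite /GRing.scale /= addrC (mulrC (g x)).
Qed.

Lemma dv_scale (c : R) f x (df : R) : is_derive x 1 f df ->
  is_derive x 1 (fun t => c * f t) (c * df).
Proof.
by move=> hf; apply: is_derive_eq (dv_mul (dv_cst c x) hf) _; rewrite mul0r add0r.
Qed.

Lemma dv_inv f x (df : R) : f x != 0 -> is_derive x 1 f df ->
  is_derive x 1 (fun t => (f t)^-1) (- df / f x ^+ 2).
Proof.
move=> fx hf; apply: is_derive_eq (is_deriveV fx hf) _.
by rewrite /GRing.scale /= -exprVn mulNr mulNr mulrC exprVn.
Qed.

Lemma dv_div f g x (df dg : R) : g x != 0 ->
  is_derive x 1 f df -> is_derive x 1 g dg ->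
  is_derive x 1 (fun t => f t / g t) ((df * g x - f x * dg) / g x ^+ 2).
Proof.
by move=> gx hf hg; apply: is_derive_eq (dv_mul hf (dv_inv gx hg)) _; field.
Qed.

Lemma dv_expR f x (df : R) : is_derive x 1 f df ->
  is_derive x 1 (fun t => expR (f t)) (expR (f x) * df).
Proof. by move=> hf; apply: (@is_derive1_comp _ expR f). Qed.

Lemma dv_ln f x (df : R) : 0 < f x -> is_derive x 1 f df ->
  is_derive x 1 (fun t => ln (f t)) (df / f x).
Proof.
move=> fx hf.
by apply: is_derive_eq (is_derive1_comp (is_derive1_ln fx) hf) _; rewrite mulrC.
Qed.

Lemma dv_sqr f x (df : R) : is_derive x 1 f df ->
  is_derive x 1 (fun t => f t ^+ 2) (2 * f x * df).
Proof.
by move=> hf; apply: is_derive_eq (dv_mul hf hf) _; ring.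
Qed.

Lemma dv_sum (I : finType) (F : I -> R -> R) x (dF : I -> R) :
  (forall i, is_derive x 1 (F i) (dF i)) ->
  is_derive x 1 (fun t => \sum_i F i t) (\sum_i dF i).
Proof.
move=> h; rewrite unlock; elim: index_enum => [|i s IH] /=; first exact: dv_cst.
exact: dv_add.
Qed.

Lemma dv_continuous f x (df : R) : is_derive x 1 f df -> {for x, continuous f}.
Proof.
by move=> hf; apply/differentiable_continuous/derivable1_diffP; case: hf.
Qed.

(** Carathéodory's slope function is continuous at [x] with value [df], hence positive near [x]. The
    product form treats both sides of [x] at once. *)
Lemma derive_pos_increment f x (df : R) : is_derive x 1 f df -> 0 < df ->
  exists2 e, 0 < e & forall z, `|z - x| < e -> z != x -> 0 < (f z - f x) * (z - x).
Proof.
move=> /is_derive1_caratheodory[g [gE gc gx]] df0.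
have : \forall z \near x, 0 < g z.
  by apply: (@cvgr_gt _ _ (nbhs x) _ g (g x)); [exact: gc | rewrite gx].
move=> /nbhs_ballP[e /= e0 he]; exists e => // z ze zx.
rewrite gE -mulrA mulr_gt0 ?he//.
  by rewrite /ball /= distrC.
by rewrite -expr2 exprn_even_gt0//= subr_eq0.
Qed.

(** One-sided on purpose: in the maximum principle the maximum may sit at the final time, where only
    the past can be compared. *)
Lemma max_derive_left f x (df a : R) : a < x -> is_derive x 1 f df ->
  (forall z, a < z -> z <= x -> f z <= f x) -> 0 <= df.
Proof.
move=> ax fx fm; rewrite leNgt; apply/negP => df0.
have [e e0 he] : exists2 e, 0 < e & forall z, `|z - x| < e -> z != x ->
    0 < ((- f z) - (- f x)) * (z - x).
  by apply: (@derive_pos_increment (fun z => - f z) x (- df)); rewrite ?oppr_gt0//.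
pose z := Num.max (x - e / 2) ((a + x) / 2).
have zx : z < x by rewrite /z gt_max; apply/andP; split; lra.
have az : a < z by rewrite /z lt_max; apply/orP; right; lra.
have ze : `|z - x| < e.
  by rewrite distrC ger0_norm ?subr_ge0 1?ltW// ltrBlDr -ltrBlDl /z lt_max; apply/orP; left; lra.
have := he z ze; rewrite lt_eqF// => /(_ isT).
have := fm z az (ltW zx); nra.
Qed.

(** If [f2] were positive, [f1], which vanishes at [x], would be positive just to the right of it,
    and the mean value theorem would push [f] above its maximum. *)
Lemma max_second_derive (f f1 : R -> R) (f2 a b x : R) : a < x -> x < b ->
  (forall t : R, is_derive t 1 f (f1 t)) -> is_derive x 1 f1 f2 ->
  (forall t, a < t -> t < b -> f t <= f x) -> f1 x = 0 /\ f2 <= 0.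
Proof.
move=> ax xb df df1 fm; have f10 : f1 x = 0.
  have : is_derive x 1 f 0.
    apply: (@derive1_at_max _ f a b); first exact/ltW/(lt_trans ax).
    - by move=> t _; case: (df t).
    - by rewrite in_itv/= ax xb.
    - by move=> t; rewrite in_itv/= => /andP[at_ tb]; exact: fm.
  by move=> h; have := df x => -[_ <-]; case: h.
split=> //; rewrite leNgt; apply/negP => f20.
have [e e0 he] := derive_pos_increment df1 f20.
pose z := Num.min (x + e / 2) ((x + b) / 2).
have xz : x < z by rewrite /z lt_min; apply/andP; split; lra.
have zb : z < b by rewrite /z gt_min; apply/orP; right; lra.
have ze : z - x < e by rewrite ltrBlDl /z gt_min; apply/orP; left; lra.
have [c] := MVT xz (fun t _ => df t)
  (continuous_subspaceT (fun t => dv_continuous (df t))).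
rewrite in_itv/= => /andP[xc cz] E.
have := he c; rewrite f10 subr0 gt_eqF// ger0_norm ?subr_ge0 1?ltW//.
have c1 : c - x < e by apply: lt_trans ze; rewrite ltrD2r.
move=> /(_ c1 isT); have := fm z (lt_trans ax xz) zb.
rewrite -subr_le0 E; nra.
Qed.

End derivation_rules.

Section continuity_rules.
Variables (R : realType) (T : topologicalType).
Implicit Types f g : T -> R.

Lemma ct_cst (c : R) : continuous (fun _ : T => c).
Proof. by move=> t; exact: cvg_cst. Qed.

Lemma ct_add f g : continuous f -> continuous g -> continuous (fun t => f t + g t).
Proof. by move=> cf cg t; apply: cvgD; [exact: cf | exact: cg]. Qed.

Lemma ct_sub f g : continuous f -> continuous g -> continuous (fun t => f t - g t).
Proof. by move=> cf cg t; apply: cvgB; [exact: cf | exact: cg]. Qed.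

Lemma ct_mul f g : continuous f -> continuous g -> continuous (fun t => f t * g t).
Proof. by move=> cf cg t; apply: cvgM; [exact: cf | exact: cg]. Qed.

Lemma ct_sqr f : continuous f -> continuous (fun t => f t ^+ 2).
Proof. by move=> cf; exact: ct_mul. Qed.

Lemma ct_inv f : (forall t, f t != 0) -> continuous f -> continuous (fun t => (f t)^-1).
Proof. by move=> f0 cf t; apply: cvgV; [exact: f0 | exact: cf]. Qed.

Lemma ct_comp (p : R -> R) f : (forall t, {for f t, continuous p}) -> continuous f ->
  continuous (fun t => p (f t)).
Proof. by move=> cp cf t; apply: (@continuous_comp _ _ _ f p t); [exact: cf | exact: cp]. Qed.

Lemma ct_sum (I : finType) (F : I -> T -> R) : (forall i, continuous (F i)) ->
  continuous (fun t => \sum_i F i t).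
Proof. by move=> cF; apply: continuous_big => // -[p q]; exact: add_continuous. Qed.

End continuity_rules.

(** * The two-point logarithmic Sobolev inequality *)

Section two_point.
Variable R : realType.
Implicit Types a b c p q r x : R.

(** The quadratic is the one that [two_point_aux] yields after division by [a ^+ 2]. The difference
    of the two sides vanishes at 1, and its derivative [H'] has the sign of [x - 1]. *)
Lemma ln_quadratic_mean r : 0 <= r ->
  - ln ((1 + r + r ^+ 2) / 3) <= 7 / 6 - 4 / 3 * r + r ^+ 2 / 6.
Proof.
move=> r0.
pose H x := 7 / 6 - 4 / 3 * x + x ^+ 2 / 6 + ln ((1 + x + x ^+ 2) / 3).
pose H' x := (x - 1) ^+ 3 / (3 * (1 + x + x ^+ 2)).
have pos x : 0 < 1 + x + x ^+ 2 by nra.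
have dH x : is_derive x 1 H (H' x).
  have p3 : 0 < (1 + x + x ^+ 2) / 3 by rewrite divr_gt0.
  have d1 : is_derive x 1 (fun x => 7 / 6 - 4 / 3 * x + x ^+ 2 / 6)
      (0 - 4 / 3 * 1 + ((2 * x * 1) * 6^-1 + x ^+ 2 * 0)).
    exact: (dv_add (dv_sub (dv_cst _ x) (dv_scale _ (dv_id x)))
      (dv_mul (dv_sqr (dv_id x)) (dv_cst _ x))).
  have d2 : is_derive x 1 (fun x => (1 + x + x ^+ 2) / 3)
      ((0 + 1 + 2 * x * 1) * 3^-1 + (1 + x + x ^+ 2) * 0).
    exact: (dv_mul (dv_add (dv_add (dv_cst _ x) (dv_id x))
      (dv_sqr (dv_id x))) (dv_cst _ x)).
  apply: is_derive_eq (dv_add d1 (@dv_ln _ (fun x => (1 + x + x ^+ 2) / 3) _ _ p3 d2)) _.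
  by rewrite /H'; field; rewrite gt_eqF.
have H1 : H 1 = 0.
  by rewrite /H (_ : (1 + 1 + 1 ^+ 2) / 3 = 1 :> R) ?ln1; field.
rewrite -subr_ge0 opprK -/(H r) -H1 -subr_ge0.
have cH A : {within A, continuous H}.
  by apply: continuous_subspaceT => x; exact: dv_continuous (dH x).
have H'E x : H' x * (x - 1) = (x - 1) ^+ 4 / (3 * (1 + x + x ^+ 2)).
  by rewrite /H' mulrAC -exprSr.
have pw x y : 0 <= (x - 1) ^+ 3 * y -> 0 <= H' x * y.
  by move=> h; rewrite /H' mulrAC mulr_ge0// invr_ge0 mulr_ge0// ltW.
case: (ltgtP r 1) => [r1|r1|->]; last by rewrite subrr.
- have [c /itvP cI] := MVT r1 (fun x _ => dH x) (cH _).
  move/eqP; rewrite -eqr_opp opprB => /eqP ->.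
  rewrite -mulrN; apply: pw.
  have : c < 1 by rewrite cI.
  move=> c1; rewrite opprB (_ : _ * _ = (1 - c) ^+ 3 * (1 - r)); last by ring.
  by rewrite mulr_ge0 ?exprn_ge0// subr_ge0 ltW.
- have [c /itvP cI ->] := MVT r1 (fun x _ => dH x) (cH _).
  apply: pw; have : 1 < c by rewrite cI.
  by move=> c1; rewrite mulr_ge0// ?exprn_ge0// subr_ge0 ltW.
Qed.

Local Notation Phi := (@Phi R).

(** Tangent line of the convex function [Phi] at [c], from ln z <= z - 1 at z = c / m. *)
Lemma Phi_tangent m c : 0 <= m -> 0 < c -> m * ln c + m - c <= Phi m.
Proof.
rewrite /Defs.Phi le_eqVlt => /predU1P[<-|m0] c0.
  by rewrite !mul0r !add0r oppr_le0 ltW.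
have : ln (c / m) <= c / m - 1.
  have := @le_ln1Dx R (c / m - 1); rewrite (_ : 1 + _ = c / m); last by ring.
  by apply; rewrite ltrBrDl subrr divr_gt0.
rewrite lnM ?posrE ?invr_gt0// lnV ?posrE// => h.
have : m * (ln c - ln m) <= m * (c / m - 1) by rewrite ler_pM2l.
rewrite !mulrBr mulr1 mulrCA mulfV ?gt_eqF// mulr1.
lra.
Qed.

(** The centre is the mean of (a + t (b - a))^2 over t in [0, 1]. By homogeneity only the ratio b /
    a matters, which leaves [a = 0] as a separate case. *)
Lemma two_point_aux a b : 0 <= a -> 0 <= b -> 0 < a ^+ 2 + a * b + b ^+ 2 ->
  Phi (a ^+ 2) - a ^+ 2 * ln ((a ^+ 2 + a * b + b ^+ 2) / 3) - a ^+ 2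
   + (a ^+ 2 + a * b + b ^+ 2) / 3 <= 2^-1 * (a - b) ^+ 2.
Proof.
rewrite le_eqVlt => /predU1P[<-|a0] b0 c0.
  by rewrite expr0n/= /Defs.Phi !mul0r !(add0r,subr0,oppr0); nra.
have a20 : 0 < a ^+ 2 by rewrite exprn_gt0.
have := @ln_quadratic_mean (b / a) (divr_ge0 b0 (ltW a0)).
set r := b / a.
have bE : b = a * r by rewrite /r mulrCA mulfV ?gt_eqF// mulr1.
have r0 : 0 <= r by rewrite divr_ge0// ltW.
rewrite bE => h.
have q0 : 0 < (1 + r + r ^+ 2) / 3 by rewrite divr_gt0//; nra.
have -> : (a ^+ 2 + a * (a * r) + (a * r) ^+ 2) / 3 =
   a ^+ 2 * ((1 + r + r ^+ 2) / 3) by field.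
rewrite lnM ?posrE// /Defs.Phi.
have := ler_pM2l a20 (- ln ((1 + r + r ^+ 2) / 3)) (7 / 6 - 4 / 3 * r + r ^+ 2 / 6).
rewrite h => /idP; rewrite mulrN.
set l := ln _; set l2 := ln _.
nra.
Qed.

(* The upper bound of [two_point_aux] controls both atoms for the single centre
   [(a^2 + ab + b^2) / 3], so it suffices to average it. *)
Lemma two_point_logsob p q a b : 0 <= p -> 0 <= q -> p + q = 1 ->
  0 <= a -> 0 <= b ->
  p * Phi (a ^+ 2) + q * Phi (b ^+ 2) - Phi (p * a ^+ 2 + q * b ^+ 2)
    <= 2^-1 * (a - b) ^+ 2.
Proof.
move=> p0 q0 pq a0 b0.
have [c0|] := ltP 0 (a ^+ 2 + a * b + b ^+ 2); last first.
  move=> c0; have [-> ->] : a = 0 /\ b = 0 by split; nra.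
  by rewrite expr0n/= !mulr0 addr0 /Defs.Phi !mul0r !mulr0 subrr addr0 oppr0 expr0n/= mulr0.
have h1 := two_point_aux a0 b0 c0.
have c0' : 0 < b ^+ 2 + b * a + a ^+ 2 by rewrite [b * a]mulrC addrAC (addrC (b ^+ 2)) addrAC.
have h2 := two_point_aux b0 a0 c0'.
move: h2; rewrite (_ : b ^+ 2 + b * a + a ^+ 2 = a ^+ 2 + a * b + b ^+ 2); last by ring.
have m0 : 0 <= p * a ^+ 2 + q * b ^+ 2 by rewrite addr_ge0 ?mulr_ge0 ?sqr_ge0.
have := @Phi_tangent _ ((a ^+ 2 + a * b + b ^+ 2) / 3) m0 (divr_gt0 c0 (ltr0Sn _ 2)).
move: h1.
set c := _ / 3; set l := ln c; set A := Phi _; set B := Phi _; set M := Phi _.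
move=> h1 h3 h2.
have {}h1 := ler_wpM2l p0 h1; have {}h2 := ler_wpM2l q0 h2.
have qE : q = 1 - p by lra.
move: h1 h2 h3; rewrite qE; nra.
Qed.

(** Reverse triangle inequality: the root of [p * a + q * b] is the Euclidean norm of (sqrt (p a),
    sqrt (q b)). What remains is Cauchy-Schwarz. *)
Lemma sqrt_mean_contraction p q a b c d : 0 <= p -> 0 <= q ->
  0 <= a -> 0 <= b -> 0 <= c -> 0 <= d ->
  (Num.sqrt (p * a + q * b) - Num.sqrt (p * c + q * d)) ^+ 2 <=
  p * (Num.sqrt a - Num.sqrt c) ^+ 2 + q * (Num.sqrt b - Num.sqrt d) ^+ 2.
Proof.
move=> p0 q0 a0 b0 c0 d0.
have S x : 0 <= x -> exists2 y, 0 <= y & x = y ^+ 2 /\ Num.sqrt x = y.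
  by move=> x0; exists (Num.sqrt x); rewrite ?sqrtr_ge0 ?sqr_sqrtr.
have [A A0 [-> ->]] := S _ a0; have [B B0 [-> ->]] := S _ b0.
have [C C0 [-> ->]] := S _ c0; have [D D0 [-> ->]] := S _ d0.
have [X X0 [XE ->]] := S (p * A ^+ 2 + q * B ^+ 2) ltac:(by rewrite addr_ge0// mulr_ge0// sqr_ge0).
have [Y Y0 [YE ->]] := S (p * C ^+ 2 + q * D ^+ 2) ltac:(by rewrite addr_ge0// mulr_ge0// sqr_ge0).
suff : p * A * C + q * B * D <= X * Y by nra.
have : (p * A * C + q * B * D) ^+ 2 <= (X * Y) ^+ 2.
  rewrite exprMn -XE -YE -subr_ge0.
  rewrite (_ : _ - _ = p * q * (A * D - B * C) ^+ 2); last by ring.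
  by apply: mulr_ge0; [exact: mulr_ge0 | exact: sqr_ge0].
by rewrite ler_sqr// nnegrE ?addr_ge0// !mulr_ge0.
Qed.

End two_point.

(** * Interpolation of odds ratios along one edge *)

Section tilted_weights.
Variable R : realType.
Implicit Types (u d s x y j : R).

Lemma le_of_sqr x y : 0 <= y -> x ^+ 2 <= y ^+ 2 -> x <= y.
Proof. by move=> y0 xy; rewrite leNgt; apply/negP => yx; nra. Qed.

Lemma sqr_homo x y : 0 <= x -> x <= y -> x ^+ 2 <= y ^+ 2.
Proof. by move=> x0 xy; nra. Qed.

(** Partition function of a single spin with weights [u] (up) and [d] (down) in an extra field [s];
    [tsum] is its magnetization, the derivative of ln [wsum]. *)
Definition wsum u d s := expR s * u + expR (- s) * d.
Definition tsum u d s := (expR s * u - expR (- s) * d) / wsum u d s.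

Lemma wsum_gt0 u d s : 0 < u -> 0 < d -> 0 < wsum u d s.
Proof. by move=> *; rewrite addr_gt0// mulr_gt0// expR_gt0. Qed.

Lemma dv_wsum u d f x (df : R) : is_derive x 1 f df ->
  is_derive x 1 (fun t => wsum u d (f t)) ((expR (f x) * u - expR (- f x) * d) * df).
Proof.
move=> hf.
have e1 := dv_mul (dv_expR hf) (dv_cst u x).
have e2 := dv_mul (dv_expR (dv_scale (-1) hf)) (dv_cst d x).
rewrite /wsum; under eq_fun do rewrite -[in expR (- _)]mulN1r.
by apply: is_derive_eq (dv_add e1 e2) _; rewrite mulN1r; ring.
Qed.

Lemma dv_ln_wsum u d f x (df : R) : 0 < u -> 0 < d -> is_derive x 1 f df ->
  is_derive x 1 (fun t => ln (wsum u d (f t))) (tsum u d (f x) * df).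
Proof.
move=> u0 d0 hf.
apply: is_derive_eq (@dv_ln _ (fun t => wsum u d (f t)) _ _ (wsum_gt0 (f x) u0 d0) (dv_wsum u d hf)) _.
by rewrite /tsum; ring.
Qed.

Lemma dv_tsum u d f x (df : R) : 0 < u -> 0 < d -> is_derive x 1 f df ->
  is_derive x 1 (fun t => tsum u d (f t)) ((1 - tsum u d (f x) ^+ 2) * df).
Proof.
move=> u0 d0 hf.
have w0 := wsum_gt0 (f x) u0 d0.
have e : is_derive x 1 (fun t => wsum u (- d) (f t)) ((expR (f x) * u + expR (- f x) * d) * df).
  by apply: is_derive_eq (dv_wsum u (- d) hf) _; ring.
have -> : (fun t => tsum u d (f t)) = (fun t => wsum u (- d) (f t) / wsum u d (f t)).
  by apply/funext => t; rewrite /tsum /wsum mulrN.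
have w0' : wsum u d (f x) != 0 by rewrite gt_eqF.
apply: is_derive_eq (@dv_div _ (fun t => wsum u (- d) (f t)) (fun t => wsum u d (f t)) _ _ _ w0' e (dv_wsum u d hf)) _.
by rewrite /tsum; move: w0'; rewrite /wsum => w0'; field.
Qed.

Lemma abs_tsum_le1 u d s : 0 < u -> 0 < d -> `|tsum u d s| <= 1.
Proof.
move=> u0 d0; rewrite /tsum ler_norml ler_pdivlMr ?ler_pdivrMr ?wsum_gt0//.
have eu := mulr_gt0 (expR_gt0 s) u0; have ed := mulr_gt0 (expR_gt0 (- s)) d0.
by rewrite /wsum mulN1r mul1r; apply/andP; split; lra.
Qed.

(** As [tsum u d s] is tanh (s + ln (u / d) / 2), this is tanh x - tanh y <= 2 tanh ((x - y) / 2)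
    for x >= y, followed by monotonicity: the last hypothesis bounds (x - y) / 2 by j + ln (a / b) /
    2. *)
Lemma tsum_sub_le u1 d1 u2 d2 a b s t j : 0 < u1 -> 0 < d1 -> 0 < u2 -> 0 < d2 ->
  0 < a -> 0 < b -> b <= a -> 0 <= j -> s - t = 2 * j ->
  u1 * d2 * b ^+ 2 <= a ^+ 2 * (d1 * u2) ->
  (tsum u1 d1 s - tsum u2 d2 t) / 2 <= tsum a b j.
Proof.
move=> u10 d10 u20 d20 a0 b0 ba j0 st h.
pose A := expR s * u1; pose B := expR (- s) * d1.
pose C := expR t * u2; pose D := expR (- t) * d2.
have A0 : 0 < A by rewrite mulr_gt0 ?expR_gt0.
have B0 : 0 < B by rewrite mulr_gt0 ?expR_gt0.
have C0 : 0 < C by rewrite mulr_gt0 ?expR_gt0.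
have D0 : 0 < D by rewrite mulr_gt0 ?expR_gt0.
pose p := expR j * a; pose q := expR (- j) * b.
have p0 : 0 < p by rewrite mulr_gt0 ?expR_gt0.
have q0 : 0 < q by rewrite mulr_gt0 ?expR_gt0.
have qp : q <= p.
  by apply: ler_pM; rewrite ?expR_ge0 ?ler_expR// ?(ltW b0)//; lra.
have key : A * D * q ^+ 2 <= p ^+ 2 * (B * C).
  have -> : A * D * q ^+ 2 = (expR s * expR (- t) * expR (- j) ^+ 2) * (u1 * d2 * b ^+ 2).
    by rewrite /A /D /q; ring.
  have -> : p ^+ 2 * (B * C) = (expR j ^+ 2 * expR (- s) * expR t) * (a ^+ 2 * (d1 * u2)).
    by rewrite /p /B /C; ring.
  rewrite !expr2 -!expRD.
  have -> : s - t + (- j - j) = 0 by lra.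
  have -> : j + j - s + t = 0 by lra.
  by rewrite expR0 !mul1r.
have -> : (tsum u1 d1 s - tsum u2 d2 t) / 2 = (A * D - B * C) / ((A + B) * (C + D)).
  rewrite /tsum /wsum -/A -/B -/C -/D; field.
  by apply/andP; split; rewrite gt_eqF ?addr_gt0.
have -> : tsum a b j = (p - q) / (p + q) by [].
rewrite ler_pdivrMr ?mulr_gt0 ?addr_gt0//.
rewrite [leRHS]mulrAC ler_pdivlMr ?addr_gt0//.
have [ad|bc] := leP (A * D) (B * C).
  apply: (@le_trans _ _ 0).
    by rewrite mulr_le0_ge0 ?subr_le0// addr_ge0// ltW.
  by rewrite !mulr_ge0 ?subr_ge0// addr_ge0// ltW.
(* With [X = sqrt (AD)] and [Y = sqrt (BC)] the claim is
   [(X - Y)/(X + Y) <= (p - q)/(p + q)], since [AC + BD >= 2XY]. *)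
pose X := Num.sqrt (A * D); pose Y := Num.sqrt (B * C).
have X2 : X ^+ 2 = A * D by rewrite sqr_sqrtr// mulr_ge0 ?ltW.
have Y2 : Y ^+ 2 = B * C by rewrite sqr_sqrtr// mulr_ge0 ?ltW.
have X0 : 0 < X by rewrite sqrtr_gt0 mulr_gt0.
have Y0 : 0 < Y by rewrite sqrtr_gt0 mulr_gt0.
have XY : Y < X by rewrite ltr_sqrt// mulr_gt0.
have kk : X * q <= p * Y.
  apply: le_of_sqr; first by apply/ltW; exact: mulr_gt0.
  rewrite (exprMn 2 X) (exprMn 2 p) X2 Y2; exact: key.
have amgm : 2 * X * Y <= A * C + B * D.
  apply: le_of_sqr; first by apply: addr_ge0; apply/ltW/mulr_gt0.
  rewrite !exprMn X2 Y2 -subr_ge0.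
  have -> : (A * C + B * D) ^+ 2 - 2 ^+ 2 * (A * D) * (B * C) = (A * C - B * D) ^+ 2 by ring.
  exact: sqr_ge0.
have S : (X + Y) ^+ 2 <= (A + B) * (C + D).
  have -> : (A + B) * (C + D) = A * D + B * C + (A * C + B * D) by ring.
  by rewrite -X2 -Y2; lra.
apply: (@le_trans _ _ ((p - q) * (X + Y) ^+ 2)); last first.
  by rewrite ler_wpM2l// subr_ge0.
rewrite -X2 -Y2.
have -> : (X ^+ 2 - Y ^+ 2) * (p + q) = ((X - Y) * (p + q)) * (X + Y) by ring.
have -> : (p - q) * (X + Y) ^+ 2 = ((p - q) * (X + Y)) * (X + Y) by ring.
by rewrite ler_pM2r ?addr_gt0//; nra.
Qed.

End tilted_weights.

(** The limits at infinity and at 0, made explicit by points [z] where a negative leading or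
    constant coefficient would dominate. *)
Lemma quadratic_ge0_ends (R : realType) (A B C : R) :
  (forall z, 0 < z -> 0 <= A * z ^+ 2 + B * z + C) -> 0 <= A /\ 0 <= C.
Proof.
move=> h; split; rewrite leNgt; apply/negP => n0.
- pose z := 1 + (`|B| + `|C|) / - A.
  have w0 : 0 <= (`|B| + `|C|) / - A by rewrite divr_ge0 ?addr_ge0// oppr_ge0 ltW.
  have z1 : 1 <= z by rewrite lerDl.
  have zE : A * z = A - (`|B| + `|C|) by rewrite /z; field; rewrite lt_eqF.
  have := h z (lt_le_trans ltr01 z1).
  have := ler_norm B; have := ler_norm C; have := normr_ge0 B; have := normr_ge0 C.
  move: zE; set b := `|B|; set c := `|C|; nra.
- pose z := - C / (1 + `|A| + `|B| - C).
  have q0 : 0 < 1 + `|A| + `|B| - C.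
    by have := normr_ge0 A; have := normr_ge0 B; lra.
  have z0 : 0 < z by rewrite divr_gt0 ?oppr_gt0.
  have zE : z * (1 + `|A| + `|B| - C) = - C by rewrite /z divfK ?gt_eqF.
  have := h z z0; have := ler_norm A; have := ler_norm B.
  have := normr_ge0 A; have := normr_ge0 B.
  have z1 : z <= 1 by rewrite ler_pdivrMr// mul1r; have := normr_ge0 A; have := normr_ge0 B; lra.
  move: zE; set b := `|B|; set c := `|A|; nra.
Qed.

Section interpolation.
Variable R : realType.
(** The letter [u] or [d] is the state of a third spin, the suffix the signs of the two compared
    spins, in a given field and without the edge from the third spin to the second compared one. In
    zero field the compared spins are equal in [al], [be] and opposite in [ga], [de]; the third spin
    equals the second one in [al], [ga]. The first three inequalities are the odds inequality with
    that edge contracted, with the compared spins glued, and with the edge deleted in any extra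
    field on the third spin. *)
Variables upp dpp umm dmm upm dpm ump dmp al be ga de : R.
Hypotheses (upp0 : 0 < upp) (dpp0 : 0 < dpp) (umm0 : 0 < umm) (dmm0 : 0 < dmm).
Hypotheses (upm0 : 0 < upm) (dpm0 : 0 < dpm) (ump0 : 0 < ump) (dmp0 : 0 < dmp).
Hypotheses (al0 : 0 < al) (be0 : 0 < be) (ga0 : 0 < ga) (de0 : 0 < de).
Hypothesis contracted : upp * dmm * ga ^+ 2 <= al ^+ 2 * (dpm * ump).
Hypothesis glued : upp * dmm * be ^+ 2 <= al ^+ 2 * (dpp * umm).
Hypothesis deleted : forall x, wsum upp dpp x * wsum umm dmm x * (ga + de) ^+ 2 <=
  (al + be) ^+ 2 * (wsum upm dpm x * wsum ump dmp x).
Hypothesis gks2 : be * ga <= al * de.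
Hypothesis gks1 : be <= al.

Let num (j x : R) := wsum upp dpp (x + j) * wsum umm dmm (x - j).
Let den (j x : R) := wsum upm dpm (x - j) * wsum ump dmp (x + j).
(** Logarithm of right side over left side of the odds inequality at edge strength [j] and extra
    field [x] on the third spin. The goal concerns [x = 0]; the other fields enter through the
    minimum principle. *)
Let f (j x : R) := 2 * (ln (wsum al be j) - ln (wsum ga de j))
  - (ln (wsum upp dpp (x + j)) + ln (wsum umm dmm (x - j))
     - ln (wsum upm dpm (x - j)) - ln (wsum ump dmp (x + j))).

Let num0 (j x : R) : 0 < num j x. Proof. by rewrite mulr_gt0 ?wsum_gt0. Qed.
Let den0 (j x : R) : 0 < den j x. Proof. by rewrite mulr_gt0 ?wsum_gt0. Qed.

Let nw0 (j x : R) : 0 < num j x * (wsum ga de j) ^+ 2.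
Proof. by apply: mulr_gt0 => //; rewrite exprn_gt0 ?wsum_gt0. Qed.
Let dw0 (j x : R) : 0 < (wsum al be j) ^+ 2 * den j x.
Proof. by apply: mulr_gt0 => //; rewrite exprn_gt0 ?wsum_gt0. Qed.

Let fE (j x : R) : f j x = ln ((wsum al be j) ^+ 2 * den j x)
   - ln (num j x * (wsum ga de j) ^+ 2).
Proof.
rewrite /f /num /den !lnM ?posrE ?mulr_gt0 ?exprn_gt0 ?wsum_gt0//.
by ring.
Qed.

Let f_ge (j x e : R) : num j x * (wsum ga de j) ^+ 2 <=
  expR e * ((wsum al be j) ^+ 2 * den j x) -> - e <= f j x.
Proof.
have q0 : 0 < expR e * ((wsum al be j) ^+ 2 * den j x).
  by apply: mulr_gt0 => //; rewrite expR_gt0.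
move=> h; rewrite fE -[e]expRK -lerBlDr opprK addrC lerBlDr.
rewrite -lnM ?posrE ?expR_gt0// [in leRHS]mulrC.
by rewrite ler_ln ?posrE.
Qed.

Let f_ge0_concl (j x : R) : 0 <= f j x -> num j x * (wsum ga de j) ^+ 2 <=
  (wsum al be j) ^+ 2 * den j x.
Proof.
by rewrite fE subr_ge0 ler_ln ?posrE. Qed.

Let numE (j x : R) : num j x = expR x ^+ 2 * (upp * umm) + expR j ^+ 2 * (upp * dmm)
  + expR (- j) ^+ 2 * (dpp * umm) + expR (- x) ^+ 2 * (dpp * dmm).
Proof.
rewrite /num /wsum !opprD opprK !expRD.
have jj : expR j * expR (- j) = 1 by rewrite -expRD subrr expR0.
have xx : expR x * expR (- x) = 1 by rewrite -expRD subrr expR0.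
move: jj xx; set a := expR j; set b := expR (- j); set c := expR x; set d := expR (- x).
move=> jj xx.
transitivity (c ^+ 2 * (a * b) * (upp * umm) + a ^+ 2 * (c * d) * (upp * dmm)
  + b ^+ 2 * (c * d) * (dpp * umm) + d ^+ 2 * (a * b) * (dpp * dmm)); first by ring.
by rewrite jj xx !mulr1.
Qed.

Let denE (j x : R) : den j x = expR x ^+ 2 * (upm * ump) + expR j ^+ 2 * (dpm * ump)
  + expR (- j) ^+ 2 * (upm * dmp) + expR (- x) ^+ 2 * (dpm * dmp).
Proof.
rewrite /den /wsum !opprD opprK !expRD.
have jj : expR j * expR (- j) = 1 by rewrite -expRD subrr expR0.
have xx : expR x * expR (- x) = 1 by rewrite -expRD subrr expR0.
move: jj xx; set a := expR j; set b := expR (- j); set c := expR x; set d := expR (- x).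
move=> jj xx.
transitivity (c ^+ 2 * (a * b) * (upm * ump) + a ^+ 2 * (c * d) * (dpm * ump)
  + b ^+ 2 * (c * d) * (upm * dmp) + d ^+ 2 * (a * b) * (dpm * dmp)); first by ring.
by rewrite jj xx !mulr1.
Qed.

(* Letting the field at the third spin tend to infinity in [deleted]. *)
Let pinned : upp * umm * (ga + de) ^+ 2 <= (al + be) ^+ 2 * (upm * ump) /\
  dpp * dmm * (ga + de) ^+ 2 <= (al + be) ^+ 2 * (dpm * dmp).
Proof.
have [] := @quadratic_ge0_ends R
  ((al + be) ^+ 2 * (upm * ump) - upp * umm * (ga + de) ^+ 2)
  ((al + be) ^+ 2 * (upm * dmp + dpm * ump) - (upp * dmm + dpp * umm) * (ga + de) ^+ 2)
  ((al + be) ^+ 2 * (dpm * dmp) - dpp * dmm * (ga + de) ^+ 2).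
  move=> z z0; have := deleted (ln z / 2).
  pose y := expR (ln z / 2); have y0 : 0 < y by rewrite expR_gt0.
  have zE : z = y ^+ 2 by rewrite expr2 -expRD -splitr lnK.
  have iy : expR (- (ln z / 2)) = y^-1 by rewrite expRN.
  rewrite /wsum iy -/y => h; rewrite zE.
  have y2 : 0 <= y ^+ 2 by rewrite ltW ?exprn_gt0.
  rewrite -subr_ge0 in h; have := mulr_ge0 y2 h.
  by congr (0 <= _); field; rewrite gt_eqF.
by rewrite !subr_ge0.
Qed.

(** Squared ratio of the zero-field weights of equal and opposite spins. By [gks2] a stronger edge
    can only increase it. *)
Let r (j : R) := (wsum al be j / wsum ga de j) ^+ 2.

Let r_ge (j : R) : 0 <= j -> ((al + be) / (ga + de)) ^+ 2 <= r j.
Proof.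
move=> j0; have w1 := wsum_gt0 j al0 be0; have w2 := wsum_gt0 j ga0 de0.
have h1 : 0 <= (al + be) / (ga + de) by rewrite divr_ge0// addr_ge0// ltW.
have h2 : 0 <= wsum al be j / wsum ga de j by rewrite divr_ge0// ltW.
rewrite /r ler_sqr ?nnegrE//.
rewrite ler_pdivrMr ?addr_gt0// mulrAC ler_pdivlMr ?wsum_gt0//.
have E : expR (- j) <= expR j by rewrite ler_expR; lra.
have : 0 <= (expR j - expR (- j)) * (al * de - be * ga) by rewrite mulr_ge0 ?subr_ge0.
by rewrite /wsum; lra.
Qed.

Let r0 (j : R) : 0 < r j.
Proof. by rewrite exprn_gt0 ?divr_gt0 ?wsum_gt0. Qed.

(* It is enough to compare [num] with [r * den] up to a factor [expR e]. *)
Let f_ge' (j x e : R) : num j x <= expR e * (r j * den j x) -> - e <= f j x.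
Proof.
move=> h; apply: f_ge.
have w2 := wsum_gt0 j ga0 de0.
have w20 : 0 < wsum ga de j ^+ 2 by rewrite exprn_gt0.
have := h; rewrite -(ler_pM2r w20) => h'; apply: le_trans h' _.
by rewrite /r le_eqVlt; apply/orP; left; apply/eqP; field; rewrite gt_eqF.
Qed.

(** The terms of [num] in exp (2x) and exp (-2x) are absorbed by those of [den] through [pinned],
    and what remains does not involve [x]. *)
Let num_le_outer (j x : R) : 0 <= j ->
  num j x <= r j * (expR x ^+ 2 * (upm * ump) + expR (- x) ^+ 2 * (dpm * dmp))
   + (expR j ^+ 2 * (upp * dmm) + expR (- j) ^+ 2 * (dpp * umm)).
Proof.
move=> j0; have [p1 p2] := pinned.
have gd0 : 0 < (ga + de) ^+ 2 by rewrite exprn_gt0// addr_gt0.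
have q1 : upp * umm <= r j * (upm * ump).
  apply: le_trans (ler_wpM2r _ (r_ge j0)); last by rewrite mulr_ge0 ?ltW.
  by rewrite expr_div_n mulrAC ler_pdivlMr.
have q2 : dpp * dmm <= r j * (dpm * dmp).
  apply: le_trans (ler_wpM2r _ (r_ge j0)); last by rewrite mulr_ge0 ?ltW.
  by rewrite expr_div_n mulrAC ler_pdivlMr.
have x1 : 0 <= expR x ^+ 2 by rewrite sqr_ge0.
have x2 : 0 <= expR (- x) ^+ 2 by rewrite sqr_ge0.
have := ler_wpM2l x1 q1; have := ler_wpM2l x2 q2.
rewrite numE; lra.
Qed.

(** As [j] grows, [r j] tends to al^2 / ga^2 and [contracted] compares the leading terms in exp
    (2j). The terms in [x] need no extra room, whence the uniformity in [x]. *)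
Let bound_large_j (e : R) : 0 < e ->
  exists2 M : R, 0 < M & forall j x : R, M <= j -> - e <= f j x.
Proof.
move=> e0.
pose a := al ^+ 2 / ga ^+ 2; pose K := dpp * umm / (dpm * ump).
have K0 : 0 < K by rewrite divr_gt0 ?mulr_gt0.
have a0 : 0 < a by rewrite divr_gt0 ?exprn_gt0.
(* For w = exp (-2j) <= 1 one has (a + K w^2) (ga + de w)^2 <= al^2 + w C, and [M] makes w C at most
   the slack th al^2. *)
pose C := a * (2 * ga * de + de ^+ 2) + K * (ga + de) ^+ 2.
have C0 : 0 < C.
  by rewrite addr_gt0// mulr_gt0// ?exprn_gt0 ?addr_gt0 ?mulr_gt0 ?exprn_gt0.
pose th := expR e - 1; have th0 : 0 < th by rewrite subr_gt0 expR_gt1.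
pose M := Num.max 1 (C / (th * al ^+ 2)).
have M0 : 0 < M by rewrite lt_max ltr01.
exists M => // j x Mj; have j0 : 0 <= j by rewrite (le_trans _ Mj)// ltW.
apply: f_ge'; apply: le_trans (num_le_outer x j0) _.
pose w := expR (- j) ^+ 2; pose y := expR j ^+ 2.
have wy : w * y = 1 by rewrite -exprMn -expRD addNr expR0 expr1n.
have y0 : 0 < y by rewrite exprn_gt0 ?expR_gt0.
have w0 : 0 < w by rewrite exprn_gt0 ?expR_gt0.
have w1 : w <= 1.
  by rewrite /w exprn_ile1 ?expR_ge0// -expR0 ler_expR oppr_le0.
have wC : w * C <= th * al ^+ 2.
  have yM : M <= y.
    apply: le_trans Mj _; have := expR_ge1Dx j; rewrite /y; nra.
  have : C / (th * al ^+ 2) <= y by apply: le_trans yM; rewrite le_max lexx orbT.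
  rewrite ler_pdivrMr ?mulr_gt0 ?exprn_gt0// => h.
  have := ler_wpM2l (ltW w0) h; rewrite mulrA wy mul1r; exact.
(* The summand [K * w ^+ 2] pays for [w * (dpp * umm)], since w = w^2 y. *)
have rj : a + K * w ^+ 2 <= expR e * r j.
  have rE : r j = (al + be * w) ^+ 2 / (ga + de * w) ^+ 2.
    rewrite /r /wsum /w expRN; field.
    by rewrite !gt_eqF// ?addr_gt0 ?mulr_gt0 ?expR_gt0 ?exprn_gt0 ?invr_gt0 ?expR_gt0.
  have gw : 0 < (ga + de * w) ^+ 2 by rewrite exprn_gt0// addr_gt0// mulr_gt0.
  rewrite rE mulrA ler_pdivlMr//.
  have aE : a * ga ^+ 2 = al ^+ 2 by rewrite /a divfK// gt_eqF// exprn_gt0.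
  apply: (@le_trans _ _ (al ^+ 2 + w * C)).
    have -> : (a + K * w ^+ 2) * (ga + de * w) ^+ 2 = a * ga ^+ 2
      + w * (a * (2 * ga * de + de ^+ 2 * w) + K * w * (ga + de * w) ^+ 2) by ring.
    rewrite aE lerD2l ler_pM2l// /C.
    apply: lerD.
      by rewrite ler_pM2l// lerD2l ler_piMr ?sqr_ge0.
    rewrite -mulrA ler_pM2l//.
    have q1 : ga + de * w <= ga + de by rewrite lerD2l ler_piMr// ltW.
    have q2 : (ga + de * w) ^+ 2 <= (ga + de) ^+ 2.
      by apply: sqr_homo => //; rewrite addr_ge0 ?mulr_ge0// ltW.
    by apply: le_trans q2; rewrite ler_piMl// ltW.
  have eE : expR e = 1 + th by rewrite /th addrC subrK.
  rewrite eE mulrDl mul1r.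
  have : al ^+ 2 <= (al + be * w) ^+ 2.
    by apply: sqr_homo; [exact: ltW | rewrite lerDl mulr_ge0// ltW].
  move=> h; apply: lerD => //; apply: le_trans wC _.
  by rewrite ler_pM2l.
rewrite denE -/w -/y.
have e1 : 1 <= expR e by rewrite -expR0 ler_expR ltW.
have g2 : 0 < ga ^+ 2 by rewrite exprn_gt0.
have er0 : 0 < expR e * r j by apply: mulr_gt0 (expR_gt0 e) (r0 j).
have c1 : upp * dmm <= a * (dpm * ump).
  by rewrite /a mulrAC ler_pdivlMr.
have c2 : dpp * umm = K * (dpm * ump) by rewrite /K divfK// gt_eqF// mulr_gt0.
set X := expR x ^+ 2 * (upm * ump); set X' := expR (- x) ^+ 2 * (dpm * dmp).
have X0 : 0 <= X by rewrite mulr_ge0 ?sqr_ge0// mulr_ge0 ?ltW.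
have X'0 : 0 <= X' by rewrite mulr_ge0 ?sqr_ge0// mulr_ge0 ?ltW.
apply: (@le_trans _ _ (expR e * r j * (X + X') + expR e * r j * (y * (dpm * ump)))); last first.
  rewrite -mulrDr [leRHS]mulrA (ler_pM2l er0).
  have : 0 <= w * (upm * dmp) by rewrite ltW// mulr_gt0// mulr_gt0.
  by rewrite -/X -/X'; lra.
apply: lerD.
  by rewrite ler_wpM2r ?addr_ge0// ler_peMl// (ltW (r0 j)).
apply: (@le_trans _ _ ((a + K * w ^+ 2) * (y * (dpm * ump)))); last first.
  by rewrite ler_wpM2r// mulr_ge0 ?mulr_ge0// ltW.
have -> : (a + K * w ^+ 2) * (y * (dpm * ump)) = y * (a * (dpm * ump)) + w * (w * y) * (K * (dpm * ump)) by ring.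
by rewrite wy mulr1 -c2 lerD2r ler_pM2l.
Qed.

(** For bounded [j] the terms in [j] are at most [C], while one of the terms in [x] grows at least
    linearly in [|x|]; the relative slack [th] then pays for [C]. *)
Let bound_large_x (e M : R) : 0 < e -> 0 < M ->
  exists2 N : R, 0 < N & forall j x : R, 0 <= j -> j <= M -> N <= `|x| -> - e <= f j x.
Proof.
move=> e0 M0.
pose C := expR M ^+ 2 * (upp * dmm) + dpp * umm.
have C0 : 0 < C by apply: addr_gt0; rewrite !mulr_gt0 ?expR_gt0.
pose R0 := ((al + be) / (ga + de)) ^+ 2.
have R00 : 0 < R0 by rewrite exprn_gt0// divr_gt0// addr_gt0.
pose th := expR e - 1; have th0 : 0 < th by rewrite subr_gt0 expR_gt1.
pose c := Num.min (upm * ump) (dpm * dmp).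
have c0 : 0 < c by rewrite lt_min !mulr_gt0.
have D0 : 0 < th * R0 * c by apply: mulr_gt0 => //; exact: mulr_gt0.
exists (C / (th * R0 * c)); first by rewrite divr_gt0.
move=> j x j0 jM; rewrite ler_pdivrMr// => Nx.
apply: f_ge'; apply: le_trans (num_le_outer x j0) _.
set X := expR x ^+ 2 * (upm * ump); set X' := expR (- x) ^+ 2 * (dpm * dmp).
have X0 : 0 <= X by rewrite mulr_ge0 ?sqr_ge0// mulr_ge0 ?ltW.
have X'0 : 0 <= X' by rewrite mulr_ge0 ?sqr_ge0// mulr_ge0 ?ltW.
have le_sqexp (y : R) : 0 <= y -> y <= expR y ^+ 2.
  by move=> y0; have := expR_ge1Dx y; nra.
have XX : `|x| * c <= X + X'.
  have [x0|x0] := leP 0 x.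
    rewrite (ger0_norm x0) -[leLHS]addr0; apply: lerD => //.
    by apply: ler_pM => //; [exact: ltW | exact: le_sqexp | rewrite ge_min lexx].
  rewrite (ltr0_norm x0) -[leLHS]add0r; apply: lerD => //.
  apply: ler_pM => //; [|exact: ltW| |by rewrite ge_min lexx orbT].
    by rewrite oppr_ge0 ltW.
  by apply: le_sqexp; rewrite oppr_ge0 ltW.
have q1 : expR j ^+ 2 * (upp * dmm) + expR (- j) ^+ 2 * (dpp * umm) <= C.
  apply: lerD.
    rewrite ler_pM2r ?mulr_gt0//; apply: sqr_homo; rewrite ?expR_ge0//.
    by rewrite ler_expR.
  rewrite ler_piMl//; first by rewrite mulr_ge0// ltW.
  by rewrite exprn_ile1 ?expR_ge0// -expR0 ler_expR oppr_le0.
have q2 : C <= th * (r j * (X + X')).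
  apply: le_trans Nx _.
  rewrite (_ : `|x| * _ = th * (R0 * (`|x| * c))); last by ring.
  rewrite ler_pM2l//.
  apply: le_trans (ler_wpM2r (addr_ge0 X0 X'0) (r_ge j0)).
  by rewrite ler_pM2l.
have dX : X + X' <= den j x.
  rewrite denE -/X -/X'.
  have : 0 <= expR j ^+ 2 * (dpm * ump) by rewrite mulr_ge0 ?sqr_ge0// mulr_ge0 ?ltW.
  have : 0 <= expR (- j) ^+ 2 * (upm * dmp) by rewrite mulr_ge0 ?sqr_ge0// mulr_ge0 ?ltW.
  by lra.
have eE : expR e = 1 + th by rewrite /th addrC subrK.
apply: (@le_trans _ _ (expR e * (r j * (X + X')))); last first.
  by rewrite ler_pM2l ?expR_gt0// (ler_pM2l (r0 j)).
by rewrite eE mulrDl mul1r; apply: lerD => //; apply: le_trans q2.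
Qed.

Let T1 (j x : R) := tsum upp dpp (x + j).
Let T2 (j x : R) := tsum umm dmm (x - j).
Let T3 (j x : R) := tsum upm dpm (x - j).
Let T4 (j x : R) := tsum ump dmp (x + j).
Let f1 (j x : R) := 2 * (tsum al be j - tsum ga de j) - (T1 j x - T2 j x + T3 j x - T4 j x).
Let f2 (j x : R) := 2 * (tsum ga de j ^+ 2 - tsum al be j ^+ 2)
  + T1 j x ^+ 2 + T2 j x ^+ 2 - T3 j x ^+ 2 - T4 j x ^+ 2.

Let df_j (j x : R) : is_derive j 1 (fun t => f t x) (f1 j x).
Proof.
have dp := dv_add (dv_cst x j) (dv_id j).
have dm := dv_sub (dv_cst x j) (dv_id j).
have d1 := dv_scale 2 (dv_sub (dv_ln_wsum al0 be0 (dv_id j)) (dv_ln_wsum ga0 de0 (dv_id j))).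
have d2 := dv_sub (dv_sub (dv_add (dv_ln_wsum upp0 dpp0 dp) (dv_ln_wsum umm0 dmm0 dm))
  (dv_ln_wsum upm0 dpm0 dm)) (dv_ln_wsum ump0 dmp0 dp).
apply: is_derive_eq (dv_sub d1 d2) _.
by rewrite /f1 /T1 /T2 /T3 /T4; ring.
Qed.

Let df1_j (j x : R) : is_derive j 1 (fun t => f1 t x) (f2 j x).
Proof.
have dp := dv_add (dv_cst x j) (dv_id j).
have dm := dv_sub (dv_cst x j) (dv_id j).
have d1 := dv_scale 2 (dv_sub (dv_tsum al0 be0 (dv_id j)) (dv_tsum ga0 de0 (dv_id j))).
have d2 := dv_sub (dv_add (dv_sub (dv_tsum upp0 dpp0 dp) (dv_tsum umm0 dmm0 dm))
  (dv_tsum upm0 dpm0 dm)) (dv_tsum ump0 dmp0 dp).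
apply: is_derive_eq (dv_sub d1 d2) _.
by rewrite /f2 /T1 /T2 /T3 /T4; ring.
Qed.

Let df_x (j x : R) : is_derive x 1 (fun t => f j t) (- (T1 j x + T2 j x - T3 j x - T4 j x)).
Proof.
have dp := dv_add (dv_id x) (dv_cst j x).
have dm := dv_sub (dv_id x) (dv_cst j x).
have d2 := dv_sub (dv_sub (dv_add (dv_ln_wsum upp0 dpp0 dp) (dv_ln_wsum umm0 dmm0 dm))
  (dv_ln_wsum upm0 dpm0 dm)) (dv_ln_wsum ump0 dmp0 dp).
apply: is_derive_eq (dv_sub (dv_cst (2 * (ln (wsum al be j) - ln (wsum ga de j))) x) d2) _.
by rewrite /T1 /T2 /T3 /T4; ring.
Qed.

Let tsum_order (j : R) : tsum ga de j <= tsum al be j.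
Proof.
rewrite /tsum ler_pdivrMr ?wsum_gt0// mulrAC ler_pdivlMr ?wsum_gt0//.
have jj : expR j * expR (- j) = 1 by rewrite -expRD subrr expR0.
rewrite /wsum -subr_ge0.
have -> : (expR j * al - expR (- j) * be) * (expR j * ga + expR (- j) * de)
  - (expR j * ga - expR (- j) * de) * (expR j * al + expR (- j) * be)
  = 2 * (expR j * expR (- j)) * (al * de - be * ga) by ring.
by rewrite jj mulr1 mulr_ge0// subr_ge0.
Qed.

(* At a critical point in [x] the identity
   [f2 = - 4 (P - phi1) (P - Q) + f1 (P - phi1 - Q - phi2)] holds, where
   [P, Q] are the two [tsum] terms of [f1], [phi1 = (T1 - T2)/2] and
   [phi2 = (T4 - T3)/2]. *)
Let f2_le (j x : R) : 0 <= j -> T1 j x + T2 j x - T3 j x - T4 j x = 0 ->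
  f2 j x <= 4 * `|f1 j x|.
Proof.
move=> j0 crit.
(* The fields [x + j] and [x - j] differ by [2 * j], and [glued] and [gks1] are the comparison
   hypotheses of [tsum_sub_le]. *)
have phi1 : (T1 j x - T2 j x) / 2 <= tsum al be j.
  by apply: tsum_sub_le => //; ring.
have bP := abs_tsum_le1 j al0 be0; have bQ := abs_tsum_le1 j ga0 de0.
have b1 := abs_tsum_le1 (x + j) upp0 dpp0; have b2 := abs_tsum_le1 (x - j) umm0 dmm0.
have b3 := abs_tsum_le1 (x - j) upm0 dpm0; have b4 := abs_tsum_le1 (x + j) ump0 dmp0.
have PQ := tsum_order j.
move: phi1 bP bQ b1 b2 b3 b4 PQ crit; rewrite /f2 /f1 /T1 /T2 /T3 /T4.
set P := tsum al be j; set Q := tsum ga de j; set t1 := tsum upp _ _.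
set t2 := tsum umm _ _; set t3 := tsum upm _ _; set t4 := tsum ump _ _.
rewrite !ler_norml => phi1 /andP[bP bP'] /andP[bQ bQ'] /andP[b1 b1'] /andP[b2 b2']
  /andP[b3 b3'] /andP[b4 b4'] PQ crit.
pose F := 2 * (P - Q) - (t1 - t2 + t3 - t4); rewrite -/F.
pose e1 := P - (t1 - t2) / 2.
have e10 : 0 <= e1 by rewrite subr_ge0.
have -> : 2 * (Q ^+ 2 - P ^+ 2) + t1 ^+ 2 + t2 ^+ 2 - t3 ^+ 2 - t4 ^+ 2 =
   - (4 * e1 * (P - Q)) + F * (e1 - Q - (t4 - t3) / 2).
  have -> : t4 = t1 + t2 - t3 by lra.
  by rewrite /F /e1 (_ : t4 = t1 + t2 - t3); [field | lra].
have w : `|e1 - Q - (t4 - t3) / 2| <= 4 by rewrite ler_norml /e1; lra.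
have : F * (e1 - Q - (t4 - t3) / 2) <= 4 * `|F|.
  apply: le_trans (ler_norm _) _; rewrite normrM mulrC.
  by rewrite ler_wpM2r.
have : 0 <= 4 * e1 * (P - Q) by rewrite mulr_ge0 ?mulr_ge0// subr_ge0.
by lra.
Qed.

Let f_continuous : continuous (fun p : R * R => f p.1 p.2).
Proof.
have cl u d (g : R * R -> R) : 0 < u -> 0 < d -> continuous g ->
    continuous (fun p => ln (wsum u d (g p))).
  move=> u0 d0 cg p.
  apply: (@continuous_comp _ _ _ g (fun s => ln (wsum u d s)) p); first exact: cg.
  exact: dv_continuous (dv_ln_wsum u0 d0 (dv_id (g p))).
have c1 : continuous (fun p : R * R => p.1) by move=> p; exact: cvg_fst.
have c2 : continuous (fun p : R * R => p.2) by move=> p; exact: cvg_snd.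
have cp : continuous (fun p : R * R => p.2 + p.1).
  by move=> p; apply: cvgD; [exact: c2|exact: c1].
have cm : continuous (fun p : R * R => p.2 - p.1).
  by move=> p; apply: cvgB; [exact: c2|exact: c1].
move=> p; apply: cvgB.
  apply: cvgM; first exact: cvg_cst.
  by apply: cvgB; exact: cl.
apply: cvgB; last exact: cl.
apply: cvgB; last exact: cl.
by apply: cvgD; exact: cl.
Qed.

(* If [f] were negative, [f + e * (1 - exp (- 5 j))] would have an interior minimum; the
   first-order conditions and [f2_le] are incompatible with the second-order one there. *)
Lemma odds_interpolation (j : R) : 0 <= j ->
  wsum upp dpp j * wsum umm dmm (- j) * wsum ga de j ^+ 2 <=
  wsum al be j ^+ 2 * (wsum upm dpm (- j) * wsum ump dmp j).
Proof.
move=> j0; suff : 0 <= f j 0.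
  by move=> /f_ge0_concl; rewrite /num /den !add0r.
rewrite leNgt; apply/negP => fn.
pose h := - f j 0; have h0 : 0 < h by rewrite oppr_gt0.
have h4 : 0 < h / 4 by rewrite divr_gt0.
have [M0 M00 HM] := bound_large_j h4.
pose M := Num.max M0 (j + 1).
have jM : j < M by rewrite lt_max; apply/orP; right; lra.
have M0M : M0 <= M by rewrite le_max lexx.
have Mp : 0 < M by apply: lt_le_trans M0M.
have [N N0 HN] := bound_large_x h4 Mp.
(* The amplitude [h / 2] keeps the minimum of [f + w] below [- h / 2]. The rate 5 exceeds the 4 of
   [f2_le]: at an interior minimum f1 = -5E and f2 >= 25E, against f2 <= 20E. *)
pose w (t : R) := h / 2 * (1 - expR (- 5 * t)).
have w_ge0 (t : R) : 0 <= t -> 0 <= w t.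
  move=> t0; rewrite mulr_ge0 ?divr_ge0 ?(ltW h0)// subr_ge0 -expR0 ler_expR.
  by rewrite mulNr oppr_le0 mulr_ge0.
have w_lt (t : R) : w t < h / 2.
  by rewrite /w -[ltRHS]mulr1 ltr_pM2l ?divr_gt0// gtrBl expR_gt0.
pose F (p : R * R) := f p.1 p.2 + w p.1.
pose K : set (R * R) := `[0, M]%classic `*` `[- N, N]%classic.
have cK : compact K by apply: compact_setX; exact: segment_compact.
have K0 : K (j, 0).
  by split; rewrite /= in_itv/=; apply/andP; split; lra.
have dw (t : R) : is_derive t 1 w (5 * (h / 2 * expR (- 5 * t))).
  apply: is_derive_eq (dv_scale (h / 2) (dv_sub (dv_cst 1 t)
    (dv_expR (dv_scale (- 5) (dv_id t))))) _.
  by ring.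
have cF : {within K, continuous F}.
  apply: continuous_subspaceT => p; apply: cvgD; first exact: f_continuous.
  apply: (@continuous_comp _ _ _ fst w p); first exact: cvg_fst.
  exact: dv_continuous (dw p.1).
have [[js xs]] := @compact_EVT_min _ _ F K (ex_intro _ _ K0) cK cF.
rewrite inE /K/= => -[]; rewrite /= !in_itv/= => /andP[js0 jsM] /andP[xsl xsu] Fmin.
have Fs : F (js, xs) < - (h / 2).
  apply: le_lt_trans (Fmin (j, 0) _) _; first by rewrite inE.
  by have := w_lt j; rewrite /F /= /h; lra.
have fs : f js xs < - (h / 2) by have := w_ge0 _ js0; move: Fs; rewrite /F/=; lra.
have hh : - (h / 2) < - (h / 4) by lra.
(* On the face j = 0 the claim is [deleted]. The other faces are excluded by the two growth bounds,
   whose margin [h / 4] is below [h / 2]. *)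
have {}js0 : 0 < js.
  rewrite lt_neqAle js0 andbT; apply/eqP => e; suff : 0 <= f js xs by lra.
  rewrite fE subr_ge0 ler_ln ?posrE// -e /num /den addr0 subr0.
  by rewrite /(wsum ga de 0) /(wsum al be 0) oppr0 expR0 !mul1r; exact: deleted.
have {}jsM : js < M.
  rewrite lt_neqAle jsM andbT; apply/eqP => e.
  by have := HM js xs; rewrite e M0M => /(_ isT); rewrite -e; lra.
have xsN : `|xs| < N.
  rewrite ltNge; apply/negP => xN.
  by have := HN js xs (ltW js0) (ltW jsM) xN; lra.
have [xsl' xsu'] : - N < xs /\ xs < N by apply/andP; rewrite -ltr_norml.
have crit : T1 js xs + T2 js xs - T3 js xs - T4 js xs = 0.
  have : is_derive xs 1 (fun t => f js t) 0.
    apply: (@derive1_at_min _ _ (- N) N).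
    - lra.
    - by move=> t _; case: (df_x js t).
    - by rewrite in_itv/= xsl' xsu'.
    - move=> t; rewrite in_itv/= => /andP[t1 t2].
      have := Fmin (js, t); rewrite inE /K /F /= => H.
      by move: H; rewrite lerD2r; apply; split; rewrite /= in_itv/= !ltW.
  case=> _ e0; have [_ e1] := df_x js xs.
  by apply/eqP; rewrite -oppr_eq0 -e1 e0.
pose E := h / 2 * expR (- 5 * js).
have E0 : 0 < E by rewrite mulr_gt0 ?expR_gt0// divr_gt0.
have [e1 e2] : - (f1 js xs + 5 * E) = 0 /\ - (f2 js xs - 25 * E) <= 0.
  have dF (t : R) : is_derive t 1 (fun t => -1 * (f t xs + w t))
      (-1 * (f1 t xs + 5 * (h / 2 * expR (- 5 * t)))).
    exact: dv_scale (dv_add (df_j t xs) (dw t)).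
  have d5 := dv_scale 5 (dv_scale (h / 2) (dv_expR (dv_scale (- 5) (dv_id js)))).
  have dF1 := dv_scale (-1) (dv_add (df1_j js xs) d5).
  have Fm (t : R) : 0 < t -> t < M -> -1 * (f t xs + w t) <= -1 * (f js xs + w js).
    move=> t0 tM; rewrite !mulN1r lerN2; have := Fmin (t, xs); rewrite inE /K /F /=.
    by apply; split; rewrite /= in_itv/= ?xsl ?xsu ?ltW.
  have [m1 m2] := max_second_derive js0 jsM dF dF1 Fm.
  split; first by rewrite -mulN1r.
  by apply: le_trans m2; rewrite /E le_eqVlt; apply/orP; left; apply/eqP; ring.
have f1E : f1 js xs = - (5 * E) by lra.
have := f2_le (ltW js0) crit; rewrite f1E normrN ger0_norm; last by rewrite mulr_ge0// ltW.
by lra.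
Qed.

End interpolation.

(** * Ferromagnetic correlation inequalities *)

Section spins.
Variables (R : realType) (L : finType).
Implicit Types (s t : config L) (x y u w : L) (f k : config L -> R) (S : pred L).
Local Notation spin := (@spin R L).

Lemma spin_flip s x y : spin (flip s x) y = if y == x then - spin s y else spin s y.
Proof. by rewrite /spin ffunE; case: eqP => // _; case: (s y); rewrite ?opprK. Qed.

Lemma flipK x : involutive (fun s => flip s x).
Proof. by move=> s; apply/ffunP => y; rewrite !ffunE; case: eqP; rewrite ?negbK. Qed.

Lemma sum_flip x f : \sum_s f s = \sum_s f (flip s x).
Proof. by rewrite (reindex_inj (inv_inj (flipK x))). Qed.

Lemma spin_sqr s x : spin s x * spin s x = 1.
Proof. by rewrite /spin; case: (s x); rewrite ?mulr1// mulrNN mulr1. Qed.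

Lemma spin_prod_flip s x (r : seq L) :
  \prod_(y <- r) spin (flip s x) y = (-1) ^+ count_mem x r * \prod_(y <- r) spin s y.
Proof.
elim: r => [|y r IH]; first by rewrite !big_nil mul1r.
rewrite !big_cons IH spin_flip /=; case: eqP => [->|_]; rewrite ?exprD ?expr1; ring.
Qed.

(** Griffiths positivity of all moments of the spins in [S]. Repetitions in [r] are allowed, so that
    [spos_mul] can simply prepend two sites. *)
Definition spos S f := forall r : seq L, all S r ->
  0 <= \sum_s (\prod_(x <- r) spin s x) * f s.

(** Flipping a site of odd multiplicity reverses the sign of the sum; if all multiplicities are
    even, the spin product is nonnegative. *)
Lemma spos_base S k : (forall s, 0 <= k s) ->
  (forall s x, S x -> k (flip s x) = k s) -> spos S k.
Proof.
move=> k0 ki r rS.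
have [/hasP[x xr ox]|/hasPn ev] := boolP (has (fun x => odd (count_mem x r)) r).
  rewrite le_eqVlt; apply/orP; left; apply/eqP/esym.
  set T := \sum_s _; suff : T = - T by lra.
  rewrite {1}/T (sum_flip x) -sumrN; apply: eq_bigr => s _.
  by rewrite spin_prod_flip ki ?(allP rS)// -signr_odd ox expr1 mulN1r mulNr.
apply: sumr_ge0 => s _; apply: mulr_ge0 => //.
rewrite -prodr_undup_exp_count big_seq; apply: prodr_ge0 => x; rewrite mem_undup => xr.
by apply: exprn_even_ge0; exact: ev.
Qed.

Lemma expR_spin (K : R) s x y : expR (K * (spin s x * spin s y)) =
  (expR K + expR (- K)) / 2 + (expR K - expR (- K)) / 2 * (spin s x * spin s y).
Proof.
have [->|->] : spin s x * spin s y = 1 \/ spin s x * spin s y = -1.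
- rewrite /Defs.spin; case: (s x); case: (s y); rewrite ?mulrNN ?mulr1 ?mul1r; by [left|right].
- by rewrite !mulr1; field.
- by rewrite mulrN1; field.
Qed.

(** For spins a and b, exp (K a b) = cosh K + a b sinh K, with nonnegative coefficients. *)
Lemma spos_mul S (K : R) x y f : S x -> S y -> 0 <= K -> spos S f ->
  spos S (fun s => expR (K * (spin s x * spin s y)) * f s).
Proof.
move=> Sx Sy K0 hf r rS.
have h1 := hf r rS; have h2 := hf [:: x, y & r]; rewrite /= Sx Sy rS in h2.
have {}h2 := h2 isT.
have -> : \sum_s (\prod_(z <- r) spin s z) * (expR (K * (spin s x * spin s y)) * f s) =
   (expR K + expR (- K)) / 2 * (\sum_s (\prod_(z <- r) spin s z) * f s)
   + (expR K - expR (- K)) / 2 * (\sum_s (\prod_(z <- [:: x, y & r]) spin s z) * f s).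
  rewrite !mulr_sumr -big_split; apply: eq_bigr => s _.
  by rewrite expR_spin !big_cons /=; ring.
apply: addr_ge0; apply: mulr_ge0 => //; rewrite divr_ge0//.
by rewrite subr_ge0 ler_expR; lra.
Qed.

Lemma spos_prod S (K : L * L -> R) (r : seq (L * L)) k : spos S k ->
  (forall p, 0 <= K p) ->
  spos S (fun s => (\prod_(p <- r | S p.1 && S p.2) expR (K p * (spin s p.1 * spin s p.2))) * k s).
Proof.
move=> hk K0; elim: r => [|p r IH].
  by under eq_fun do rewrite big_nil mul1r.
have [c|c] := boolP (S p.1 && S p.2); last first.
  by under eq_fun do rewrite big_cons (negbTE c).
under eq_fun do rewrite big_cons c -mulrA.
by case/andP: c => S1 S2; exact: spos_mul.
Qed.

Definition cxor s t : config L := [ffun x => s x (+) t x].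

Lemma cxorK s : involutive (cxor s).
Proof. by move=> t; apply/ffunP => x; rewrite !ffunE addbA addbb addFb. Qed.

Lemma spin_cxor s t x : spin (cxor s t) x = if t x then - spin s x else spin s x.
Proof. by rewrite /spin ffunE; case: (s x); case: (t x); rewrite ?opprK. Qed.

Definition pair_weight (J : L -> L -> R) s : R :=
  expR (\sum_x \sum_y J x y * (spin s x * spin s y)).

Definition cls2 f u y (a b : bool) : R :=
  \sum_(s : config L | (s u == a) && (s y == b)) f s.
Definition cls3 f u y w (a b c : bool) : R :=
  \sum_(s : config L | [&& s u == a, s y == b & s w == c]) f s.

Lemma cls2_split f u y w a b : cls2 f u y a b = cls3 f u y w a b true + cls3 f u y w a b false.
Proof.
rewrite /cls2 (bigID (fun s : config L => s w)) /=; congr (_ + _);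
  by apply: eq_bigl => s; case: (s w); rewrite ?andbT ?andbF.
Qed.

Lemma sum_cls2 (g : bool -> bool -> R) f u y : \sum_(s : config L) g (s u) (s y) * f s =
  g true true * cls2 f u y true true + g true false * cls2 f u y true false
  + g false true * cls2 f u y false true + g false false * cls2 f u y false false.
Proof.
rewrite (bigID (fun s : config L => s u)) /= (bigID (fun s : config L => s y)) /=.
rewrite [X in _ + X](bigID (fun s : config L => s y)) /= addrA /cls2 !mulr_sumr.
by congr (_ + _ + _ + _); apply: eq_big => s; case: (s u) (s y) => [] [].
Qed.

(** The single-site weights [q] cover fields of either sign and, by taking the value 0, pinned
    spins. *)
Variables (J : L -> L -> R) (q : L -> bool -> R).
Hypotheses (J0 : forall x y, 0 <= J x y) (q0 : forall x b, 0 <= q x b).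
Let nu s := pair_weight J s * \prod_x q x (s x).

(* Duplicated system: on the sites where the two copies differ no field is left and
   no coupling to the remaining sites, so the Griffiths expansion applies there. *)
Let dup_ge0 u w t : t u -> t w -> 0 <= \sum_s spin s u * spin s w * (nu s * nu (cxor s t)).
Proof.
move=> tu tw.
(* The second copy is [cxor s t]. If both ends of a pair or neither lie in [t], the copies have the
   same spin product and their couplings add up; if exactly one does, they cancel. *)
pose K (p : L * L) := if t p.1 == t p.2 then 2 * J p.1 p.2 else 0.
have K0 p : 0 <= K p by rewrite /K; case: ifP => // _; rewrite mulr_ge0.
pose k s := (\prod_(p : L * L | ~~ (t p.1 && t p.2)) expR (K p * (spin s p.1 * spin s p.2)))
  * \prod_x (q x (s x) * q x (s x (+) t x)).
have kpos : spos t k.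
  apply: spos_base => [s|s x tx].
    apply: mulr_ge0; apply: prodr_ge0 => *; rewrite ?expR_ge0//.
    by rewrite mulr_ge0.
  rewrite /k; congr (_ * _).
    apply: eq_bigr => -[y z] /= ntt; rewrite !spin_flip /K /=.
    case: ifP => [/eqP e|]; last by rewrite !mul0r.
    have ty : ~~ t y by move: ntt; rewrite -e andbb.
    have tz : ~~ t z by rewrite -e.
    have -> : (y == x) = false by apply: contraNF ty => /eqP ->.
    by have -> : (z == x) = false by apply: contraNF tz => /eqP ->.
  apply: eq_bigr => y _; rewrite ffunE; case: eqP => [->|//].
  by rewrite tx !addbT negbK mulrC.
have := @spos_prod t K (index_enum _) k kpos K0 [:: u; w].
rewrite /= tu tw => /(_ isT).
congr (0 <= _); apply: eq_bigr => s _; rewrite !big_cons big_nil mulr1; congr (_ * _).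
pose e (p : L * L) := expR (K p * (spin s p.1 * spin s p.2)).
have E : \prod_(p : L * L | t p.1 && t p.2) e p * \prod_(p : L * L | ~~ (t p.1 && t p.2)) e p
    = pair_weight J s * pair_weight J (cxor s t).
  have -> : \prod_(p : L * L | t p.1 && t p.2) e p *
     \prod_(p : L * L | ~~ (t p.1 && t p.2)) e p = \prod_p e p.
    by rewrite [RHS](bigID (fun p => t p.1 && t p.2)).
  rewrite /pair_weight -expRD -expR_sum -big_split /=; congr expR.
  under [RHS]eq_bigr do rewrite -big_split /=.
  rewrite pair_big/=; apply: eq_bigr => -[x y] _.
  by rewrite !spin_cxor /K /=; case: (t x); case: (t y) => /=; ring.
rewrite /k mulrA E /nu mulrACA; congr (_ * _).
by rewrite -big_split; apply: eq_bigr => x _; rewrite ffunE.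
Qed.

(** For two independent copies, the product of the differences at [u] and [w] vanishes unless both
    sites disagree; [dup_ge0] treats each disagreement set [t]. The resulting sum is eight times the
    gap between the two sides. *)
Lemma pair_association u w :
  cls2 nu u w true false * cls2 nu u w false true <=
  cls2 nu u w true true * cls2 nu u w false false.
Proof.
have nu0 s : 0 <= nu s.
  by rewrite mulr_ge0 ?expR_ge0//; apply: prodr_ge0.
pose sp (b : bool) : R := if b then 1 else -1.
have dup : 0 <= \sum_s \sum_s' (spin s u - spin s' u) * (spin s w - spin s' w) * (nu s * nu s').
  have -> : \sum_s \sum_s' (spin s u - spin s' u) * (spin s w - spin s' w) * (nu s * nu s')
     = \sum_(t : config L) \sum_s (if t u && t w then 4 * (spin s u * spin s w * (nu s * nu (cxor s t))) else 0).
    rewrite [RHS]exchange_big /=; apply: eq_bigr => s _.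
    rewrite (reindex_inj (inv_inj (cxorK s))); apply: eq_bigr => t _.
    by rewrite !spin_cxor; case: (t u); case: (t w) => /=; ring.
  apply: sumr_ge0 => t _; have [/andP[tu tw]|_] := boolP (t u && t w); last by rewrite big1.
  by rewrite -mulr_sumr mulr_ge0// dup_ge0.
have s1 : \sum_s spin s u * spin s w * nu s = cls2 nu u w true true - cls2 nu u w true false
    - cls2 nu u w false true + cls2 nu u w false false.
  by rewrite (sum_cls2 (fun a b => sp a * sp b) nu u w) /sp /=; ring.
have s2 : \sum_s spin s u * nu s = cls2 nu u w true true + cls2 nu u w true false
    - cls2 nu u w false true - cls2 nu u w false false.
  by rewrite (sum_cls2 (fun a b => sp a) nu u w) /sp /=; ring.
have s3 : \sum_s spin s w * nu s = cls2 nu u w true true - cls2 nu u w true false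
    + cls2 nu u w false true - cls2 nu u w false false.
  by rewrite (sum_cls2 (fun a b => sp b) nu u w) /sp /=; ring.
have s4 : \sum_s nu s = cls2 nu u w true true + cls2 nu u w true false
    + cls2 nu u w false true + cls2 nu u w false false.
  have := sum_cls2 (fun _ _ => 1) nu u w; rewrite !mul1r => <-.
  by apply: eq_bigr => s _; rewrite mul1r.
have E : \sum_s \sum_s' (spin s u - spin s' u) * (spin s w - spin s' w) * (nu s * nu s') =
   2 * ((\sum_s spin s u * spin s w * nu s) * (\sum_s nu s)
        - (\sum_s spin s u * nu s) * (\sum_s spin s w * nu s)).
  pose A := \sum_s spin s u * spin s w * nu s; pose B := \sum_s nu s.
  pose C := \sum_s spin s u * nu s; pose D := \sum_s spin s w * nu s.
  transitivity (\sum_s ((spin s u * spin s w * nu s) * B - (spin s u * nu s) * D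
     - (spin s w * nu s) * C + nu s * A)).
    apply: eq_bigr => s _; rewrite /A /B /C /D !mulr_sumr -!sumrN -!big_split /=.
    by apply: eq_bigr => s' _; ring.
  by rewrite !big_split /= !sumrN -!mulr_suml -/A -/B -/C -/D; ring.
move: dup; rewrite E s1 s2 s3 s4; set a := cls2 _ _ _ true true; set b := cls2 _ _ _ true false.
by set c := cls2 _ _ _ false true; set d := cls2 _ _ _ false false; lra.
Qed.

End spins.

(** * Gibbs weights under pinning, edge deletion and edge contraction *)

Section gibbs.
Variables (R : realType) (L : finType).
Implicit Types (s t : config L) (x y u w : L) (f : config L -> R)
  (J : L -> L -> R) (h : L -> R).
Local Notation spin := (@spin R L).

Definition gibbs J h s : R := pair_weight J s * expR (\sum_x h x * spin s x).

Lemma gibbs_gt0 J h s : 0 < gibbs J h s.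
Proof. by rewrite mulr_gt0 ?expR_gt0. Qed.

Lemma gibbsE J h s : gibbs J h s =
  pair_weight J s * \prod_x expR (h x * (if s x then 1 else -1)).
Proof. by rewrite /gibbs expR_sum. Qed.

Lemma gibbs_pair_association J h u w : (forall x y, 0 <= J x y) ->
  cls2 (gibbs J h) u w true false * cls2 (gibbs J h) u w false true <=
  cls2 (gibbs J h) u w true true * cls2 (gibbs J h) u w false false.
Proof.
move=> J0; have := @pair_association R L J (fun x b => expR (h x * (if b then 1 else -1))) J0
  (fun _ _ => expR_ge0 _) u w.
by under eq_fun do rewrite -gibbsE.
Qed.

Lemma cls3_swap12 f u y w a b c : cls3 f u y w a b c = cls3 f y u w b a c.
Proof. by apply: eq_bigl => s; rewrite andbCA. Qed.

(** The constraint [s y = b] becomes a factor 0 or 1 in the single-site weight at [y]. *)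
Lemma gibbs_pinned_association J h u y w b : (forall x y, 0 <= J x y) ->
  cls3 (gibbs J h) u y w true b false * cls3 (gibbs J h) u y w false b true <=
  cls3 (gibbs J h) u y w true b true * cls3 (gibbs J h) u y w false b false.
Proof.
move=> J0; pose q x b' := expR (h x * (if b' then 1 else -1)) *
  (if (x == y) && (b' != b) then 0 else 1).
have q0 x b' : 0 <= q x b' by rewrite mulr_ge0 ?expR_ge0//; case: ifP.
have := @pair_association R L J q J0 q0 u w.
have E a c : cls2 (fun s => pair_weight J s * \prod_x q x (s x)) u w a c =
    cls3 (gibbs J h) u y w a b c.
  rewrite /cls3 (eq_bigl (fun s : config L => ((s u == a) && (s w == c)) && (s y == b))); last first.
    by move=> s; rewrite -andbA; congr (_ && _); rewrite andbC.
  rewrite [RHS]big_mkcondr /=; apply: eq_bigr => s _; rewrite gibbsE.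
  rewrite /q big_split /=; case: eqP => sy.
    rewrite [X in _ * (_ * X)]big1 ?mulr1// => x _.
    by case: eqP => //= ->; rewrite sy eqxx.
  rewrite (bigD1 y) //= [X in _ * (_ * X)](bigD1 y)//= eqxx /=.
  by move/eqP: sy => ->; rewrite mul0r !mulr0.
by rewrite !E.
Qed.

Lemma cls3_gt0 J h u y w a b c : u != y -> u != w -> y != w ->
  0 < cls3 (gibbs J h) u y w a b c.
Proof.
move=> uy uw yw; pose s0 : config L := [ffun x => if x == u then a else if x == y then b else c].
rewrite /cls3 (bigD1 s0) /=; last first.
  rewrite !ffunE !eqxx [y == u]eq_sym (negbTE uy) [w == u]eq_sym (negbTE uw).
  by rewrite [w == y]eq_sym (negbTE yw) !eqxx.
by rewrite ltr_pwDl ?gibbs_gt0// sumr_ge0// => s _; exact/ltW/gibbs_gt0.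
Qed.

Lemma gibbs0_even J u y w a b c : cls3 (gibbs J (fun=> 0)) u y w a b c =
  cls3 (gibbs J (fun=> 0)) u y w (~~ a) (~~ b) (~~ c).
Proof.
pose T : config L := [ffun=> true].
rewrite /cls3 (reindex_inj (inv_inj (cxorK T))); apply: eq_big => s.
  by rewrite !ffunE; case: (s u) (s y) (s w) a b c => [] [] [] [] [] [].
move=> _; rewrite /gibbs /pair_weight; congr (expR _ * expR _).
  apply: eq_bigr => x _; apply: eq_bigr => z _; congr (_ * _).
  by rewrite /Defs.spin !ffunE; case: (s x) (s z) => [] [] /=; rewrite ?mulrNN ?mulr1 ?mul1r.
by rewrite !big1// => x _; rewrite mul0r.
Qed.

(** Used for an extra field at [w] and for the edge between [y] and [w]: on a class [s y] is fixed,
    so that the edge acts on [w] as a field. *)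
Lemma cls2_tilt f f' u y w a b (z : R) :
  (forall s, s u = a -> s y = b -> f' s = f s * expR (z * spin s w)) ->
  cls2 f' u y a b = wsum (cls3 f u y w a b true) (cls3 f u y w a b false) z.
Proof.
move=> h; rewrite (cls2_split f' u y w) /wsum /cls3 !mulr_sumr; congr (_ + _).
  apply: eq_bigr => s /and3P[/eqP su /eqP sy /eqP sw].
  by rewrite h// /Defs.spin sw mulr1 mulrC.
apply: eq_bigr => s /and3P[/eqP su /eqP sy /eqP sw].
by rewrite h// /Defs.spin sw mulrN1 mulrC.
Qed.

Lemma sum_delta2 (g : L -> L -> R) y w :
  \sum_x \sum_z (if (x == y) && (z == w) then g x z else 0) = g y w.
Proof. by rewrite pair_big/= -big_mkcond (big_pred1 (y, w)). Qed.

(** [pair_weight] sums over ordered pairs, so an edge has strength [J y w + J w y] and both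
    orientations are removed. *)
Definition del_edge J y w : L -> L -> R := fun a b =>
  if ((a == y) && (b == w)) || ((a == w) && (b == y)) then 0 else J a b.

Lemma gibbs_del_edge J h y w s : y != w -> gibbs J h s =
  gibbs (del_edge J y w) h s * expR ((J y w + J w y) * (spin s y * spin s w)).
Proof.
move=> yw; rewrite /gibbs mulrAC; congr (_ * _); rewrite /pair_weight -expRD; congr expR.
have := sum_delta2 (fun x z => J x z * (spin s x * spin s z)) y w.
have := sum_delta2 (fun x z => J x z * (spin s x * spin s z)) w y.
rewrite [spin s w * _]mulrC mulrDl => <- <-.
rewrite [X in _ = _ + X]addrC -!big_split /=; apply: eq_bigr => x _.
rewrite -!big_split /=; apply: eq_bigr => z _; rewrite /del_edge.
have [->|_] := eqVneq x y; have [->|_] := eqVneq z w; have [e|_] := eqVneq x w;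
  rewrite ?eqxx ?(negbTE yw) ?[w == y]eq_sym ?(negbTE yw) ?andbF ?mul0r ?add0r ?addr0 //=.
all: by case: ifP; rewrite ?mul0r ?add0r ?addr0.
Qed.

Lemma del_edge_ge0 J y w : (forall a b, 0 <= J a b) -> forall a b, 0 <= del_edge J y w a b.
Proof. by move=> J0 a b; rewrite /del_edge; case: ifP. Qed.

Lemma gibbs_field J h w (z : R) s :
  gibbs J (fun a => h a + (if a == w then z else 0)) s = gibbs J h s * expR (z * spin s w).
Proof.
rewrite /gibbs -mulrA -expRD; congr (_ * expR _).
under eq_bigr do rewrite mulrDl; rewrite big_split /=; congr (_ + _).
rewrite (bigD1 w)//= eqxx big1 ?addr0// => x /negbTE ->.
by rewrite mul0r.
Qed.

(** Edge contraction with the vertex type unchanged: [w] hands its couplings and field over to [y]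
    and stays behind as a free spin, the source of the factor 2 in [sum_merge]. *)
Definition merge y w x := if x == w then y else x.
Definition merge_coupling J y w : L -> L -> R := fun a b =>
  \sum_(x | merge y w x == a) \sum_(z | merge y w z == b) J x z.
Definition merge_field h y w : L -> R := fun a => \sum_(x | merge y w x == a) h x.

Lemma gibbs_merge J h y w s : gibbs (merge_coupling J y w) (merge_field h y w) s =
  gibbs J h [ffun x => s (merge y w x)].
Proof.
rewrite /gibbs /pair_weight; congr (expR _ * expR _).
  rewrite [RHS](partition_big (merge y w) predT)//=; apply: eq_bigr => a _.
  under eq_bigr do rewrite /merge_coupling mulr_suml.
  rewrite exchange_big /=; apply: eq_bigr => x /eqP xa.
  rewrite [RHS](partition_big (merge y w) predT)//=; apply: eq_bigr => b _.
  rewrite mulr_suml; apply: eq_bigr => z /eqP zb.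
  by rewrite /Defs.spin !ffunE xa zb.
rewrite [RHS](partition_big (merge y w) predT)//=; apply: eq_bigr => a _.
rewrite /merge_field mulr_suml; apply: eq_bigr => x /eqP xa.
by rewrite /Defs.spin !ffunE xa.
Qed.

Lemma merge_coupling_ge0 J y w : (forall a b, 0 <= J a b) ->
  forall a b, 0 <= merge_coupling J y w a b.
Proof. by move=> J0 a b; apply: sumr_ge0 => x _; apply: sumr_ge0. Qed.

Lemma merge_field0 y w : merge_field (fun=> 0) y w = fun=> 0.
Proof. by apply/funext => a; rewrite /merge_field big1. Qed.

Lemma sum_merge (P : pred (config L)) f y w : y != w -> (forall s, P (flip s w) = P s) ->
  \sum_(s : config L | P s) f [ffun x => s (merge y w x)] =
  2 * \sum_(s : config L | P s && (s w == s y)) f s.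
Proof.
move=> yw Pw; rewrite (bigID (fun s : config L => s w == s y)) /=.
have E s : s w == s y -> [ffun x => s (merge y w x)] = s.
  by move=> /eqP e; apply/ffunP => x; rewrite ffunE /merge; case: eqP => // ->.
rewrite [X in _ + X](reindex_inj (inv_inj (@flipK L w))) /=.
rewrite mulr2n mulrDl mul1r; congr (_ + _).
  by apply: eq_bigr => s /andP[_ /E ->].
apply: eq_big => [s|s].
  rewrite Pw !ffunE eqxx (negbTE yw); by case: (s w) (s y) => [] [].
move=> /andP[_]; rewrite !ffunE eqxx (negbTE yw) => sw.
congr f; rewrite -[RHS]E; last by move: sw; case: (s w) (s y) => [] [].
by apply/ffunP => x; rewrite !ffunE /merge; case: (eqVneq x w) => [_|/negbTE ->//]; rewrite (negbTE yw).
Qed.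

Lemma cls2_merge_right J h u y w a b : u != w -> y != w ->
  cls2 (gibbs (merge_coupling J y w) (merge_field h y w)) u y a b =
  2 * cls3 (gibbs J h) u y w a b b.
Proof.
move=> uw yw; rewrite /cls2; under eq_bigr do rewrite gibbs_merge.
rewrite (@sum_merge (fun s : config L => (s u == a) && (s y == b)) (gibbs J h))//; last first.
  by move=> s; rewrite !ffunE (negbTE uw) (negbTE yw).
congr (_ * _); apply: eq_bigl => s; case: (s u) (s y) (s w) a b => [] [] [] [] [] //.
Qed.

Lemma cls2_merge_left J h u y w a c : u != y -> w != y ->
  cls2 (gibbs (merge_coupling J u y) (merge_field h u y)) u w a c =
  2 * cls3 (gibbs J h) u y w a a c.
Proof.
move=> uy wy; rewrite /cls2; under eq_bigr do rewrite gibbs_merge.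
rewrite (@sum_merge (fun s : config L => (s u == a) && (s w == c)) (gibbs J h))//; last first.
  by move=> s; rewrite !ffunE (negbTE uy) (negbTE wy).
congr (_ * _); apply: eq_bigl => s; case: (s u) (s y) (s w) a c => [] [] [] [] [] //.
Qed.

(** The odds ratio in field [h] against its zero-field value, cleared of denominators. In zero field
    opposite classes have equal weight, hence the squares. *)
Definition odds_le (J : L -> L -> R) u y := forall h,
  cls2 (gibbs J h) u y true true * cls2 (gibbs J h) u y false false *
   cls2 (gibbs J (fun=> 0)) u y true false ^+ 2 <=
  cls2 (gibbs J (fun=> 0)) u y true true ^+ 2 *
   (cls2 (gibbs J h) u y true false * cls2 (gibbs J h) u y false true).

(** A case of equality: if [y] is coupled to [u] alone, every field cancels from the odds ratio,
    which is exp (4k). *)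
Lemma odds_le_isolated J u y : u != y -> (forall a b, 0 <= J a b) ->
  (forall w, w != u -> w != y -> J y w + J w y = 0) -> odds_le J u y.
Proof.
move=> uy J0 iso h; pose J' := del_edge J u y; pose k := J u y + J y u.
pose h0 (h : L -> R) x := if x == y then 0 else h x.
have J'0 x z : ((x == y) || (z == y)) && (x != z) -> J' x z = 0.
  have aux w : w != y -> J' y w = 0 /\ J' w y = 0.
    move=> wy; rewrite /J' /del_edge eqxx [y == u]eq_sym (negbTE uy) (negbTE wy) /= ?andbT ?andbF ?orbF.
    have [//|wu] := eqVneq w u.
    have := iso w wu wy; have := J0 y w; have := J0 w y; rewrite /=; split; lra.
  have [->|xy] := eqVneq x y; have [->|zy] := eqVneq z y => //=; rewrite ?eqxx// => _.
    by case: (aux z zy).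
  by case: (aux x xy).
pose f h := gibbs J' (h0 h).
have ff h1 s : f h1 (flip s y) = f h1 s.
  rewrite /f /gibbs /pair_weight; congr (expR _ * expR _).
    apply: eq_bigr => x _; apply: eq_bigr => z _; rewrite !spin_flip.
    have [c|] := boolP (((x == y) || (z == y)) && (x != z)); first by rewrite J'0// !mul0r.
    rewrite negb_and negbK negb_or => /orP[/andP[/negbTE -> /negbTE ->//]|/eqP ->].
    by case: ifP => // _; rewrite mulrNN.
  apply: eq_bigr => x _; rewrite spin_flip /h0; case: ifP => // _.
  by rewrite !mul0r.
have cf h1 a : cls2 (f h1) u y a false = cls2 (f h1) u y a true.
  rewrite /cls2 (reindex_inj (inv_inj (@flipK L y))) /=; apply: eq_big => s.
    by rewrite !ffunE eqxx (negbTE uy); case: (s y); rewrite ?andbF.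
  by rewrite ff.
have cE h1 a b : cls2 (gibbs J h1) u y a b = cls2 (f h1) u y a true *
    expR (k * ((if a then 1 else -1) * (if b then 1 else -1)) + h1 y * (if b then 1 else -1)).
  have -> : cls2 (f h1) u y a true = cls2 (f h1) u y a b by case: b.
  rewrite /cls2 mulr_suml; apply: eq_bigr => s /andP[/eqP su /eqP sy].
  rewrite (gibbs_del_edge J h1 s uy) -/J' -/k /f.
  have -> : gibbs J' h1 s = gibbs J' (h0 h1) s * expR (h1 y * spin s y).
    rewrite -gibbs_field; congr (gibbs J' _ s); apply/funext => x.
    by rewrite /h0; case: eqP => [->|_]; rewrite ?add0r ?addr0.
  by rewrite -mulrA -expRD /Defs.spin su sy addrC.
rewrite !cE /= ?(mul0r, addr0, mulr1, mulrN1, mulNr, opprK, mul1r, mulrNN).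
set A := cls2 _ _ _ true true; set B := cls2 _ _ _ false true; set C := cls2 _ _ _ true true.
rewrite le_eqVlt; apply/orP; left; apply/eqP.
transitivity (A * B * C ^+ 2 * (expR (k + h y) * expR (k - h y) * expR (- k) ^+ 2)).
  by rewrite ?mulrN ?mulNr ?opprK ?mulr1; ring.
transitivity (A * B * C ^+ 2 * (expR k ^+ 2 * (expR (- k - h y) * expR (- k + h y)))).
  congr (_ * _); rewrite !expr2 -!expRD; congr expR; ring.
by ring.
Qed.

End gibbs.

(** * Induction on the graph for the odds-ratio inequality *)

Section odds_ratio.
Variables (R : realType) (L : finType).
Implicit Types (s t : config L) (x y u w : L) (f : config L -> R)
  (J : L -> L -> R) (h : L -> R) (S : {set L}).
Local Notation spin := (@spin R L).

(** The vertex count of the induction is the size of a set [S] carrying all off-diagonal couplings;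
    a contraction removes one element of it. *)
Definition coupling_on J S := forall a b, a != b -> J a b != 0 -> (a \in S) && (b \in S).

Definition neighbours J u y := #|[pred w | [&& w != u, w != y & J y w + J w y != 0]]|.

Lemma coupling_on_merge J S y w : y \in S -> y != w -> coupling_on J S ->
  coupling_on (merge_coupling J y w) (S :\ w).
Proof.
move=> yS yw JS a b ab; rewrite /merge_coupling => nz.
have [x /andP[/eqP xa]] : exists x, (merge y w x == a) &&
    (\sum_(z | merge y w z == b) J x z != 0).
  apply/existsP; apply: contraNT nz; rewrite negb_exists => /forallP H.
  by rewrite big1// => x xa; apply/eqP; move: (H x); rewrite xa /= negbK.
move=> nzx; have [z /andP[/eqP zb Jxz]] : exists z, (merge y w z == b) && (J x z != 0).
  apply/existsP; apply: contraNT nzx; rewrite negb_exists => /forallP H.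
  by rewrite big1// => z zb; apply/eqP; move: (H z); rewrite zb /= negbK.
have xz : x != z by apply: contraNneq ab => e; rewrite -xa -zb e.
have /andP[xS zS] := JS _ _ xz Jxz.
have aux v : v \in S -> merge y w v \in S :\ w.
  by rewrite /merge !inE => vS; case: (eqVneq v w) => [_|vw]; rewrite ?yw ?yS ?vw ?vS.
by rewrite -xa -zb !aux.
Qed.

Lemma wsumN (a b j : R) : wsum a b (- j) = wsum b a j.
Proof. by rewrite /wsum opprK addrC. Qed.

(** On a class the edge [y w] is a field of strength j or -j on [w], so [odds_interpolation] applies
    with [w] as third spin. [hdel] gives the face j = 0, [hcon] the behaviour at infinity, and
    [hglu] enters the second-derivative test. *)
Lemma odds_le_interpolate J u y w : u != y -> u != w -> y != w ->
  (forall a b, 0 <= J a b) ->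
  odds_le (del_edge J y w) u y ->
  odds_le (merge_coupling (del_edge J y w) y w) u y ->
  odds_le (merge_coupling (del_edge J y w) u y) u w ->
  odds_le J u y.
Proof.
move=> uy uw yw J0 hdel hcon hglu h.
set J' := del_edge J y w in hdel hcon hglu.
have J'0 : forall a b, 0 <= J' a b by exact: del_edge_ge0.
pose F h1 := cls3 (gibbs J' h1) u y w.
have F_gt0 h1 a b c : 0 < F h1 a b c by exact: cls3_gt0.
pose z0 : L -> R := fun=> 0.
have ev a b c : F z0 a b c = F z0 (~~ a) (~~ b) (~~ c) by exact: gibbs0_even.
pose j := J y w + J w y; have j0 : 0 <= j by rewrite addr_ge0.
have cE h1 a b : cls2 (gibbs J h1) u y a b =
    wsum (F h1 a b true) (F h1 a b false) (j * (if b then 1 else -1)).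
  apply: cls2_tilt => s su sy; rewrite (gibbs_del_edge J h1 s yw) -/J' -/j.
  by rewrite /Defs.spin sy mulrA.
rewrite !cE -/z0 /= !mulr1 !mulrN1 [wsum (F z0 true false true) _ _]wsumN.
rewrite (ev true false false) (ev true false true) /=.
have c2 h1 a b : cls2 (gibbs J' h1) u y a b = F h1 a b true + F h1 a b false.
  exact: cls2_split.
have m0 : merge_field z0 y w = z0 by exact: merge_field0.
have m0' : merge_field z0 u y = z0 by exact: merge_field0.
have p2 : (0 : R) < 2 by [].
apply: odds_interpolation; try exact: F_gt0; last exact: j0.
- have := hcon (merge_field h y w); rewrite -/z0.
  have m h1 a b : cls2 (gibbs (merge_coupling J' y w) (merge_field h1 y w)) u y a b = 2 * F h1 a b b.
    exact: cls2_merge_right.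
  have mz a b := m z0 a b; rewrite m0 in mz.
  rewrite !(m h) !mz (ev true false false) /= => H.
  (* Each merged class carries a factor 2, and each side is a product of four classes. *)
  rewrite -(ler_pM2l (_ : 0 < 2 ^+ 4)) ?exprn_gt0//; move: H; congr (_ <= _); ring.
- have := hglu (merge_field h u y); rewrite -/z0.
  have wy : w != y by rewrite eq_sym.
  have m h1 a b : cls2 (gibbs (merge_coupling J' u y) (merge_field h1 u y)) u w a b = 2 * F h1 a a b.
    exact: cls2_merge_left.
  have mz a b := m z0 a b; rewrite m0' in mz.
  rewrite !(m h) !mz => H.
  rewrite -(ler_pM2l (_ : 0 < 2 ^+ 4)) ?exprn_gt0//; move: H; congr (_ <= _); ring.
- move=> x; have := hdel (fun a => h a + (if a == w then x else 0)); rewrite -/z0 !c2.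
  have cx a b : cls2 (gibbs J' (fun a => h a + (if a == w then x else 0))) u y a b =
      wsum (F h a b true) (F h a b false) x.
    by apply: cls2_tilt => s _ _; rewrite gibbs_field.
  rewrite -!c2 !cx !c2 (ev true false false) (ev true false true) /=.
  by rewrite [F z0 false true false + _]addrC.
- exact: gibbs_pinned_association.
(* The bound be <= al: association of [u], [w] given [y] is multiplied by association of [y], [w]
   given [u], and the common factors cancel. *)
- have h1 : F z0 true true false * F z0 false true true <= F z0 true true true * F z0 false true false.
    exact: gibbs_pinned_association.
  have h2 : F z0 true true false * F z0 true false true <= F z0 true true true * F z0 true false false.
    have := @gibbs_pinned_association R L J' z0 y u w true J'0.
    by rewrite -!(cls3_swap12 _ u y).
  rewrite (ev true false true) (ev true false false) /= in h2.
  move: h1 h2 (F_gt0 z0 true true false) (F_gt0 z0 true true true)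
    (F_gt0 z0 false true true) (F_gt0 z0 false true false).
  set A := F z0 true true true; set B := F z0 true true false.
  set C := F z0 false true false; set D := F z0 false true true.
  move=> h1 h2 B0 A0 D0 C0; rewrite leNgt; apply/negP => AB.
  have : B * D * (B * C) <= A * C * (A * D).
    by apply: ler_pM h1 h2; apply/ltW; exact: mulr_gt0.
  have -> : B * D * (B * C) = (C * D) * B ^+ 2 by ring.
  have -> : A * C * (A * D) = (C * D) * A ^+ 2 by ring.
  by rewrite ler_pM2l ?mulr_gt0// leNgt => /negP; apply; nra.
Qed.

(* The coupling of an edge [y w] is interpolated between deletion (fewer neighbours of [y])
   and contraction (fewer vertices). *)
Lemma odds_le_coupling_on n : forall S J u y, (#|S| < n)%N -> coupling_on J S ->
  u \in S -> y \in S -> u != y -> (forall a b, 0 <= J a b) -> odds_le J u y.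
Proof.
elim: n => // n IHn S J u y /ltnSE Sn JS uS yS uy J0.
have [m] := ubnP (neighbours J u y); elim: m J JS J0 => // m IHm J JS J0 /ltnSE Jm.
have [/card0_eq n0|/card_gt0P[w]] := posnP (neighbours J u y).
  apply: odds_le_isolated => // w wu wy; apply/eqP; have := n0 w.
  by rewrite !inE wu wy /= => /negbFE.
rewrite !inE => /and3P[wu wy jw].
have yw : y != w by rewrite eq_sym.
have uw : u != w by rewrite eq_sym.
have wS : w \in S.
  have [e|nz] := eqVneq (J y w) 0.
    by move: jw; rewrite e add0r => nz; have /andP[] := JS _ _ wy nz.
  by have /andP[] := JS _ _ yw nz.
have dS : coupling_on (del_edge J y w) S.
  by move=> a b ab; rewrite /del_edge; case: ifP; [rewrite eqxx | move=> _; exact: JS].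
have d0 := del_edge_ge0 y w J0.
have Sw v : v \in S -> (#|S :\ v| < n)%N.
  by move=> vS; move: Sn; rewrite (cardsD1 v) vS.
apply: (@odds_le_interpolate _ _ _ w) => //.
- apply: IHm => //; apply: leq_trans Jm; rewrite /neighbours; apply: proper_card; apply/properP; split.
    apply/fintype.subsetP => v; rewrite !inE /del_edge => /and3P[-> vy /=].
    rewrite eqxx (negbTE vy) (negbTE yw) !andbF !orbF !andbT /=.
    by have [_|//] := eqVneq v w; rewrite addr0 eqxx.
  exists w; first by rewrite !inE wu wy jw.
  by rewrite !inE /del_edge !eqxx /= (orbC (_ && _)) ?orbT /= addr0 eqxx !andbF.
- apply: (IHn (S :\ w)) => //; [exact: Sw|exact: coupling_on_merge|..|exact: merge_coupling_ge0].
  + by rewrite !inE uw.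
  + by rewrite !inE yw.
- apply: (IHn (S :\ y)) => //; [exact: Sw|exact: coupling_on_merge|..|exact: merge_coupling_ge0].
  + by rewrite !inE uy.
  + by rewrite !inE wy.
Qed.

Lemma odds_ratio_le_zero_field J u y :
  u != y -> (forall a b, 0 <= J a b) -> odds_le J u y.
Proof.
move=> uy J0.
apply: (@odds_le_coupling_on #|[set: L]%SET|.+1 [set: L]%SET J u y (ltnSn _)); rewrite ?inE//.
by move=> a b _ _; rewrite !inE.
Qed.

End odds_ratio.

(** * From odds ratios to covariances *)

Section covariance.
Variables (R : realType) (L : finType).
Implicit Types (s t : config L) (x y u w : L) (f : config L -> R)
  (J : L -> L -> R) (h : L -> R).
Local Notation spin := (@spin R L).

(** With X = sqrt (ad) and Y = sqrt (bc), a + d >= 2X and b + c >= 2Y bound the left side by (X - Y)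
    / (X + Y), which increases with X / Y <= p / q. *)
Lemma cov_odds_bound (a b c d p q : R) : 0 < a -> 0 < b -> 0 < c -> 0 < d -> 0 < p -> 0 < q ->
  b * c <= a * d -> a * d * q ^+ 2 <= p ^+ 2 * (b * c) ->
  4 * (a * d - b * c) / (a + b + c + d) ^+ 2 <= (p - q) / (p + q).
Proof.
move=> a0 b0 c0 d0 p0 q0 bcad adq.
pose X := Num.sqrt (a * d); pose Y := Num.sqrt (b * c).
have X2 : X ^+ 2 = a * d by rewrite sqr_sqrtr// ltW// mulr_gt0.
have Y2 : Y ^+ 2 = b * c by rewrite sqr_sqrtr// ltW// mulr_gt0.
have X0 : 0 < X by rewrite sqrtr_gt0 mulr_gt0.
have Y0 : 0 < Y by rewrite sqrtr_gt0 mulr_gt0.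
have YX : Y <= X by exact: ler_wsqrtr.
have Xq : X * q <= p * Y.
  apply: le_of_sqr; first by apply/ltW; exact: mulr_gt0.
  by rewrite (exprMn 2 X) (exprMn 2 p) X2 Y2.
have ad2 : 2 * X <= a + d.
  apply: le_of_sqr; first by rewrite addr_ge0// ltW.
  by rewrite exprMn X2 -subr_ge0 (_ : _ - _ = (a - d) ^+ 2) ?sqr_ge0//; ring.
have bc2 : 2 * Y <= b + c.
  apply: le_of_sqr; first by rewrite addr_ge0// ltW.
  by rewrite exprMn Y2 -subr_ge0 (_ : _ - _ = (b - c) ^+ 2) ?sqr_ge0//; ring.
have XY0 : 0 < X + Y by rewrite addr_gt0.
have Z : (2 * (X + Y)) ^+ 2 <= (a + b + c + d) ^+ 2.
  by apply: sqr_homo; [rewrite mulr_ge0// ltW | lra].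
have Z0 : 0 < (2 * (X + Y)) ^+ 2 by rewrite exprn_gt0// mulr_gt0.
apply: (@le_trans _ _ ((X - Y) / (X + Y))).
  rewrite ler_pdivrMr; last exact: lt_le_trans Z.
  have -> : 4 * (a * d - b * c) = (X - Y) / (X + Y) * (2 * (X + Y)) ^+ 2.
    by rewrite -X2 -Y2; field; rewrite gt_eqF.
  by apply: ler_wpM2l => //; rewrite divr_ge0 ?subr_ge0// ltW.
by rewrite ler_pdivrMr// mulrAC ler_pdivlMr ?addr_gt0//; nra.
Qed.

Lemma cls2_gibbs_gt0 J h u y a b : u != y -> 0 < cls2 (gibbs J h) u y a b.
Proof.
move=> uy; pose s0 : config L := [ffun x => if x == u then a else b].
rewrite /cls2 (bigD1 s0) /=; last first.
  by rewrite !ffunE !eqxx [y == u]eq_sym (negbTE uy) !eqxx.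
by rewrite ltr_pwDl ?gibbs_gt0// sumr_ge0// => s _; exact/ltW/gibbs_gt0.
Qed.

Lemma cls2_gibbs0_even J u y a b :
  cls2 (gibbs J (fun=> 0)) u y a b = cls2 (gibbs J (fun=> 0)) u y (~~ a) (~~ b).
Proof.
rewrite !(cls2_split _ u y u) !(gibbs0_even J u y u a b) /=.
by rewrite addrC.
Qed.

Definition gmean J h f : R := (\sum_s f s * gibbs J h s) / \sum_s gibbs J h s.

(** Association makes the covariance of distinct spins nonnegative, which removes the absolute
    value; the odds ratio gives the upper bound. For x = y both claims concern a variance. *)
Lemma gibbs_covariance_bound J h x y : (forall a b, 0 <= J a b) ->
  `|gmean J h (fun s => spin s x * spin s y)
    - gmean J h (fun s => spin s x) * gmean J h (fun s => spin s y)| <=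
  gmean J (fun=> 0) (fun s => spin s x * spin s y).
Proof.
move=> J0.
have Z0 h1 : 0 < \sum_s gibbs J h1 s.
  rewrite (bigD1 [ffun=> true])//= ltr_pwDl ?gibbs_gt0// sumr_ge0// => s _.
  exact/ltW/gibbs_gt0.
have [<-|xy] := eqVneq x y.
  have one h1 : gmean J h1 (fun s => spin s x * spin s x) = 1.
    rewrite /gmean; under eq_bigr do rewrite spin_sqr mul1r.
    by rewrite divff// gt_eqF.
  rewrite !one -expr2 ger0_norm.
    by rewrite gerBl sqr_ge0.
  have : `|gmean J h (fun s => spin s x)| <= 1.
    rewrite /gmean normrM normfV (gtr0_norm (Z0 h)) ler_pdivrMr// mul1r.
    apply: le_trans (ler_norm_sum _ _ _) _; apply: ler_sum => s _.
    rewrite normrM (gtr0_norm (gibbs_gt0 J h s)).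
    apply: ler_piMl; first exact/ltW/gibbs_gt0.
    by rewrite /Defs.spin; case: (s x); rewrite ?normrN1 ?normr1.
  by rewrite ler_norml => /andP[m1 m2]; nra.
pose c h1 := cls2 (gibbs J h1) x y.
pose sp (b : bool) : R := if b then 1 else -1.
have c0 h1 a b : 0 < c h1 a b by exact: cls2_gibbs_gt0.
have s1 h1 : \sum_s spin s x * spin s y * gibbs J h1 s = c h1 true true - c h1 true false
    - c h1 false true + c h1 false false.
  by rewrite (sum_cls2 (fun a b => sp a * sp b) (gibbs J h1) x y) /sp /= /c; ring.
have s2 h1 : \sum_s spin s x * gibbs J h1 s = c h1 true true + c h1 true false
    - c h1 false true - c h1 false false.
  by rewrite (sum_cls2 (fun a b => sp a) (gibbs J h1) x y) /sp /= /c; ring.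
have s3 h1 : \sum_s spin s y * gibbs J h1 s = c h1 true true - c h1 true false
    + c h1 false true - c h1 false false.
  by rewrite (sum_cls2 (fun a b => sp b) (gibbs J h1) x y) /sp /= /c; ring.
have s4 h1 : \sum_s gibbs J h1 s = c h1 true true + c h1 true false
    + c h1 false true + c h1 false false.
  have := sum_cls2 (fun _ _ => 1) (gibbs J h1) x y; rewrite !mul1r => <-.
  by apply: eq_bigr => s _; rewrite mul1r.
have odds := @odds_ratio_le_zero_field R L J x y xy J0 h.
have assoc := @gibbs_pair_association R L J h x y J0.
rewrite /gmean !s1 s2 s3 !s4.
pose z0 : L -> R := fun=> 0.
have e1 : c z0 false false = c z0 true true by rewrite /c cls2_gibbs0_even.
have e2 : c z0 false true = c z0 true false by rewrite /c cls2_gibbs0_even.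
rewrite -/z0 e1 e2 -/(c z0 _ _); move: odds assoc; rewrite -/z0 -!/(c _ _ _).
move: (c0 h true true) (c0 h true false) (c0 h false true) (c0 h false false)
  (c0 z0 true true) (c0 z0 true false).
set a := c h true true; set b := c h true false; set d := c h false true; set e := c h false false.
set p := c z0 true true; set q := c z0 true false => a0 b0 d0 e0 p0 q0 odds assoc.
have -> : (p - q - q + p) / (p + q + q + p) = (p - q) / (p + q).
  by field; apply/andP; split; rewrite gt_eqF ?addr_gt0.
have -> : (a - b - d + e) / (a + b + d + e) -
   (a + b - d - e) / (a + b + d + e) * ((a - b + d - e) / (a + b + d + e)) =
   4 * (a * e - b * d) / (a + b + d + e) ^+ 2.
  by field; rewrite gt_eqF ?addr_gt0.
rewrite ger0_norm; first exact: cov_odds_bound.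
by rewrite mulr_ge0 ?invr_ge0 ?sqr_ge0// mulr_ge0// subr_ge0.
Qed.

(** Each product v_x v_y is replaced by the mean of the squares, and the symmetry of [K] reduces
    both halves to row sums. *)
Lemma schur_test (K C : L -> L -> R) (v : L -> R) (chi : R) :
  (forall x y, K x y = K y x) -> (forall x y, `|C x y| <= K x y) ->
  (forall x, \sum_y K x y <= chi) ->
  \sum_x \sum_y v x * v y * C x y <= chi * \sum_x v x ^+ 2.
Proof.
move=> Ks CK Kchi.
apply: (@le_trans _ _ (\sum_x \sum_y 2^-1 * (v x ^+ 2 + v y ^+ 2) * K x y)).
  apply: ler_sum => x _; apply: ler_sum => y _.
  have := CK x y; rewrite ler_norml => /andP[l1 l2].
  have := sqr_ge0 (v x - v y); have := sqr_ge0 (v x + v y).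
  move: l1 l2; set c := C x y; set k := K x y; set a := v x; set b := v y.
  move=> l1 l2 q1 q2.
  have i1 : 0 <= (a + b) ^+ 2 * (k - c) by rewrite mulr_ge0 ?sqr_ge0// subr_ge0.
  have i2 : 0 <= (a - b) ^+ 2 * (k + c) by rewrite mulr_ge0 ?sqr_ge0// -lerBlDl sub0r.
  by lra.
rewrite (_ : \sum_x _ = \sum_x v x ^+ 2 * \sum_y K x y).
  by rewrite mulr_sumr; apply: ler_sum => x _; rewrite mulrC ler_wpM2r ?sqr_ge0.
have -> : \sum_x \sum_y 2^-1 * (v x ^+ 2 + v y ^+ 2) * K x y =
   2^-1 * (\sum_x \sum_y v x ^+ 2 * K x y) + 2^-1 * (\sum_x \sum_y v y ^+ 2 * K x y).
  rewrite !mulr_sumr -big_split; apply: eq_bigr => x _ /=.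
  by rewrite !mulr_sumr -big_split; apply: eq_bigr => y _ /=; ring.
rewrite [X in _ + _ * X]exchange_big /=.
have -> : \sum_x \sum_y v x ^+ 2 * K y x = \sum_x \sum_y v x ^+ 2 * K x y.
  by apply: eq_bigr => x _; apply: eq_bigr => y _; rewrite Ks.
rewrite -mulrDl (_ : 2^-1 + 2^-1 = 1 :> R) ?mul1r; last by field.
by apply: eq_bigr => x _; rewrite mulr_sumr.
Qed.

End covariance.

Section ising_covariance.
Variables (R : realType) (L : finType) (A : L -> L -> R) (beta : R).
Hypotheses (Aoff : offdiag_nonpos A) (beta0 : 0 <= beta).
Local Notation spin := (@spin R L).

(** The diagonal of [A] contributes only a constant factor, because spins square to 1. *)
Let J x y := if x == y then 0 else - (beta / 2) * A x y.

Let J0 a b : 0 <= J a b.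
Proof.
rewrite /J; case: (eqVneq a b) => // ab; rewrite mulNr -mulrN mulr_ge0 ?divr_ge0//.
by rewrite oppr_ge0; exact: Aoff.
Qed.

Let weightE h s : ising_weight A beta h s =
  expR (- (beta / 2) * \sum_x A x x) * gibbs J h s.
Proof.
rewrite /ising_weight /gibbs /pair_weight [RHS]mulrA -[in RHS]expRD; congr (expR _ * _).
rewrite /inner /matvec !mulr_sumr -big_split /=; apply: eq_bigr => x _.
rewrite mulr_sumr mulr_sumr (bigD1 x)//= [X in _ = _ + X](bigD1 x)//=.
rewrite /J eqxx mul0r add0r; congr (_ + _).
  transitivity (- (beta / 2) * A x x * (spin s x * spin s x)); first by ring.
  by rewrite spin_sqr mulr1.
apply: eq_bigr => y yx; rewrite eq_sym (negbTE yx); ring.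
Qed.

Let expectE h f : expect A beta h f = gmean J h f.
Proof.
rewrite /expect /partition_fn /gmean.
under eq_bigr do rewrite weightE mulrCA.
under [X in _ / X]eq_bigr do rewrite weightE.
by rewrite -!mulr_sumr -mulf_div divff ?mul1r// gt_eqF ?expR_gt0.
Qed.

Lemma ising_covariance_bound h x y :
  `|expect A beta h (fun s => spin s x * spin s y)
    - expect A beta h (fun s => spin s x) * expect A beta h (fun s => spin s y)| <=
  expect A beta (fun=> 0) (fun s => spin s x * spin s y).
Proof. by rewrite !expectE; exact: gibbs_covariance_bound. Qed.

Lemma ising_covariance_form h (v : L -> R) :
  \sum_x \sum_y v x * v y * (expect A beta h (fun s => spin s x * spin s y)
    - expect A beta h (fun s => spin s x) * expect A beta h (fun s => spin s y))
  <= susceptibility A beta * \sum_x v x ^+ 2.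
Proof.
apply: schur_test => [x y|x y|x]; last 1 first.
- exact: (le_bigmax 0 (fun x => \sum_y expect A beta (fun=> 0) (fun c => spin c x * spin c y)) x).
- by congr expect; apply/funext => s; rewrite mulrC.
- exact: ising_covariance_bound.
Qed.

End ising_covariance.

(** * Quadratic forms *)

Section compact_max.
Variables (R : realType) (K : finType).

(** Row vectors carry the topology in which boxes are compact; points of R^K are functions
    elsewhere. *)
Definition of_row (v : 'rV[R]_#|K|) : K -> R := fun k => v ord0 (enum_rank k).
Definition to_row (y : K -> R) : 'rV[R]_#|K| := \row_i y (enum_val i).

Lemma to_rowK y : of_row (to_row y) = y.
Proof. by apply/funext => k; rewrite /of_row mxE enum_rankK. Qed.

Lemma of_row_continuous k : continuous (fun v => of_row v k).
Proof. exact: coord_continuous. Qed.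

(** The constraint [c] serves for the unit sphere in [spectral_bound]; the parabolic maximum
    principle takes it identically 0. *)
Lemma box_max (lo hi : K -> R) (g c : (K -> R) -> R) (y0 : K -> R) :
  continuous (fun v => g (of_row v)) -> continuous (fun v => c (of_row v)) ->
  (forall k, lo k <= y0 k <= hi k) -> c y0 = 0 ->
  exists y1, [/\ (forall k, lo k <= y1 k <= hi k), c y1 = 0 &
    forall y, (forall k, lo k <= y k <= hi k) -> c y = 0 -> g y <= g y1].
Proof.
move=> cg cc y0b cy0.
pose B : set 'rV[R]_#|K| :=
  [set v | forall i, `[lo (enum_val i), hi (enum_val i)]%classic (v ord0 i)].
pose C : set 'rV[R]_#|K| := [set v | c (of_row v) = 0].
have Bc : compact B.
  exact: (@rV_compact R #|K| (fun i => `[lo (enum_val i), hi (enum_val i)]%classic)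
    (fun i => @segment_compact _ _ _)).
have Cc : closed C.
  have := (continuous_closedP _).1 cc [set 0].
  by apply; exact: closed_eq.
have BC : compact (B `&` C) by exact: compact_closedI.
have Bof y : (forall k, lo k <= y k <= hi k) -> B (to_row y).
  by move=> h i /=; rewrite in_itv/= mxE; exact: h.
have BC0 : B `&` C !=set0.
  by exists (to_row y0); split; [exact: Bof | rewrite /C /= to_rowK].
have gw : {within B `&` C, continuous (fun v => g (of_row v))}.
  exact: continuous_subspaceT.
have [v] := compact_EVT_max BC0 BC gw.
rewrite inE => -[vB vC] vmax; exists (of_row v); split => //.
  by move=> k; have := vB (enum_rank k); rewrite /= in_itv/= enum_rankK.
move=> y yb cy; have := vmax (to_row y); rewrite to_rowK; apply.
by rewrite inE; split; [exact: Bof | rewrite /C /= to_rowK].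
Qed.

End compact_max.

Section quadratic_forms.
Variables (R : realType) (L : finType).
Implicit Types (A B : L -> L -> R) (v w : L -> R).

Definition bform B v w := \sum_x \sum_y B x y * v x * w y.

Lemma bform_inner B v w : bform B v w = inner v (matvec B w).
Proof.
by apply: eq_bigr => x _; rewrite mulr_sumr; apply: eq_bigr => y _; ring.
Qed.

Lemma bformC B v w : sym_mx B -> bform B v w = bform B w v.
Proof.
move=> Bs; rewrite /bform exchange_big; apply: eq_bigr => x _; apply: eq_bigr => y _ /=.
by rewrite Bs; ring.
Qed.

Lemma bform_line B v w (t : R) : sym_mx B ->
  bform B (fun x => v x + t * w x) (fun x => v x + t * w x) =
  bform B v v + 2 * t * bform B w v + t ^+ 2 * bform B w w.
Proof.
move=> Bs; have -> : 2 * t * bform B w v = t * bform B w v + t * bform B v w.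
  by rewrite (bformC v w Bs); ring.
rewrite /bform !mulr_sumr -!big_split /=; apply: eq_bigr => x _.
by rewrite !mulr_sumr -!big_split /=; apply: eq_bigr => y _; ring.
Qed.

Definition delta x : L -> R := fun y => if y == x then 1 else 0.

Lemma sum_delta x (g : L -> R) : \sum_y delta x y * g y = g x.
Proof.
rewrite (bigD1 x)//= /delta eqxx mul1r big1 ?addr0// => y /negbTE ->.
by rewrite mul0r.
Qed.

Lemma bform_delta B x v : bform B (delta x) v = \sum_y B x y * v y.
Proof. by rewrite bform_inner /inner sum_delta. Qed.

(* A quadratic [a t^2 + 2 b t >= 0] forces [b = 0]. *)
Lemma isotropic_kernel B v w : sym_mx B -> (forall u, 0 <= bform B u u) ->
  bform B v v = 0 -> bform B w v = 0.
Proof.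
move=> Bs B0 Bv; set b := bform B w v; set a := bform B w w.
have a0 : 0 <= a by exact: B0.
have h t : 0 <= 2 * t * b + t ^+ 2 * a.
  by have := B0 (fun x => v x + t * w x); rewrite bform_line// Bv add0r.
apply/eqP/negPn/negP => b0.
have := h (- b / (1 + a)); have a1 : 0 < 1 + a by lra.
have -> : 2 * (- b / (1 + a)) * b + (- b / (1 + a)) ^+ 2 * a =
   - (b ^+ 2 * (2 + a)) / (1 + a) ^+ 2 by field; rewrite gt_eqF.
rewrite leNgt => /negP; apply; rewrite mulNr oppr_lt0 divr_gt0 ?exprn_gt0//.
by rewrite mulr_gt0; [by []| |lra]; rewrite exprn_even_gt0.
Qed.

(** Symmetric elimination: each step splits off the rank-one part at a pivot [x0] and continues with
    the Schur complement [B'], supported on one index less. *)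
Lemma psd_decomposition_on n : forall (S : {set L}) B, (#|S| < n)%N ->
  (forall x y, x \notin S -> B x y = 0) -> sym_mx B -> (forall v, 0 <= bform B v v) ->
  exists2 b : L -> L -> R, (forall k x, k \notin S -> b k x = 0) &
    forall x y, B x y = \sum_k b k x * b k y.
Proof.
elim: n => // n IH S B /ltnSE Sn BS Bs B0.
have [S0|[x0 x0S]] := set_0Vmem S.
  exists (fun _ _ => 0) => // x y; rewrite big1; last by move=> *; rewrite mul0r.
  by apply: BS; rewrite S0 inE.
have Sn' : (#|S :\ x0| < n)%N by move: Sn; rewrite (cardsD1 x0) x0S.
have d0 : bform B (delta x0) (delta x0) = B x0 x0.
  rewrite bform_delta -[RHS](sum_delta x0 (fun y => B x0 y)).
  by apply: eq_bigr => y _; rewrite mulrC.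
(* A zero pivot makes [delta x0] isotropic, so its whole row vanishes and nothing has to be split
   off. *)
have [B00|B00] := eqVneq (B x0 x0) 0.
  have row0 y : B x0 y = 0.
    have := @isotropic_kernel B (delta x0) (delta y) Bs B0.
    rewrite d0 B00 => /(_ erefl); rewrite bform_delta Bs => <-.
    rewrite -[LHS](sum_delta x0 (fun z => B y z)).
    by apply: eq_bigr => z _; rewrite mulrC.
  have [|b bS bE] := IH (S :\ x0) B Sn' _ Bs B0.
    by move=> x y; rewrite !inE negb_and negbK => /orP[/eqP ->//|]; exact: BS.
  by exists b => // k x kS; apply: bS; rewrite !inE (negbTE kS) andbF.
have Bp : 0 < B x0 x0 by rewrite lt_neqAle eq_sym B00 -d0 B0.
pose B' x y := B x y - B x0 x * B x0 y / B x0 x0.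
have [||v|b bS bE] := IH (S :\ x0) B' Sn'.
- move=> x y; rewrite !inE negb_and negbK /B' => /orP[/eqP ->|xS].
    by rewrite mulrC mulKf// subrr.
  by rewrite BS// (Bs x0 x) BS// !mul0r subrr.
- by move=> x y; rewrite /B' Bs [B x0 x * _]mulrC.
- pose c := \sum_y B x0 y * v y.
  have -> : bform B' v v = bform B v v - c ^+ 2 / B x0 x0.
    rewrite /bform [c ^+ 2]expr2 {1}/c !mulr_suml -sumrN -big_split /=; apply: eq_bigr => x _.
    rewrite -mulrA /c mulr_suml mulr_sumr -sumrN -big_split /=; apply: eq_bigr => y _.
    by rewrite /B'; field.
  (* The coefficient minimises [B] along the line through [v] in direction [delta x0]; the minimum
     is the value of [B'] at [v]. *)
  have := B0 (fun x => v x + (- c / B x0 x0) * delta x0 x).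
  rewrite bform_line// bform_delta -/c d0; congr (0 <= _).
  by field.
exists (fun k x => if k == x0 then B x0 x / Num.sqrt (B x0 x0) else b k x).
  move=> k x kS; case: eqP => [kx|_]; first by rewrite kx x0S in kS.
  by apply: bS; rewrite !inE (negbTE kS) andbF.
move=> x y; rewrite (bigD1 x0)//= eqxx.
have bx0 z : b x0 z = 0 by apply: bS; rewrite !inE eqxx.
rewrite (eq_bigr (fun k => b k x * b k y)); last by move=> k /negbTE ->.
have := bE x y; rewrite (bigD1 x0)//= bx0 mul0r add0r => <-.
have s2 : Num.sqrt (B x0 x0) ^+ 2 = B x0 x0 by rewrite sqr_sqrtr// ltW.
have s0 : Num.sqrt (B x0 x0) != 0 by rewrite gt_eqF// sqrtr_gt0.
rewrite /B' -{3}s2; field; exact: s0.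
Qed.

Lemma psd_decomposition B : sym_mx B -> (forall v, 0 <= bform B v v) ->
  exists b : L -> L -> R, forall x y, B x y = \sum_k b k x * b k y.
Proof.
move=> Bs B0.
have [|b _ bE] := @psd_decomposition_on #|[set: L]%SET|.+1 [set: L]%SET B (ltnSn _) _ Bs B0.
  by move=> x y; rewrite inE.
by exists b.
Qed.

(** A maximiser [w] of the Rayleigh quotient is an eigenvector: lam - A is nonnegative and isotropic
    at [w], so [w] lies in its kernel. A maximum above 1 contradicts the spectral radius. *)
Lemma spectral_bound A v : sym_mx A -> spec_rad_le1 A ->
  inner v (matvec A v) <= inner v v.
Proof.
move=> As Ar; rewrite leNgt; apply/negP => vA.
pose n2 (w : L -> R) := \sum_x w x ^+ 2.
have n2E w : inner w w = n2 w by apply: eq_bigr => x _; rewrite expr2.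
rewrite n2E -bform_inner in vA.
have n20 w : 0 <= n2 w by apply: sumr_ge0 => x _; exact: sqr_ge0.
have n2Z (t : R) w : n2 (fun x => t * w x) = t ^+ 2 * n2 w.
  by rewrite /n2 mulr_sumr; apply: eq_bigr => x _; rewrite exprMn.
have bZ (t : R) w : bform A (fun x => t * w x) (fun x => t * w x) = t ^+ 2 * bform A w w.
  rewrite /bform mulr_sumr; apply: eq_bigr => x _; rewrite mulr_sumr.
  by apply: eq_bigr => y _; ring.
have n2_eq0 w : n2 w = 0 -> w = fun=> 0.
  move=> /eqP; rewrite psumr_eq0; last by move=> x _; exact: sqr_ge0.
  move=> /allP h; apply/funext => x; apply/eqP; rewrite -sqrf_eq0.
  by apply: h; rewrite mem_index_enum.
have n2v : 0 < n2 v.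
  rewrite lt_neqAle eq_sym n20 andbT; apply/eqP => /n2_eq0 v0.
  by move: vA; rewrite v0 /n2 /bform !big1 ?ltxx// => x _; rewrite ?big1 ?expr0n// => y _; rewrite mulr0.
pose v1 x := (Num.sqrt (n2 v))^-1 * v x.
have n2v1 : n2 v1 = 1 by rewrite n2Z exprVn sqr_sqrtr ?n20// mulVf// gt_eqF.
have unit_box w : n2 w = 1 -> forall x, -1 <= w x <= 1.
  move=> w1 x; rewrite -ler_norml -[leRHS]normr1 -ler_sqr ?nnegrE// ?normr_ge0//.
  rewrite !real_normK ?num_real// expr1n -w1 /n2 (bigD1 x)//= lerDl.
  by apply: sumr_ge0 => y _; exact: sqr_ge0.
have cb : continuous (fun u => bform A (of_row u) (of_row u)).
  apply: ct_sum => x; apply: ct_sum => y; apply: ct_mul; last exact: of_row_continuous.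
  by apply: ct_mul; [exact: ct_cst | exact: of_row_continuous].
have cn : continuous (fun u => n2 (of_row u) - 1).
  apply: ct_sub; last exact: ct_cst.
  by apply: ct_sum => x; apply: ct_sqr; exact: of_row_continuous.
have [|w [_ w1 wmax]] := @box_max R L (fun=> -1) (fun=> 1) (fun u => bform A u u)
   (fun u => n2 u - 1) v1 cb cn (unit_box _ n2v1).
  by rewrite n2v1 subrr.
have {}w1 : n2 w = 1 by apply/eqP; rewrite -subr_eq0 w1.
pose lam := bform A w w.
have lam1 : 1 < lam.
  have : bform A v1 v1 <= lam.
    by apply: wmax; [exact: unit_box | rewrite n2v1 subrr].
  apply: lt_le_trans; rewrite bZ exprVn sqr_sqrtr ?n20// mulrC ltr_pdivlMr//.
  by rewrite mul1r.
have Abound u : bform A u u <= lam * n2 u.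
  have [/n2_eq0 ->|nu] := eqVneq (n2 u) 0.
    by rewrite /n2 /bform !big1 ?mulr0// => x _; rewrite ?big1 ?expr0n// => y _; rewrite mulr0.
  have nu0 : 0 < n2 u by rewrite lt_neqAle eq_sym nu n20.
  pose u1 x := (Num.sqrt (n2 u))^-1 * u x.
  have n2u1 : n2 u1 = 1 by rewrite n2Z exprVn sqr_sqrtr ?n20// mulVf.
  have : bform A u1 u1 <= lam.
    by apply: wmax; [exact: unit_box | rewrite n2u1 subrr].
  by rewrite bZ exprVn sqr_sqrtr ?n20// mulrC ler_pdivrMr.
pose M x y := lam * delta x y - A x y.
have ME u u' : bform M u u' = lam * (\sum_x u x * u' x) - bform A u u'.
  rewrite /bform mulr_sumr -sumrN -big_split /=; apply: eq_bigr => x _.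
  rewrite -sumrN -(sum_delta x (fun y => u x * u' y)) mulr_sumr -big_split /=.
  by apply: eq_bigr => y _; rewrite /M; ring.
have n2S u : \sum_x u x * u x = n2 u by apply: eq_bigr => x _; rewrite expr2.
have Ms : sym_mx M by move=> x y; rewrite /M As /delta eq_sym.
have M0 u : 0 <= bform M u u by rewrite ME n2S subr_ge0.
have Mw : bform M w w = 0 by rewrite ME n2S w1 mulr1 subrr.
have wn0 : exists x, w x != 0.
  apply/existsP; apply: contraT; rewrite negb_exists => /forallP w0.
  have : n2 w = 0.
    by rewrite /n2 big1// => x _; move: (w0 x); rewrite negbK => /eqP ->; rewrite expr0n.
  by rewrite w1 => /eqP; rewrite oner_eq0.
have : `|lam| <= 1.
  apply: (Ar lam w wn0) => x.
  have := @isotropic_kernel M w (delta x) Ms M0 Mw.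
  by rewrite ME sum_delta bform_delta => /eqP; rewrite subr_eq0 => /eqP ->.
by rewrite ger0_norm ?(ltW (lt_trans ltr01 lam1))// leNgt lam1.
Qed.

End quadratic_forms.

(** * The parabolic maximum principle *)

Section parabolic.
Variables (R : realType) (K : finType) (beta : R).
Hypothesis beta0 : 0 <= beta.
Implicit Types (y : K -> R) (s t : R).

Definition upd y k t : K -> R := fun j => if j == k then t else y j.

Lemma upd_id y k : upd y k (y k) = y.
Proof. by apply/funext => j; rewrite /upd; case: eqP => [->|]. Qed.

Lemma upd_same y k t : upd y k t k = t.
Proof. by rewrite /upd eqxx. Qed.

Lemma sum_upd_sqr y k t :
  \sum_j upd y k t j ^+ 2 = t ^+ 2 + (\sum_j y j ^+ 2 - y k ^+ 2).
Proof.
rewrite (bigD1 k)//= upd_same [in RHS](bigD1 k)//= addrAC subrr add0r; congr (_ + _).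
by apply: eq_bigr => j /negbTE jk; rewrite /upd jk.
Qed.

Definition clamp s := Num.max 0 (Num.min s beta).

Lemma clamp_in s : 0 <= clamp s <= beta.
Proof. by rewrite /clamp le_max lexx/= ge_max beta0 ge_min lexx orbT. Qed.

Lemma clamp_id s : 0 <= s <= beta -> clamp s = s.
Proof. by move=> /andP[s0 sb]; rewrite /clamp min_l// max_r. Qed.

Lemma clamp_continuous : continuous clamp.
Proof.
move=> s; rewrite /clamp; apply: (@continuous_max R R (fun=> 0) (fun s => Num.min s beta)).
  exact: cst_continuous.
by apply: (@continuous_min R R id (fun=> beta)); [by move=> ?; exact: cvg_id | exact: cst_continuous].
Qed.

(* A function of time and space bundled with candidates for its time derivative and its
   first and second space derivatives; [jet_ok] certifies them. *)
Record jet := Jet {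
  jf : R -> (K -> R) -> R;
  jt : R -> (K -> R) -> R;
  j1 : K -> R -> (K -> R) -> R;
  j2 : K -> R -> (K -> R) -> R }.

(* Joint continuity on [0, beta] x R^K; [clamp] makes it a statement on the whole space. *)
Definition jcont (f : R -> (K -> R) -> R) :=
  continuous (fun v : 'rV[R]_#|{: option K}| =>
    f (clamp (of_row v None)) (fun k => of_row v (Some k))).

Definition jet_ok (a : jet) := [/\ jcont (jf a),
  forall s y, 0 < s -> s <= beta -> is_derive s 1 (fun t : R => jf a t y) (jt a s y),
  forall k s y t, is_derive t 1 (fun t : R => jf a s (upd y k t)) (j1 a k s (upd y k t)) &
  forall k s y t, is_derive t 1 (fun t : R => j1 a k s (upd y k t)) (j2 a k s (upd y k t))].

Definition heat (m : K -> R -> (K -> R) -> R) (a : jet) s y :=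
  jt a s y - \sum_k (2^-1 * j2 a k s y + m k s y * j1 a k s y).

(* If [a] is positive somewhere, [a - e * exp (c s) * (1 + |y|^2)] still is, for small [e];
   for large [c] it is a strict subsolution, and it is negative outside a large box, so its
   maximum over the box contradicts the derivative tests. *)
Lemma parabolic_max (m : K -> R -> (K -> R) -> R) (a : jet) (M C : R) :
  jet_ok a -> 0 <= M ->
  (forall k s y, 0 <= s -> s <= beta -> `|m k s y| <= M) ->
  (forall s y, 0 <= s -> s <= beta -> jf a s y <= C) ->
  (forall y, jf a 0 y <= 0) ->
  (forall s y, 0 < s -> s <= beta -> heat m a s y <= 0) ->
  forall s y, 0 <= s -> s <= beta -> jf a s y <= 0.
Proof.
move=> [ac at_ a1 a2] M0 mM aC ai ah s0 y0 s00 s0b; rewrite leNgt; apply/negP => d0.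
set d := jf a s0 y0 in d0.
pose n2 y := \sum_k y k ^+ 2.
have n20 y : 0 <= n2 y by apply: sumr_ge0 => k _; exact: sqr_ge0.
(* Per coordinate, half the second derivative costs 1 and the drift at most M + M, in units of e E
   (1 + |y|^2); the final 1 makes the inequality strict. *)
pose c : R := \sum_(k : K) (1 + M + M) + 1.
have c0 : 0 < c.
  by rewrite /c ltr_wpDl// sumr_ge0// => k _; lra.
pose w0 := expR (c * s0) * (1 + n2 y0).
have w00 : 0 < w0 by rewrite mulr_gt0 ?expR_gt0// ltr_pwDl.
(* The penalty at (s0, y0) is exactly d / 2, so [w] stays positive there. *)
pose e : R := d / (2 * w0).
have e0 : 0 < e by rewrite divr_gt0// mulr_gt0.
(* The term [|C| / e] makes the penalty exceed [C] on the spatial faces of the box; [n2 y0] puts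
   [y0] inside it. *)
pose rad : R := 1 + `|C| / e + n2 y0.
have Ce : 0 <= `|C| / e by rewrite divr_ge0 ?normr_ge0// ltW.
have rad1 : 1 <= rad by rewrite /rad; have := n20 y0; lra.
pose w s y := jf a s y - e * (expR (c * s) * (1 + n2 y)).
(* [None] is the time coordinate. *)
pose lo (o : option K) := if o is Some _ then - rad else 0.
pose hi (o : option K) : R := if o is Some _ then rad else beta.
pose g (z : option K -> R) := w (clamp (z None)) (fun k => z (Some k)).
have gc : continuous (fun v => g (of_row v)).
  apply: ct_sub; first exact: ac.
  have cc : continuous (fun v : 'rV[R]_#|{: option K}| => clamp (of_row v None)).
    apply: ct_comp; last exact: of_row_continuous.
    by move=> v; exact: clamp_continuous.
  apply: ct_mul; first exact: ct_cst.
  apply: ct_mul.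
    apply: (@ct_comp _ _ expR); first by move=> v; exact: continuous_expR.
    by apply: ct_mul; [exact: ct_cst | exact: cc].
  apply: ct_add; first exact: ct_cst.
  by apply: ct_sum => k; apply: ct_sqr; exact: of_row_continuous.
pose z0 (o : option K) := if o is Some k then y0 k else s0.
have yk y k : y k ^+ 2 <= n2 y.
  by rewrite /n2 (bigD1 k)//= lerDl; apply: sumr_ge0 => j _; exact: sqr_ge0.
have y0rad k : - rad <= y0 k <= rad.
  have := yk y0 k; have := sqr_ge0 (y0 k - 1); have := sqr_ge0 (y0 k + 1).
  by rewrite /rad => h1 h2 h3; apply/andP; split; nra.
have z0b o : lo o <= z0 o <= hi o by case: o => [k|] //=; rewrite s00 s0b.
have [z [zb _ zmax]] := @box_max R _ lo hi g (fun=> 0) z0 gc (@ct_cst R _ 0) z0b erefl.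
pose s := z None; pose y k := z (Some k).
have sb : 0 <= s <= beta := zb None.
have ylo k : - rad <= y k <= rad := zb (Some k).
have wmax s' y' : 0 <= s' <= beta -> (forall k, - rad <= y' k <= rad) -> w s' y' <= w s y.
  move=> s'b y'b.
  have := zmax (fun o => if o is Some k then y' k else s').
  by rewrite /g !clamp_id//; apply=> //; case.
have wpos : 0 < w s y.
  apply: lt_le_trans (wmax s0 y0 _ _) => //; last by rewrite s00 s0b.
  rewrite /w -/d -/w0; have -> : e * w0 = d / 2.
    by rewrite /e; field; rewrite gt_eqF.
  lra.
have [s_ge0 s_leb] := andP sb.
have ex1 : 1 <= expR (c * s) by rewrite -expR0 ler_expR mulr_ge0// ltW.
have radC : C < e * (1 + rad ^+ 2).
  have r2 : rad <= rad ^+ 2 by nra.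
  have rC : `|C| <= e * rad.
    have -> : `|C| = e * (`|C| / e) by field; rewrite gt_eqF.
    by rewrite ler_pM2l// /rad; have := n20 y0; lra.
  have := ler_norm C; nra.
have yin k : - rad < y k /\ y k < rad.
  have : y k ^+ 2 < rad ^+ 2.
    rewrite ltNge; apply/negP => ry.
    have : w s y <= C - e * (1 + rad ^+ 2).
      apply: lerB; first exact: aC.
      rewrite ler_pM2l//; have := yk y k; have := n20 y; nra.
    lra.
  have := ylo k => /andP[]; split; nra.
have s_gt0 : 0 < s.
  rewrite lt_neqAle eq_sym s_ge0 andbT; apply/eqP => sE.
  have : w s y <= 0.
    rewrite /w sE; have := ai y; have := n20 y; rewrite mulr0 expR0 => ny ay.
    have : 0 <= e * (1 * (1 + n2 y)) by rewrite mul1r mulr_ge0// ?ltW//; lra.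
    lra.
  lra.
pose E := expR (c * s).
have E0 : 0 < E by exact: expR_gt0.
have wt : 0 <= jt a s y - e * (E * c * (1 + n2 y)).
  apply: (@max_derive_left _ (fun t => w t y) s _ 0) => //; last first.
    by move=> t t0 ts; apply: wmax => //; rewrite (ltW t0) (le_trans ts).
  apply: dv_sub; first exact: at_.
  apply: dv_scale.
  apply: is_derive_eq (dv_mul (dv_expR (dv_scale c (dv_id s))) (dv_cst (1 + n2 y) s)) _.
  by rewrite /E; ring.
have wk k : j1 a k s y = 2 * e * E * y k /\ j2 a k s y <= 2 * e * E.
  have [ylk yrk] := yin k.
  have [] := @max_second_derive _ (fun t => w s (upd y k t))
     (fun t => j1 a k s (upd y k t) - 2 * e * E * t) (j2 a k s y - 2 * e * E) (- rad) rad (y k) ylk yrk.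
  - move=> t.
    have nE : (fun t => n2 (upd y k t)) = fun t => t ^+ 2 + (n2 y - y k ^+ 2).
      by apply/funext => t'; exact: sum_upd_sqr.
    have dn : is_derive t 1 (fun t => n2 (upd y k t)) (2 * t * 1 + 0).
      by rewrite nE; exact: dv_add (dv_sqr (dv_id t)) (dv_cst _ t).
    have dw := dv_sub (a1 k s y t) (dv_scale e (dv_scale E (dv_add (dv_cst 1 t) dn))).
    by apply: is_derive_eq dw _; ring.
  - have := a2 k s y (y k); rewrite upd_id => d2.
    by apply: is_derive_eq (dv_sub d2 (dv_scale (2 * e * E) (dv_id (y k)))) _; rewrite mulr1.
  - move=> t tl tr; rewrite upd_id; apply: wmax => // j.
    by rewrite /upd; case: eqP => // _; rewrite !ltW.
  by rewrite upd_id => h1 h2; split; lra.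
have := ah s y s_gt0 s_leb; rewrite /heat leNgt => /negP; apply; rewrite subr_gt0.
apply: (@le_lt_trans _ _ (e * E * (\sum_(k : K) (1 + M + M) * (1 + n2 y)))).
  rewrite mulr_sumr; apply: ler_sum => k _.
  have [-> h2] := wk k.
  have eE : 0 < e * E by exact: mulr_gt0.
  have : m k s y * (2 * y k) <= M * (1 + n2 y).
    have := yk y k; have := mM k s y s_ge0 s_leb; rewrite ler_norml => /andP[m1 m2] y2.
    have h1 : 0 <= (M - m k s y) * (1 + y k) ^+ 2 by rewrite mulr_ge0 ?sqr_ge0// subr_ge0.
    have h2' : 0 <= (M + m k s y) * (1 - y k) ^+ 2 by rewrite mulr_ge0 ?sqr_ge0//; lra.
    have : m k s y * (2 * y k) <= M * (1 + y k ^+ 2) by lra.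
    have : M * (1 + y k ^+ 2) <= M * (1 + n2 y) by rewrite ler_wpM2l// lerD2l.
    lra.
  move=> h; have : 2^-1 * j2 a k s y <= e * E by lra.
  move=> h3; have : m k s y * (2 * e * E * y k) = e * E * (m k s y * (2 * y k)) by ring.
  move=> ->; rewrite -(ler_pM2l eE) in h.
  apply: (le_trans (lerD h3 h)); rewrite -[X in X + _]mulr1 -mulrDr ler_pM2l//.
  have : 0 <= M * (1 + n2 y) by rewrite mulr_ge0// addr_ge0.
  have := n20 y; lra.
have {wt}: e * (E * c * (1 + n2 y)) <= jt a s y by lra.
apply: lt_le_trans; rewrite -mulr_suml.
have -> : e * (E * c * (1 + n2 y)) = e * E * ((\sum_(k : K) (1 + M + M)) * (1 + n2 y)) + e * E * (1 + n2 y).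
  by rewrite /c; ring.
by rewrite ltrDl; apply: mulr_gt0; [exact: mulr_gt0 | have := n20 y; lra].
Qed.

End parabolic.

(** * Algebra and chain rules for jets *)

Section jet_calculus.
Variables (R : realType) (K : finType) (beta : R).
Implicit Types (y : K -> R) (s t : R) (a b : jet R K).
Local Notation jet_ok := (@jet_ok R K beta).
Local Notation jcont := (@jcont R K beta).

Definition jtime (p p' : R -> R) : jet R K :=
  Jet (fun s _ => p s) (fun s _ => p' s) (fun _ _ _ => 0) (fun _ _ _ => 0).

Definition jsub a b : jet R K := Jet (fun s y => jf a s y - jf b s y)
  (fun s y => jt a s y - jt b s y) (fun k s y => j1 a k s y - j1 b k s y)
  (fun k s y => j2 a k s y - j2 b k s y).

Definition jmul a b : jet R K := Jet (fun s y => jf a s y * jf b s y)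
  (fun s y => jt a s y * jf b s y + jf a s y * jt b s y)
  (fun k s y => j1 a k s y * jf b s y + jf a s y * j1 b k s y)
  (fun k s y => (j2 a k s y * jf b s y + j1 a k s y * j1 b k s y)
     + (j1 a k s y * j1 b k s y + jf a s y * j2 b k s y)).

Definition jsum (I : finType) (a : I -> jet R K) : jet R K :=
  Jet (fun s y => \sum_i jf (a i) s y) (fun s y => \sum_i jt (a i) s y)
  (fun k s y => \sum_i j1 (a i) k s y) (fun k s y => \sum_i j2 (a i) k s y).

Definition jcomp (p p1 p2 : R -> R) a : jet R K := Jet (fun s y => p (jf a s y))
  (fun s y => p1 (jf a s y) * jt a s y) (fun k s y => p1 (jf a s y) * j1 a k s y)
  (fun k s y => p2 (jf a s y) * j1 a k s y * j1 a k s y + p1 (jf a s y) * j2 a k s y).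

Lemma jtime_ok (p p' : R -> R) : continuous (fun s => p (clamp beta s)) ->
  (forall s, 0 < s -> s <= beta -> is_derive s 1 p (p' s)) -> jet_ok (jtime p p').
Proof.
move=> pc pd; split => /=.
- apply: (@ct_comp _ _ (fun s => p (clamp beta s))); last exact: of_row_continuous.
  by move=> v; exact: pc.
- by move=> s _; exact: pd.
- by move=> k s y t; exact: dv_cst.
- by move=> k s y t; exact: dv_cst.
Qed.

Lemma jsub_ok a b : jet_ok a -> jet_ok b -> jet_ok (jsub a b).
Proof.
move=> [ac at_ a1 a2] [bc bt b1 b2]; split => /=.
- exact: ct_sub.
- by move=> s y s0 sb; exact: dv_sub (at_ s y s0 sb) (bt s y s0 sb).
- by move=> k s y t; exact: dv_sub (a1 k s y t) (b1 k s y t).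
- by move=> k s y t; exact: dv_sub (a2 k s y t) (b2 k s y t).
Qed.

Lemma jmul_ok a b : jet_ok a -> jet_ok b -> jet_ok (jmul a b).
Proof.
move=> [ac at_ a1 a2] [bc bt b1 b2]; split => /=.
- exact: ct_mul.
- by move=> s y s0 sb; exact: dv_mul (at_ s y s0 sb) (bt s y s0 sb).
- by move=> k s y t; exact: dv_mul (a1 k s y t) (b1 k s y t).
- move=> k s y t.
  exact: dv_add (dv_mul (a2 k s y t) (b1 k s y t)) (dv_mul (a1 k s y t) (b2 k s y t)).
Qed.

Lemma jsum_ok (I : finType) (a : I -> jet R K) :
  (forall i, jet_ok (a i)) -> jet_ok (jsum a).
Proof.
move=> aok; split => /=.
- by apply: ct_sum => i; have [] := aok i.
- by move=> s y s0 sb; apply: dv_sum => i; have [_ h _ _] := aok i; exact: h.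
- by move=> k s y t; apply: dv_sum => i; have [_ _ h _] := aok i; exact: h.
- by move=> k s y t; apply: dv_sum => i; have [_ _ _ h] := aok i; exact: h.
Qed.

Lemma dv_comp (p f : R -> R) (dp df t : R) : is_derive (f t) 1 p dp -> is_derive t 1 f df ->
  is_derive t 1 (fun t => p (f t)) (dp * df).
Proof. by move=> hp hf; apply: is_derive_eq (is_derive1_comp hp hf) _; rewrite mulrC. Qed.

Lemma jcomp_ok (p p1 p2 : R -> R) a : jet_ok a -> (forall s y, 0 < jf a s y) ->
  (forall x : R, 0 < x -> is_derive x 1 p (p1 x)) ->
  (forall x : R, 0 < x -> is_derive x 1 p1 (p2 x)) -> jet_ok (jcomp p p1 p2 a).
Proof.
move=> [ac at_ a1 a2] a0 dp dp1; split => /=.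
- by apply: ct_comp ac => v; exact: dv_continuous (dp _ (a0 _ _)).
- by move=> s y s0 sb; exact: dv_comp (dp _ (a0 _ _)) (at_ s y s0 sb).
- by move=> k s y t; exact: (@dv_comp p _ _ _ t (dp _ (a0 _ _)) (a1 k s y t)).
- move=> k s y t.
  exact: dv_mul (@dv_comp p1 _ _ _ t (dp1 _ (a0 _ _)) (a1 k s y t)) (a2 k s y t).
Qed.

Variable m : K -> R -> (K -> R) -> R.
Local Notation heat := (heat m).

Lemma heat_time p p' s y : heat (jtime p p') s y = p' s.
Proof. by rewrite /heat big1 ?subr0//= => k _; rewrite !mulr0 addr0. Qed.

Lemma heat_sub a b s y : heat (jsub a b) s y = heat a s y - heat b s y.
Proof.
rewrite /heat /=.
have -> : \sum_k (2^-1 * (j2 a k s y - j2 b k s y) + m k s y * (j1 a k s y - j1 b k s y)) =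
  \sum_k (2^-1 * j2 a k s y + m k s y * j1 a k s y) -
  \sum_k (2^-1 * j2 b k s y + m k s y * j1 b k s y).
  by rewrite -sumrB; apply: eq_bigr => k _; ring.
by ring.
Qed.

(** The Leibniz defect comes from the second-order part alone; the drift is a derivation. *)
Lemma heat_mul a b s y : heat (jmul a b) s y =
  heat a s y * jf b s y + jf a s y * heat b s y - \sum_k j1 a k s y * j1 b k s y.
Proof.
rewrite /heat /=.
have -> : \sum_k (2^-1 * (j2 a k s y * jf b s y + j1 a k s y * j1 b k s y +
    (j1 a k s y * j1 b k s y + jf a s y * j2 b k s y)) +
    m k s y * (j1 a k s y * jf b s y + jf a s y * j1 b k s y)) =
  (\sum_k (2^-1 * j2 a k s y + m k s y * j1 a k s y)) * jf b s y +
  jf a s y * (\sum_k (2^-1 * j2 b k s y + m k s y * j1 b k s y)) +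
  \sum_k j1 a k s y * j1 b k s y.
  by rewrite mulr_suml mulr_sumr -!big_split /=; apply: eq_bigr => k _; field.
by ring.
Qed.

Lemma heat_sum (I : finType) (a : I -> jet R K) s y :
  heat (jsum a) s y = \sum_i heat (a i) s y.
Proof.
rewrite /heat /= sumrB; congr (_ - _); rewrite exchange_big /=.
by apply: eq_bigr => k _; rewrite !mulr_sumr -big_split.
Qed.

Lemma heat_comp p p1 p2 a s y : heat (jcomp p p1 p2 a) s y =
  p1 (jf a s y) * heat a s y - 2^-1 * p2 (jf a s y) * \sum_k j1 a k s y ^+ 2.
Proof.
rewrite /heat /= mulrBr -addrA -opprD; congr (_ - _).
by rewrite !mulr_sumr -big_split /=; apply: eq_bigr => k _; ring.
Qed.

End jet_calculus.

(** * Flow of Ising expectations *)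

Section expectation.
Variables (R : realType) (L : finType) (A : L -> L -> R) (s : R) (h : L -> R).
Implicit Types (f g : config L -> R).
Local Notation E := (expect A s h).

Lemma ising_weight_gt0 (c : config L) : 0 < ising_weight A s h c.
Proof. by rewrite mulr_gt0 ?expR_gt0. Qed.

Lemma partition_fn_gt0 : 0 < partition_fn A s h.
Proof.
rewrite /partition_fn (bigD1 [ffun=> true])//= ltr_pwDl ?ising_weight_gt0//.
by apply: sumr_ge0 => c _; apply/ltW/ising_weight_gt0.
Qed.

Lemma expect_cst (c : R) : E (fun=> c) = c.
Proof.
by rewrite /expect -mulr_sumr -/(partition_fn A s h) mulfK// gt_eqF// partition_fn_gt0.
Qed.

Lemma expect_add f g : E (fun c => f c + g c) = E f + E g.
Proof.
rewrite /expect -mulrDl -big_split /=; congr (_ / _).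
by apply: eq_bigr => c _; rewrite mulrDl.
Qed.

Lemma expect_scale (r : R) f : E (fun c => r * f c) = r * E f.
Proof.
by rewrite /expect mulrA mulr_sumr; congr (_ / _); apply: eq_bigr => c _; rewrite mulrA.
Qed.

Lemma expect_sub f g : E (fun c => f c - g c) = E f - E g.
Proof.
have -> : (fun c => f c - g c) = (fun c => f c + -1 * g c).
  by apply/funext => c; rewrite mulN1r.
by rewrite expect_add expect_scale mulN1r.
Qed.

Lemma expect_sum (I : finType) (F : I -> config L -> R) :
  E (fun c => \sum_i F i c) = \sum_i E (F i).
Proof.
rewrite /expect -mulr_suml exchange_big /=; congr (_ / _).
by apply: eq_bigr => c _; rewrite mulr_suml.
Qed.

Lemma expect_le f g : (forall c, f c <= g c) -> E f <= E g.
Proof.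
move=> fg; rewrite /expect ler_pM2r ?invr_gt0 ?partition_fn_gt0//.
by apply: ler_sum => c _; rewrite ler_pM2r// ising_weight_gt0.
Qed.

Lemma expect_ge0 f : (forall c, 0 <= f c) -> 0 <= E f.
Proof. by move=> f0; rewrite -[leLHS](expect_cst 0); exact: expect_le. Qed.

Lemma expect_gt0 f : (forall c, 0 <= f c) -> (exists c, f c != 0) -> 0 < E f.
Proof.
move=> f0 [c fc]; rewrite /expect divr_gt0 ?partition_fn_gt0// (bigD1 c)//=.
rewrite ltr_pwDl//; first by rewrite mulr_gt0 ?ising_weight_gt0// lt_neqAle eq_sym fc f0.
by apply: sumr_ge0 => d _; rewrite mulr_ge0//; apply/ltW/ising_weight_gt0.
Qed.

Lemma expect_norm f : `|E f| <= \sum_c `|f c|.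
Proof.
have fb c : `|f c| <= \sum_c `|f c|.
  by rewrite (bigD1 c)//= lerDl; apply: sumr_ge0.
rewrite ler_norml; apply/andP; split.
  rewrite -[leLHS]expect_cst; apply: expect_le => c.
  by have := fb c; rewrite ler_norml => /andP[].
rewrite -[leRHS]expect_cst; apply: expect_le => c.
by have := fb c; rewrite ler_norml => /andP[].
Qed.

End expectation.

Section flow.
Variables (R : realType) (L : finType) (A : L -> L -> R) (h : L -> R) (b : L -> L -> R).
Variables (beta : R) (nu : R).
Implicit Types (f g : config L -> R) (s t : R) (y : L -> R) (c : config L).
Local Notation jet_ok := (@jet_ok R L beta).

Definition tilt k c : R := inner (b k) (spin R c).
Definition energy c : R := inner (spin R c) (matvec A (spin R c)).
Definition tilted_field y : L -> R := fun x => h x + \sum_k y k * b k x.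
Definition ev f s y := expect A s (tilted_field y) f.

Lemma inner_tilted_field y c : inner (tilted_field y) (spin R c) = inner h (spin R c) + \sum_k y k * tilt k c.
Proof.
rewrite /inner /tilted_field (eq_bigr (fun x => h x * spin R c x + (\sum_k y k * b k x) * spin R c x)).
  rewrite big_split /=; congr (_ + _).
  under eq_bigr do rewrite mulr_suml.
  rewrite exchange_big /=; apply: eq_bigr => k _; rewrite /tilt /inner mulr_sumr.
  by apply: eq_bigr => x _; rewrite mulrA.
by move=> x _; rewrite mulrDl.
Qed.

Lemma dv_weight_space k s y t c :
  is_derive t 1 (fun t => ising_weight A s (tilted_field (upd y k t)) c)
    (tilt k c * ising_weight A s (tilted_field (upd y k t)) c).
Proof.
pose r := inner h (spin R c) + \sum_(j | j != k) y j * tilt j c.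
have lin : (fun t => inner (tilted_field (upd y k t)) (spin R c)) = fun t => r + tilt k c * t.
  apply/funext => t'; rewrite inner_tilted_field (bigD1 k)//= upd_same.
  rewrite (eq_bigr (fun j => y j * tilt j c)); first by rewrite /r; ring.
  by move=> j /negbTE jk; rewrite /upd jk.
have d1 : is_derive t 1 (fun t => inner (tilted_field (upd y k t)) (spin R c)) (tilt k c).
  rewrite lin; apply: is_derive_eq (dv_add (dv_cst r t) (dv_scale (tilt k c) (dv_id t))) _.
  by rewrite add0r mulr1.
apply: is_derive_eq (dv_scale (expR (- (s / 2) * energy c)) (dv_expR d1)) _.
by rewrite /ising_weight -/(energy c); ring.
Qed.

Lemma dv_weight_time s y c : is_derive s 1 (fun s : R => ising_weight A s (tilted_field y) c)
  (- 2^-1 * energy c * ising_weight A s (tilted_field y) c).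
Proof.
have d1 : is_derive s 1 (fun s : R => - (s / 2) * energy c) (- 2^-1 * energy c).
  have -> : (fun s : R => - (s / 2) * energy c) = fun s : R => (- 2^-1 * energy c) * s.
    by apply/funext => t; ring.
  by apply: is_derive_eq (dv_scale _ (dv_id s)) _; rewrite mulr1.
apply: is_derive_eq (dv_mul (dv_expR d1) (dv_cst (expR (inner (tilted_field y) (spin R c))) s)) _.
by rewrite /ising_weight -/(energy c); ring.
Qed.

(** The derivative of a Gibbs mean is the covariance with the logarithmic derivative [p] of the
    weight. This covers both time and tilt. *)
Lemma dv_gibbs_ratio (w : R -> config L -> R) (p f : config L -> R) t :
  (forall c, is_derive t 1 (fun t => w t c) (p c * w t c)) ->
  (forall t c, 0 < w t c) ->
  let E g := (\sum_c g c * w t c) / \sum_c w t c in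
  is_derive t 1 (fun t => (\sum_c f c * w t c) / \sum_c w t c)
   (E (fun c => f c * p c) - E f * E p).
Proof.
move=> dw w0 E.
have Z0 t' : \sum_c w t' c != 0.
  rewrite gt_eqF// (bigD1 [ffun=> true])//= ltr_pwDl ?w0//.
  by apply: sumr_ge0 => c _; apply/ltW/w0.
have dN := dv_sum (fun c => dv_scale (f c) (dw c)).
apply: is_derive_eq (dv_div (Z0 t) dN (dv_sum dw)) _.
rewrite /E; have -> : \sum_i f i * (p i * w t i) = \sum_i f i * p i * w t i.
  by apply: eq_bigr => c _; rewrite mulrA.
by field.
Qed.

Definition jev f : jet R L := Jet (ev f)
  (fun s y => - 2^-1 * (ev (fun c => f c * energy c) s y - ev f s y * ev energy s y))
  (fun k s y => ev (fun c => f c * tilt k c) s y - ev f s y * ev (tilt k) s y)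
  (fun k s y => (ev (fun c => f c * tilt k c * tilt k c) s y
      - ev (fun c => f c * tilt k c) s y * ev (tilt k) s y)
    - ((ev (fun c => f c * tilt k c) s y - ev f s y * ev (tilt k) s y) * ev (tilt k) s y
      + ev f s y * (ev (fun c => tilt k c * tilt k c) s y - ev (tilt k) s y * ev (tilt k) s y))).

Lemma dv_ev_space f k s y t : is_derive t 1 (fun t => ev f s (upd y k t))
  (ev (fun c => f c * tilt k c) s (upd y k t) - ev f s (upd y k t) * ev (tilt k) s (upd y k t)).
Proof.
apply: (@dv_gibbs_ratio (fun t c => ising_weight A s (tilted_field (upd y k t)) c) (tilt k) f t).
  exact: dv_weight_space.
by move=> t' c; exact: ising_weight_gt0.
Qed.

Lemma jev_ok f : jet_ok (jev f).
Proof.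
split => /=.
- have wc c : continuous (fun v : 'rV[R]_#|{: option L}| =>
      ising_weight A (clamp beta (of_row v None)) (tilted_field (fun k => of_row v (Some k))) c).
    apply: ct_mul; apply: ct_comp; try by move=> v; exact: continuous_expR.
      apply: ct_mul; last exact: ct_cst.
      have -> : (fun v : 'rV[R]_#|{: option L}| => - (clamp beta (of_row v None) / 2)) =
          fun v => (- 2^-1) * clamp beta (of_row v None).
        by apply/funext => v; ring.
      apply: ct_mul; first exact: ct_cst.
      by apply: ct_comp; [move=> v; exact: clamp_continuous | exact: of_row_continuous].
    apply: ct_sum => x; apply: ct_mul; last exact: ct_cst.
    apply: ct_add; first exact: ct_cst.
    by apply: ct_sum => k; apply: ct_mul; [exact: of_row_continuous | exact: ct_cst].
  apply: ct_mul.
    by apply: ct_sum => c; apply: ct_mul; [exact: ct_cst | exact: wc].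
  apply: ct_inv; last by apply: ct_sum.
  by move=> v; rewrite gt_eqF//; exact: partition_fn_gt0.
- move=> s y _ _.
  have := @dv_gibbs_ratio (fun s c => ising_weight A s (tilted_field y) c)
     (fun c => - 2^-1 * energy c) f s (dv_weight_time s y)
     (fun t c => ising_weight_gt0 A t (tilted_field y) c).
  move=> /is_derive_eq; apply; rewrite -!/(partition_fn _ _ _) -!/(expect _ _ _ _).
  rewrite expect_scale (_ : (fun c => _) = fun c => - 2^-1 * (f c * energy c)).
    by rewrite expect_scale /ev; ring.
  by apply/funext => c; ring.
- by move=> k s y t; exact: dv_ev_space.
- move=> k s y t.
  have d1 := dv_ev_space (fun c => f c * tilt k c) k s y t.
  exact: dv_sub d1 (dv_mul (dv_ev_space f k s y t) (dv_ev_space (tilt k) k s y t)).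
Qed.

Local Notation heat := (heat (fun k => ev (tilt k))).
Hypothesis tiltE : forall c, \sum_k tilt k c * tilt k c = nu - energy c.

(* The choice [b^T b = 1 - A] gives [tiltE], which makes the second-order terms cancel
   against the time derivative. *)
Lemma heat_ev f s y : heat (jev f) s y = 0.
Proof.
rewrite /heat /=.
have -> : \sum_k (2^-1 * (ev (fun c => f c * tilt k c * tilt k c) s y
      - ev (fun c => f c * tilt k c) s y * ev (tilt k) s y
    - ((ev (fun c => f c * tilt k c) s y - ev f s y * ev (tilt k) s y) * ev (tilt k) s y
      + ev f s y * (ev (fun c => tilt k c * tilt k c) s y - ev (tilt k) s y * ev (tilt k) s y)))
    + ev (tilt k) s y * (ev (fun c => f c * tilt k c) s y - ev f s y * ev (tilt k) s y)) =
  2^-1 * (\sum_k ev (fun c => f c * tilt k c * tilt k c) s y)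
  - 2^-1 * ev f s y * (\sum_k ev (fun c => tilt k c * tilt k c) s y).
  by rewrite !mulr_sumr -sumrB; apply: eq_bigr => k _; field.
rewrite /ev -!expect_sum.
have -> : (fun c => \sum_k tilt k c * tilt k c) = fun c => nu - energy c.
  by apply/funext => c; exact: tiltE.
have -> : (fun c => \sum_k f c * tilt k c * tilt k c) = fun c => nu * f c - f c * energy c.
  apply/funext => c; rewrite [nu * _]mulrC -mulrBr -tiltE mulr_sumr.
  by apply: eq_bigr => k _; rewrite mulrA.
by rewrite !expect_sub expect_scale expect_cst; ring.
Qed.

End flow.

Section covariance_form.
Variables (R : realType) (L : finType) (A : L -> L -> R) (s : R) (h : L -> R).
Local Notation E := (expect A s h).

(** The form depends only on the combined observable, which allows tilts to be traded for spins in
    [grad_covariance]. *)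
Lemma variance_form (I : finType) (a : I -> R) (f : I -> config L -> R) :
  \sum_i \sum_j a i * a j * (E (fun c => f i c * f j c) - E (f i) * E (f j)) =
  E (fun c => (\sum_i a i * f i c) ^+ 2) - E (fun c => \sum_i a i * f i c) ^+ 2.
Proof.
have -> : (fun c => (\sum_i a i * f i c) ^+ 2) =
    fun c => \sum_i \sum_j (a i * a j) * (f i c * f j c).
  apply/funext => c; rewrite expr2 mulr_suml; apply: eq_bigr => i _.
  by rewrite mulr_sumr; apply: eq_bigr => j _; ring.
rewrite !expect_sum expr2 mulr_suml -sumrB; apply: eq_bigr => i _.
rewrite expect_sum mulr_sumr -sumrB; apply: eq_bigr => j _.
by rewrite !expect_scale; ring.
Qed.

End covariance_form.

(** * Evolution of Fisher information and entropy *)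

Section entropy_flow.
Variables (R : realType) (L : finType) (A : L -> L -> R) (h : L -> R) (b : L -> L -> R).
Variables (beta nu : R) (F : config L -> R).
Hypotheses (beta0 : 0 <= beta) (Aoff : offdiag_nonpos A).
Hypothesis tiltE : forall c, \sum_k tilt b k c * tilt b k c = nu - energy A c.
Hypothesis b_contraction : forall w : L -> R,
  \sum_k (\sum_x b k x * w x) ^+ 2 <= \sum_x w x ^+ 2.
Hypotheses (F0 : forall c, 0 <= F c) (Fn0 : exists c, F c != 0).
Implicit Types (s t : R) (y : L -> R) (c : config L).
Local Notation jet_ok := (@jet_ok R L beta).
Local Notation tilt := (tilt b).
Local Notation ev := (ev A h b).
Local Notation jev := (jev A h b).
Local Notation heat := (heat (fun k => ev (tilt k))).
Local Notation chi := (susceptibility A).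

Let G := jev F.
(* With [G s y] the expectation of [F] at time [s] and tilt [y], [jgrad k] is the partial
   derivative of [G], [jfisher] is [|grad G|^2 / G] and [jent] is the entropy. *)
Definition jgrad k := jsub (jev (fun c => F c * tilt k c)) (jmul G (jev (tilt k))).
Definition jinv := jcomp (fun x : R => x^-1) (fun x => -1 * (x ^+ 2)^-1) (fun x => 2 * (x ^+ 3)^-1) G.
Definition jfisher := jsum (fun k => jmul (jmul (jgrad k) (jgrad k)) jinv).
Definition jphi := jcomp (@Phi R) (fun x => ln x + 1) (fun x => x^-1) G.
Definition jent := jsub (jev (fun c => Phi (F c))) jphi.

Let G0 s y : 0 < jf G s y.
Proof. exact: expect_gt0. Qed.

Let jinv_ok : jet_ok jinv.
Proof.
apply: (jcomp_ok (jev_ok A h b beta F) G0) => x x0.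
  have xn : x != 0 by rewrite gt_eqF.
  by apply: is_derive_eq (@dv_inv _ id x _ xn (dv_id x)) _.
have x2 : x ^+ 2 != 0 by rewrite expf_neq0// gt_eqF.
apply: is_derive_eq (dv_scale (-1) (@dv_inv _ (fun t => t ^+ 2) x _ x2 (dv_sqr (dv_id x)))) _.
by field; rewrite gt_eqF.
Qed.

Let jphi_ok : jet_ok jphi.
Proof.
apply: (jcomp_ok (jev_ok A h b beta F) G0) => x x0.
  have dln := @dv_ln _ (fun x => x) x 1 x0 (dv_id x).
  by apply: is_derive_eq (dv_mul (dv_id x) dln) _; field; rewrite gt_eqF.
have dln := @dv_ln _ (fun x => x) x 1 x0 (dv_id x).
by apply: is_derive_eq (dv_add dln (dv_cst 1 x)) _; rewrite addr0 mul1r.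
Qed.

Let jgrad_ok k : jet_ok (jgrad k).
Proof. by apply: jsub_ok; [|apply: jmul_ok]; exact: jev_ok. Qed.

Let jfisher_ok : jet_ok jfisher.
Proof. by apply: jsum_ok => k; apply: jmul_ok => //; exact: jmul_ok. Qed.

Let jent_ok : jet_ok jent.
Proof. by apply: jsub_ok => //; exact: jev_ok. Qed.

Let heat_jev f s y : heat (jev f) s y = 0.
Proof. exact: heat_ev tiltE f s y. Qed.

Let v k s y := jf (jgrad k) s y.

Lemma jfisherE s y : jf jfisher s y = (\sum_k v k s y ^+ 2) / jf G s y.
Proof. by rewrite mulr_suml; apply: eq_bigr => k _; rewrite expr2. Qed.

Lemma heat_ent s y : heat jent s y = 2^-1 * jf jfisher s y.
Proof. by rewrite heat_sub heat_jev heat_comp heat_jev jfisherE /=; ring. Qed.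

(** All expectations involved are solutions, so only the Leibniz cross term survives, and the [j]
    derivative of the mean of [tilt k] is a covariance. *)
Lemma heat_grad k s y : heat (jgrad k) s y =
  \sum_j v j s y * (ev (fun c => tilt k c * tilt j c) s y - ev (tilt k) s y * ev (tilt j) s y).
Proof.
rewrite heat_sub heat_mul !heat_jev mul0r mulr0 addr0 !sub0r opprK.
by [].
Qed.

(** The transpose of a contraction is a contraction: with xi = b^T v, |xi|^2 = (v, b xi) <= (|v|^2 +
    |b xi|^2) / 2 <= (|v|^2 + |xi|^2) / 2. *)
Lemma grad_contraction s y (xi := fun x => \sum_k v k s y * b k x) :
  \sum_x xi x ^+ 2 <= \sum_k v k s y ^+ 2.
Proof.
have E : \sum_x xi x ^+ 2 = \sum_k v k s y * (\sum_x b k x * xi x).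
  under eq_bigr do rewrite expr2 {1}/xi mulr_suml.
  rewrite exchange_big /=; apply: eq_bigr => k _; rewrite mulr_sumr.
  by apply: eq_bigr => x _; ring.
have h2 : \sum_k v k s y * (\sum_x b k x * xi x) <=
    \sum_k 2^-1 * (v k s y ^+ 2 + (\sum_x b k x * xi x) ^+ 2).
  apply: ler_sum => k _; have := sqr_ge0 (v k s y - \sum_x b k x * xi x); lra.
have := b_contraction xi; move: h2; rewrite -E -mulr_sumr big_split /=; lra.
Qed.

Lemma grad_covariance s y : 0 <= s ->
  \sum_k v k s y * heat (jgrad k) s y <= chi s * \sum_k v k s y ^+ 2.
Proof.
move=> s0.
have chi0 : 0 <= chi s.
  by rewrite /susceptibility; elim/big_rec: _ => // i x _ x0; rewrite le_max x0 orbT.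
pose xi x := \sum_k v k s y * b k x.
apply: le_trans (ler_wpM2l chi0 (grad_contraction s y)).
apply: le_trans (ising_covariance_form Aoff s0 (tilted_field h b y) xi).
rewrite variance_form.
have -> : \sum_k v k s y * heat (jgrad k) s y = \sum_k \sum_j v k s y * v j s y *
   (ev (fun c => tilt k c * tilt j c) s y - ev (tilt k) s y * ev (tilt j) s y).
  apply: eq_bigr => k _; rewrite heat_grad mulr_sumr.
  by apply: eq_bigr => j _; rewrite mulrA.
rewrite variance_form.
have -> : (fun c => \sum_k v k s y * tilt k c) = fun c => \sum_x xi x * spin R c x.
  apply/funext => c; rewrite /xi; under [RHS]eq_bigr do rewrite mulr_suml.
  rewrite exchange_big /=; apply: eq_bigr => k _; rewrite mulr_sumr.
  by apply: eq_bigr => x _; rewrite mulrA.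
have -> // : (fun c => (\sum_k v k s y * tilt k c) ^+ 2) = fun c => (\sum_x xi x * spin R c x) ^+ 2.
apply/funext => c; congr (_ ^+ 2); rewrite /xi; under [RHS]eq_bigr do rewrite mulr_suml.
rewrite exchange_big /=; apply: eq_bigr => k _; rewrite mulr_sumr.
by apply: eq_bigr => x _; rewrite mulrA.
Qed.

(** Joint convexity of (v, g) -> v^2 / g: the second-order terms form a sum of squares with a
    favourable sign, and [grad_covariance] bounds the rest. *)
Lemma heat_fisher s y : 0 <= s -> heat jfisher s y <= 2 * chi s * jf jfisher s y.
Proof.
move=> s0; rewrite heat_sum.
apply: (@le_trans _ _ (\sum_k 2 * (v k s y * heat (jgrad k) s y) / jf G s y)).
  apply: ler_sum => k _; rewrite !heat_mul heat_comp heat_jev -/(v k s y).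
  set H := heat _ _ _; set g := jf G s y.
  have g0 : 0 < g by exact: G0.
  rewrite mulr0 sub0r.
  change (jf jinv s y) with (g^-1).
  change (jf (jmul (jgrad k) (jgrad k)) s y) with (v k s y * v k s y).
  rewrite (_ : \sum_j j1 (jmul (jgrad k) (jgrad k)) j s y * j1 jinv j s y =
    - (2 * v k s y / g ^+ 2) * \sum_j j1 (jgrad k) j s y * j1 G j s y); last first.
    rewrite mulr_sumr; apply: eq_bigr => j _.
    change (j1 (jmul (jgrad k) (jgrad k)) j s y) with
      (j1 (jgrad k) j s y * v k s y + v k s y * j1 (jgrad k) j s y).
    change (j1 jinv j s y) with (-1 * (g ^+ 2)^-1 * j1 G j s y).
    by ring.
  set P := \sum_j j1 (jgrad k) j s y * j1 G j s y; set S := \sum_j j1 G j s y ^+ 2.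
  set Q := \sum_j j1 (jgrad k) j s y * j1 (jgrad k) j s y.
  have : 0 <= \sum_j (j1 (jgrad k) j s y - v k s y / g * j1 G j s y) ^+ 2 / g.
    by apply: sumr_ge0 => j _; rewrite divr_ge0 ?sqr_ge0// ltW.
  have -> : \sum_j (j1 (jgrad k) j s y - v k s y / g * j1 G j s y) ^+ 2 / g =
     Q / g - 2 * v k s y / g ^+ 2 * P + v k s y ^+ 2 / g ^+ 3 * S.
    rewrite /Q /P /S mulr_suml !mulr_sumr -sumrB -big_split /=; apply: eq_bigr => j _.
    by field; rewrite gt_eqF.
  lra.
rewrite -mulr_suml -mulr_sumr -/(v _ s y) jfisherE mulrA ler_pM2r ?invr_gt0//.
have := grad_covariance y s0; lra.
Qed.

(** Crude bounds uniform in time and tilt, which supply the boundedness assumptions of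
    [parabolic_max]. *)
Let B := \sum_k \sum_c `|tilt k c|.

Let B0 : 0 <= B.
Proof. by apply: sumr_ge0 => k _; apply: sumr_ge0. Qed.

Let tilt_bound k : \sum_c `|tilt k c| <= B.
Proof.
by rewrite /B (bigD1 k)//= lerDl; apply: sumr_ge0 => j _; apply: sumr_ge0.
Qed.

Let drift_bound k s y : `|ev (tilt k) s y| <= B.
Proof. exact: le_trans (expect_norm _ _ _ _) (tilt_bound k). Qed.

Let grad_bound k s y : `|v k s y| <= 2 * B * jf G s y.
Proof.
have tB c : `|tilt k c| <= B.
  by apply: le_trans (tilt_bound k); rewrite (bigD1 c)//= lerDl; apply: sumr_ge0.
have h1 : `|ev (fun c => F c * tilt k c) s y| <= B * jf G s y.
  rewrite ler_norml -mulNr /= /ev -!expect_scale; apply/andP; split; apply: expect_le => c;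
    have := tB c; rewrite ler_norml => /andP[]; have := F0 c; nra.
have h2 : `|jf G s y * ev (tilt k) s y| <= B * jf G s y.
  by rewrite normrM mulrC (gtr0_norm (G0 s y)) ler_pM2r//; exact: drift_bound.
by apply: le_trans (ler_normB _ _) _; rewrite /= in h1 h2 *; lra.
Qed.

Lemma fisher_bound s y : jf jfisher s y <= (\sum_(k : L) (2 * B) ^+ 2) * \sum_c `|F c|.
Proof.
have GF : jf G s y <= \sum_c `|F c|.
  by apply: le_trans (ler_norm _) _; exact: expect_norm.
apply: (@le_trans _ _ ((\sum_(k : L) (2 * B) ^+ 2) * jf G s y)); last first.
  by rewrite ler_wpM2l// sumr_ge0// => k _; exact: sqr_ge0.
rewrite jfisherE ler_pdivrMr// -mulrA -expr2 mulr_suml; apply: ler_sum => k _.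
rewrite -exprMn -(real_normK (num_real (v k s y))).
rewrite ler_sqr ?nnegrE; [exact: grad_bound | exact: normr_ge0 |].
by apply: mulr_ge0; [move: B0; lra | apply/ltW].
Qed.

Lemma ent_bound s y : jf jent s y <= \sum_c `|Phi (F c)| + 1.
Proof.
rewrite /= lerBlDr; apply: le_trans (ler_norm _) _.
apply: le_trans (expect_norm _ _ _ _) _; rewrite -addrA lerDl.
have := Phi_tangent (ltW (G0 s y)) ltr01; rewrite ln1 mulr0 add0r /=.
have := G0 s y => /=; lra.
Qed.

Variables (X Y : R -> R) (d : config L -> R).
Hypotheses (X0 : X 0 = 0) (Xge0 : forall s, 0 <= s -> s <= beta -> 0 <= X s)
  (Xc : continuous (fun s => X (clamp beta s)))
  (Xd : forall s : R, 0 < s -> s <= beta -> is_derive s 1 X (chi s)).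
Hypotheses (Y0 : Y 0 = 2^-1) (Yge0 : forall s, 0 <= s -> s <= beta -> 0 <= Y s)
  (Yc : continuous (fun s => Y (clamp beta s)))
  (Yd : forall s : R, 0 < s -> s <= beta -> is_derive s 1 Y (expR (2 * X s))).
Hypotheses (d0 : forall c, 0 <= d c)
  (fisher0 : forall y, jf jfisher 0 y <= ev d 0 y)
  (ent0 : forall y, jf jent 0 y <= 2^-1 * ev d 0 y).

Let ed0 s y : 0 <= ev d s y.
Proof. exact: expect_ge0. Qed.

Lemma fisher_le s y : 0 <= s -> s <= beta -> jf jfisher s y <= expR (2 * X s) * ev d s y.
Proof.
move=> s0 sb.
(* Integrating factor for the growth rate [2 * chi s]. *)
pose q (s : R) := expR ((-2) * X s).
pose qj := @jtime R L q (fun s => q s * (-2 * chi s)).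
pose u := jsub (jmul qj jfisher) (jev d).
have qok : jet_ok qj.
  apply: jtime_ok => [|t t0 tb].
    apply: (@ct_comp _ _ expR); first by move=> ?; exact: continuous_expR.
    by apply: ct_mul => //; exact: ct_cst.
  exact: dv_expR (dv_scale (-2) (Xd t0 tb)).
have uok : jet_ok u by apply: jsub_ok; [exact: jmul_ok | exact: jev_ok].
have fisher_ge0 t z : 0 <= jf jfisher t z.
  rewrite jfisherE; apply: divr_ge0; last exact/ltW/G0.
  by apply: sumr_ge0 => k _; exact: sqr_ge0.
have uE t z : jf u t z = q t * jf jfisher t z - ev d t z by [].
suff : jf u s y <= 0.
  rewrite uE subr_le0 => qle.
  have -> : jf jfisher s y = expR (2 * X s) * (q s * jf jfisher s y).
    by rewrite mulrA /q -expRD mulNr subrr expR0 mul1r.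
  by rewrite ler_pM2l ?expR_gt0.
apply: (@parabolic_max _ _ beta (fun k => ev (tilt k)) u B
  ((\sum_(k : L) (2 * B) ^+ 2) * \sum_c `|F c|) uok B0 _ _ _ _ s y s0 sb).
- by move=> k t z _ _; exact: drift_bound.
- move=> t z t0 tb; rewrite uE lerBlDr; apply: ler_wpDr => //.
  apply: le_trans (fisher_bound t z); rewrite ler_piMl// /q -[leRHS]expR0 ler_expR.
  by have := Xge0 t0 tb; lra.
- move=> z; rewrite uE /q X0 mulr0 expR0 mul1r subr_le0; exact: fisher0.
move=> t z t0 tb; rewrite heat_sub heat_mul heat_time heat_jev subr0.
rewrite big1 ?subr0; last by move=> k _; rewrite mul0r.
have hf := heat_fisher z (ltW t0).
have q0 : 0 < q t by exact: expR_gt0.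
rewrite -(ler_pM2l q0) in hf.
change (jf qj t z) with (q t); lra.
Qed.

Lemma ent_le s y : 0 <= s -> s <= beta -> jf jent s y <= Y s * ev d s y.
Proof.
move=> s0 sb.
pose Yj := @jtime R L Y (fun s => expR (2 * X s)).
pose u := jsub jent (jmul Yj (jev d)).
have uok : jet_ok u.
  apply: jsub_ok => //; apply: jmul_ok; last exact: jev_ok.
  by apply: jtime_ok.
have uE t z : jf u t z = jf jent t z - Y t * ev d t z by [].
rewrite -subr_le0 -uE.
apply: (@parabolic_max _ _ beta (fun k => ev (tilt k)) u B
  (\sum_c `|Phi (F c)| + 1) uok B0 _ _ _ _ s y s0 sb).
- by move=> k t z _ _; exact: drift_bound.
- move=> t z t0 tb; rewrite uE lerBlDr; apply: ler_wpDr; last exact: ent_bound.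
  by rewrite mulr_ge0// Yge0.
- by move=> z; rewrite uE Y0 subr_le0; exact: ent0.
move=> t z t0 tb; rewrite heat_sub heat_ent heat_mul heat_time heat_jev mulr0 addr0.
rewrite big1 ?subr0; last by move=> k _; rewrite mul0r.
have := fisher_le z (ltW t0) tb; have := ed0 t z.
change (jf (jev d) t z) with (ev d t z).
have := expR_gt0 (2 * X t); set e := expR _; set D := ev d t z => e0 D0.
(* Entropy is produced at half the Fisher information, hence at most e D / 2, below the rate e D of
   the comparison function. *)
have : 0 <= e * D by rewrite mulr_ge0// ltW.
lra.
Qed.

End entropy_flow.

(** * The product measure at time zero *)

Section product_measure.
Variables (R : realType) (L : finType) (A : L -> L -> R) (h : L -> R).
Implicit Types (f g : config L -> R) (x : L) (c : config L) (l : seq L).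
Local Notation E := (expect A 0 h).
Local Notation spin := (@spin R L).

Definition set_spin x (a : bool) c : config L := [ffun y => if y == x then a else c y].

Lemma flip_set_spin x a c : flip (set_spin x a c) x = set_spin x (~~ a) c.
Proof. by apply/ffunP => y; rewrite !ffunE; case: eqP. Qed.

Lemma flip_set_spinC x y a c : x != y -> flip (set_spin y a c) x = set_spin y a (flip c x).
Proof.
move=> xy; apply/ffunP => z; rewrite !ffunE; have [->|zx] := eqVneq z x; last by [].
by rewrite (negbTE xy).
Qed.

Lemma set_spin_id x c : set_spin x (c x) c = c.
Proof. by apply/ffunP => y; rewrite ffunE; case: eqP => [->|]. Qed.

Lemma flip_set_spinE x c : flip c x = set_spin x (~~ c x) c.
Proof. by rewrite -{1}(set_spin_id x c) flip_set_spin. Qed.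

Definition prob x (a : bool) : R :=
  expR (if a then h x else - h x) / (expR (h x) + expR (- h x)).

Lemma prob_ge0 x a : 0 <= prob x a.
Proof. by rewrite /prob divr_ge0 ?addr_ge0 ?expR_ge0. Qed.

Lemma prob_sum x : prob x true + prob x false = 1.
Proof. by rewrite /prob -mulrDl divff// gt_eqF// addr_gt0 ?expR_gt0. Qed.

Definition avg x f c := prob x true * f (set_spin x true c) + prob x false * f (set_spin x false c).

(** At time 0 the spins are independent, so [prob x] is the law of the spin at [x] given all
    others. *)
Lemma weight_set_spin x a c : ising_weight A 0 h (set_spin x a c) =
  prob x a * (ising_weight A 0 h c + ising_weight A 0 h (flip c x)).
Proof.
pose r := \sum_(y | y != x) h y * spin c y.
have wE (d : config L) : (forall y, y != x -> d y = c y) ->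
    ising_weight A 0 h d = expR r * expR (if d x then h x else - h x).
  move=> dc; rewrite /ising_weight mul0r oppr0 mul0r expR0 mul1r -expRD /inner (bigD1 x)//=.
  have -> : \sum_(i | i != x) h i * Defs.spin R d i = r.
    by apply: eq_bigr => y yx; rewrite /Defs.spin dc.
  have -> : h x * Defs.spin R d x = if d x then h x else - h x.
    by rewrite /Defs.spin; case: (d x); rewrite ?mulr1// mulrN1.
  by rewrite addrC.
rewrite !wE ?ffunE ?eqxx//; last first.
- by move=> y yx; rewrite ffunE (negbTE yx).
- by move=> y yx; rewrite ffunE (negbTE yx).
rewrite /prob; have : expR (h x) + expR (- h x) != 0 by rewrite gt_eqF// addr_gt0 ?expR_gt0.
by case: (c x) => /= n0; case: a => /=; field.
Qed.

Lemma avg_flip x f c : avg x f (flip c x) = avg x f c.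
Proof.
have e a : set_spin x a (flip c x) = set_spin x a c.
  by apply/ffunP => y; rewrite !ffunE; case: eqP.
by rewrite /avg !e.
Qed.

Lemma expect_avg x f : E (avg x f) = E f.
Proof.
rewrite /expect; congr (_ / _).
have sym g : \sum_c g c = 2^-1 * \sum_c (g c + g (flip c x)).
  by rewrite big_split /= -(sum_flip x g); field.
rewrite [LHS]sym [RHS]sym; congr (_ * _); apply: eq_bigr => c _.
rewrite avg_flip -mulrDr.
have -> : avg x f c * (ising_weight A 0 h c + ising_weight A 0 h (flip c x)) =
  f (set_spin x true c) * ising_weight A 0 h (set_spin x true c) +
  f (set_spin x false c) * ising_weight A 0 h (set_spin x false c).
  by rewrite !weight_set_spin /avg; ring.
by have := set_spin_id x c; rewrite flip_set_spinE; case: (c x) => /= -> //; rewrite addrC.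
Qed.

Lemma avg_ge0 x f : (forall c, 0 <= f c) -> forall c, 0 <= avg x f c.
Proof. by move=> f0 c; rewrite /avg addr_ge0// mulr_ge0 ?prob_ge0. Qed.

Definition sqrt_jump x f c := (Num.sqrt (f c) - Num.sqrt (f (flip c x))) ^+ 2.

Lemma avg_sqrt_jump x y f c : x != y -> (forall c, 0 <= f c) ->
  sqrt_jump x (avg y f) c <= avg y (sqrt_jump x f) c.
Proof.
move=> xy f0; rewrite /sqrt_jump /avg !flip_set_spinC//.
by apply: sqrt_mean_contraction; rewrite ?prob_ge0.
Qed.

Lemma avg_entropy x f : (forall c, 0 <= f c) ->
  E (fun c => Phi (f c)) - E (fun c => Phi (avg x f c)) <= 2^-1 * E (sqrt_jump x f).
Proof.
move=> f0; rewrite -(expect_avg x (fun c => Phi (f c))) -(expect_avg x (sqrt_jump x f)).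
rewrite -expect_sub -expect_scale; apply: expect_le => c.
rewrite /avg /sqrt_jump !flip_set_spin /=.
have [s1 s2] : Num.sqrt (f (set_spin x true c)) ^+ 2 = f (set_spin x true c) /\
   Num.sqrt (f (set_spin x false c)) ^+ 2 = f (set_spin x false c) by rewrite !sqr_sqrtr.
have := two_point_logsob (prob_ge0 x true) (prob_ge0 x false) (prob_sum x)
  (sqrtr_ge0 (f (set_spin x true c))) (sqrtr_ge0 (f (set_spin x false c))).
rewrite s1 s2; set a := Num.sqrt _; set b := Num.sqrt _; have := prob_sum x.
set p := prob x true; set q := prob x false => pq.
have -> : 2^-1 * (p * (a - b) ^+ 2 + q * (b - a) ^+ 2) = 2^-1 * (p + q) * (a - b) ^+ 2 by ring.
by rewrite pq mulr1.
Qed.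

Definition avgs l f := foldl (fun f x => avg x f) f l.

(** Spins are resampled one at a time and the entropy losses telescope. By [avg_sqrt_jump] a
    resampling at [x] does not increase the mean jumps at other sites; [uniq] keeps these different
    from [x]. *)
Lemma avgs_entropy l f : uniq l -> (forall c, 0 <= f c) ->
  E (fun c => Phi (f c)) - E (fun c => Phi (avgs l f c)) <= 2^-1 * \sum_(x <- l) E (sqrt_jump x f).
Proof.
elim: l f => [|x l IH] f /=; first by rewrite big_nil subrr mulr0.
move=> /andP[xl ul] f0; rewrite big_cons mulrDr.
have h1 := avg_entropy x f0.
have h2 := IH (avg x f) ul (avg_ge0 x f0).
have h3 : \sum_(y <- l) E (sqrt_jump y (avg x f)) <= \sum_(y <- l) E (sqrt_jump y f).
  rewrite big_seq [leRHS]big_seq; apply: ler_sum => y yl.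
  rewrite -(expect_avg x (sqrt_jump y f)); apply: expect_le => c; apply: avg_sqrt_jump => //.
  by apply: contraNneq xl => <-.
lra.
Qed.

Lemma expect_avgs l f : E (avgs l f) = E f.
Proof. by elim: l f => //= x l IH f; rewrite IH expect_avg. Qed.

(* Resampling the spins of [l] leaves no dependence on them. *)
Lemma avgs_local l f (S : pred L) :
  (forall c c', (forall y, S y -> c y = c' y) -> f c = f c') ->
  forall c c', (forall y, S y && (y \notin l) -> c y = c' y) -> avgs l f c = avgs l f c'.
Proof.
elim: l f S => [|x l IH] f S fS c c' cc /=.
  by apply: fS => y Sy; apply: cc; rewrite Sy.
apply: (IH _ (predI S (predC1 x))) => [d d' dd|y /andP[/andP[Sy yx] yl]]; last first.
  by apply: cc; rewrite Sy inE negb_or yl andbT.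
by rewrite /avg; congr (_ * _ + _ * _); apply: fS => y Sy; rewrite !ffunE;
  case: eqP => // /eqP yx; apply: dd; rewrite /= Sy.
Qed.

Lemma product_logsob f : (forall c, 0 <= f c) ->
  E (fun c => Phi (f c)) - Phi (E f) <= 2^-1 * E (fun c => \sum_x sqrt_jump x f c).
Proof.
move=> f0; rewrite expect_sum.
pose c0 : config L := [ffun=> true].
have cst c : avgs (enum L) f c = avgs (enum L) f c0.
  apply: (@avgs_local _ _ predT) => [d d' dd|y]; last by rewrite mem_enum.
  by congr f; apply/ffunP => y; exact: dd.
have := avgs_entropy (enum_uniq L) f0; rewrite big_enum /=.
have <- : Phi (E f) = E (fun c => Phi (avgs (enum L) f c)).
  by rewrite -(expect_avgs (enum L) f) (funext cst) !expect_cst.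
by [].
Qed.

(** Discriminant of a quadratic in [t] that is nonnegative already after averaging over the spin at
    [x] alone. *)
Lemma product_covariance x f : (forall c, 0 <= f c) ->
  (E (fun c => f c * spin c x) - E f * E (fun c => spin c x)) ^+ 2 <= E f * E (sqrt_jump x f).
Proof.
move=> f0; pose p := prob x true; pose q := prob x false; pose m := p - q.
have mE : E (fun c => spin c x) = m.
  rewrite -(expect_avg x) -[RHS](expect_cst A 0 h); congr expect; apply/funext => c.
  by rewrite /avg /Defs.spin !ffunE eqxx /m /p /q; ring.
rewrite mE; set g := _ - _; set G := E f; set S := E _.
have pq : p + q = 1 by exact: prob_sum.
have quad t : 0 <= G * t ^+ 2 - 2 * t * g + S.
  pose K c := t ^+ 2 * f c - 2 * t * (f c * spin c x - m * f c) + sqrt_jump x f c.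
  have -> : G * t ^+ 2 - 2 * t * g + S = E K.
    rewrite /K expect_add !expect_sub !expect_scale expect_sub expect_scale /g /G /S; ring.
  rewrite -(expect_avg x); apply: expect_ge0 => c; rewrite /avg /K /sqrt_jump !flip_set_spin /=.
  rewrite /Defs.spin !ffunE eqxx.
  have [s1 s2] : f (set_spin x true c) = Num.sqrt (f (set_spin x true c)) ^+ 2 /\
    f (set_spin x false c) = Num.sqrt (f (set_spin x false c)) ^+ 2 by rewrite !sqr_sqrtr.
  move: s1 s2; set a := Num.sqrt _; set b := Num.sqrt _ => -> ->.
  have p0 : 0 <= p by exact: prob_ge0.
  have q0 : 0 <= q by exact: prob_ge0.
  rewrite -/p -/q /m.
  have qE : q = 1 - p by lra.
  (* For p + q = 1 the averaged quadratic is exactly the sum of these three terms. *)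
  have h1 : 0 <= ((a - b) - 2 * p * q * t * (a + b)) ^+ 2 by exact: sqr_ge0.
  have h2 : 0 <= t ^+ 2 * (p * a - q * b) ^+ 2 by rewrite mulr_ge0 ?sqr_ge0.
  have h3 : 0 <= t ^+ 2 * (p * q * (a + b) ^+ 2 * (p - q) ^+ 2).
    apply: mulr_ge0; first exact: sqr_ge0.
    apply: mulr_ge0; last exact: sqr_ge0.
    by apply: mulr_ge0; [exact: mulr_ge0 | exact: sqr_ge0].
  move: h1 h2 h3; rewrite qE; lra.
have G0 : 0 <= G by exact: expect_ge0.
have S0 : 0 <= S by apply: expect_ge0 => c; exact: sqr_ge0.
have [G00|Gn] := eqVneq G 0.
  (* With G = 0 the quadratic is affine in [t]; this point would give it the value -1. *)
  have := quad ((S + 1) / (2 * g)).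
  have [->|gn] := eqVneq g 0; first by rewrite expr0n mulr_ge0.
  rewrite G00 mul0r; have -> : 0 - 2 * ((S + 1) / (2 * g)) * g + S = -1 by field.
  by lra.
have := quad (g / G).
have -> : G * (g / G) ^+ 2 - 2 * (g / G) * g + S = S - g ^+ 2 / G by field.
by rewrite subr_ge0 ler_pdivrMr ?lt_neqAle ?G0 1?eq_sym ?Gn// mulrC.
Qed.

End product_measure.

(** * The logarithmic Sobolev inequality for the Ising model *)

Section primitive.
Variable R : realType.
Local Notation mu := (@lebesgue_measure R).

Definition primitive (f : R -> R) (s : R) : R := \int[mu]_(t in `[0, s]%classic) f t.

Variable f : R -> R.
Hypothesis fc : forall s : R, 0 <= s -> {for s, continuous f}.

Let f_integrable (u : R) : mu.-integrable `[0, u]%classic (EFin \o f).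
Proof.
apply: continuous_compact_integrable; first exact: segment_compact.
by apply: continuous_in_subspaceT => s; rewrite inE/= in_itv/= => /andP[s0 _]; exact: fc.
Qed.

Lemma primitive0 : primitive f 0 = 0.
Proof. by rewrite /primitive set_itv1 Rintegral_set1. Qed.

Lemma primitive_derive (s : R) : 0 < s -> is_derive s 1 (primitive f) (f s).
Proof.
move=> s0; have s1 : s < s + 1 by rewrite ltrDl.
have [d e] := @continuous_FTC1_closed R f 0 s (s + 1) s1 (f_integrable _) s0 (fc (ltW s0)).
by apply: DeriveDef; [exact: d | rewrite -derive1E].
Qed.

Lemma primitive_continuous (s : R) : 0 <= s -> {for s, continuous (primitive f)}.
Proof.
rewrite le_eqVlt => /predU1P[<-|s0]; last exact: dv_continuous (primitive_derive s0).
(* Continuity at 0 is two-sided: for negative arguments the interval is empty and the integral is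
   0. *)
rewrite /prop_for /continuous_at primitive0.
exact: (@parameterized_integral_cvg_left R 0 1 f ltr01 (f_integrable 1)).
Qed.

Lemma primitive_clamp_continuous (beta : R) : 0 <= beta ->
  continuous (fun s => primitive f (clamp beta s)).
Proof.
move=> b0 s; apply: (@continuous_comp _ _ _ (clamp beta) (primitive f)).
  exact: clamp_continuous.
by apply: primitive_continuous; have /andP[] := clamp_in b0 s.
Qed.

End primitive.

Section susceptibility.
Variables (R : realType) (L : finType) (A : L -> L -> R).

Lemma expect_continuous h f : continuous (fun s : R => expect A s h f).
Proof.
have wc c : continuous (fun s : R => ising_weight A s h c).
  move=> s; have := dv_weight_time A h (fun _ _ => 0) s (fun=> 0) c.
  have -> : tilted_field h (fun _ _ => 0) (fun=> 0) = h.
    by apply/funext => x; rewrite /tilted_field big1 ?addr0// => k _; rewrite mul0r.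
  exact: dv_continuous.
apply: ct_mul; first by apply: ct_sum => c; apply: ct_mul; [exact: ct_cst | exact: wc].
apply: ct_inv; last by apply: ct_sum.
by move=> s; rewrite gt_eqF// partition_fn_gt0.
Qed.

Lemma susceptibility_continuous : continuous (susceptibility A).
Proof.
pose g x s := \sum_y expect A s (fun=> 0) (fun c => spin R c x * spin R c y).
have gc x : continuous (g x) by apply: ct_sum => y; exact: expect_continuous.
have -> : susceptibility A = fun s => \big[Num.max/0]_x g x s by [].
elim: index_enum => [|x l IH].
  rewrite (_ : (fun s => _) = fun=> 0); first exact: ct_cst.
  by apply/funext => s; rewrite big_nil.
rewrite (_ : (fun s => _) = fun s => Num.max (g x s) (\big[Num.max/0]_(x <- l) g x s)).
  by move=> s; apply: continuous_max; [exact: gc | exact: IH].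
by apply/funext => s; rewrite big_cons.
Qed.

Lemma susceptibility_ge0 s : 0 <= susceptibility A s.
Proof.
by rewrite /susceptibility; elim/big_rec: _ => // i x _ x0; rewrite le_max x0 orbT.
Qed.

End susceptibility.

Section ising_logsob.
Variables (R : realType) (L : finType) (A : L -> L -> R).
Hypotheses (Asym : sym_mx A) (Apd : posdef_mx A) (Aoff : offdiag_nonpos A).
Hypotheses (Anorm : spec_rad_le1 A).
Implicit Types (w : L -> R).

Lemma complement_decomposition : exists b : L -> L -> R, forall w,
  \sum_k (\sum_x b k x * w x) ^+ 2 = inner w w - inner w (matvec A w).
Proof.
pose B x y := delta R x y - A x y.
have BE w : bform B w w = inner w w - inner w (matvec A w).
  rewrite bform_inner /inner -sumrB; apply: eq_bigr => x _; rewrite -mulrBr; congr (_ * _).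
  by rewrite /matvec -(sum_delta x w) -sumrB; apply: eq_bigr => y _; rewrite mulrBl.
have [||b bE] := @psd_decomposition R L B.
- by move=> x y; rewrite /B Asym /delta eq_sym.
- by move=> w; rewrite BE subr_ge0; exact: spectral_bound.
exists b => w; rewrite -BE /bform.
under eq_bigr do rewrite expr2 mulr_suml.
rewrite exchange_big; apply: eq_bigr => x _ /=.
under eq_bigr do rewrite mulr_sumr.
rewrite exchange_big; apply: eq_bigr => y _ /=; rewrite bE !mulr_suml.
by apply: eq_bigr => k _; ring.
Qed.

Lemma posdef_ge0 w : 0 <= inner w (matvec A w).
Proof.
have [/existsP w0|] := boolP [exists x, w x != 0]; first exact/ltW/Apd.
rewrite negb_exists => /forallP w0; rewrite /inner big1// => x _.
by move: (w0 x); rewrite negbK => /eqP ->; rewrite mul0r.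
Qed.

Section initial.
Variables (h : L -> R) (b : L -> L -> R) (F : config L -> R).
Hypothesis b_contraction : forall w, \sum_k (\sum_x b k x * w x) ^+ 2 <= \sum_x w x ^+ 2.
Hypotheses (F0 : forall c, 0 <= F c) (Fn0 : exists c, F c != 0).

Lemma initial_fisher y :
  jf (jfisher A h b F) 0 y <= ev A h b (fun c => \sum_x sqrt_jump x F c) 0 y.
Proof.
set G := ev A h b F 0 y; have G0 : 0 < G by exact: expect_gt0.
rewrite jfisherE ler_pdivrMr//.
pose g x := ev A h b (fun c => F c * spin R c x) 0 y - G * ev A h b (fun c => spin R c x) 0 y.
have vE k : jf (jgrad A h b F k) 0 y = \sum_x b k x * g x.
  rewrite /= /ev; have -> : (fun c => F c * tilt b k c) =
      fun c => \sum_x b k x * (F c * spin R c x).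
    by apply/funext => c; rewrite /tilt /inner mulr_sumr; apply: eq_bigr => x _; ring.
  have -> : tilt b k = fun c => \sum_x b k x * spin R c x by [].
  rewrite !expect_sum mulr_sumr -sumrB; apply: eq_bigr => x _.
  by rewrite !expect_scale /g /G /ev; ring.
under eq_bigr do rewrite vE.
apply: le_trans (b_contraction g) _.
rewrite /ev expect_sum mulr_suml; apply: ler_sum => x _; rewrite mulrC.
exact: product_covariance.
Qed.

Lemma initial_ent y :
  jf (jent A h b F) 0 y <= 2^-1 * ev A h b (fun c => \sum_x sqrt_jump x F c) 0 y.
Proof. exact: product_logsob. Qed.

End initial.

Variables (beta : R) (h : L -> R).
Hypothesis beta0 : 0 <= beta.

Let X := primitive (susceptibility A).
Let rhs : R := 2^-1 + primitive (fun t => expR (2 * X t)) beta.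

Lemma rhs_gt0 : 0 < rhs.
Proof. by rewrite ltr_pwDl// Rintegral_ge0// => t _; exact: expR_ge0. Qed.

Lemma DirichletE F : expect A beta h (fun c => \sum_x sqrt_jump x F c) =
  2 * Dirichlet A beta h (fun c => Num.sqrt (F c)).
Proof. by rewrite expect_sum /Dirichlet mulrA divff ?mul1r. Qed.

Lemma ising_entropy_le (F : config L -> R) : (forall c, 0 <= F c) ->
  Ent A beta h F <= 2 * rhs * Dirichlet A beta h (fun c => Num.sqrt (F c)).
Proof.
move=> F0; rewrite [2 * rhs]mulrC -mulrA -DirichletE.
(* The flow divides by the expectation of [F], so the zero function is treated directly. *)
have [/existsP Fn0|] := boolP [exists c, F c != 0]; last first.
  rewrite negb_exists => /forallP Fz.
  have -> : F = fun=> 0 by apply/funext => c; apply/eqP; have := Fz c; rewrite negbK.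
  rewrite /Ent !expect_cst subrr mulr_ge0 ?(ltW rhs_gt0)//; apply: expect_ge0 => c.
  by apply: sumr_ge0 => x _; exact: sqr_ge0.
have [b bE] := complement_decomposition.
have b_contraction w : \sum_k (\sum_x b k x * w x) ^+ 2 <= \sum_x w x ^+ 2.
  rewrite bE -[leRHS](_ : inner w w = _); first by rewrite gerBl posdef_ge0.
  by apply: eq_bigr => x _; rewrite expr2.
have tiltE c : \sum_k tilt b k c * tilt b k c = #|L|%:R - energy A c.
  have -> : \sum_k tilt b k c * tilt b k c = \sum_k (\sum_x b k x * spin R c x) ^+ 2.
    by apply: eq_bigr => k _; rewrite expr2.
  rewrite bE /energy; congr (_ - _); rewrite /inner.
  by under eq_bigr do rewrite spin_sqr; rewrite sumr_const.
have tilted_field0 : tilted_field h b (fun=> 0) = h.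
  by apply/funext => x; rewrite /tilted_field big1 ?addr0// => k _; rewrite mul0r.
have Xc s : 0 <= s -> {for s, continuous X}.
  by move=> s0; apply: primitive_continuous => // t _; exact: susceptibility_continuous.
have ec (s : R) : 0 <= s -> {for s, continuous (fun t => expR (2 * X t))}.
  move=> s0; apply: (@continuous_comp _ _ _ (fun t => 2 * X t) expR).
    by apply: cvgM; [exact: cvg_cst | exact: Xc].
  exact: continuous_expR.
pose Y s := 2^-1 + primitive (fun t => expR (2 * X t)) s.
have clamp0 s : 0 <= clamp beta s by have /andP[] := clamp_in beta0 s.
have XE : X 0 = 0 by exact: primitive0.
have X0 s : 0 <= s -> s <= beta -> 0 <= X s.
  by move=> _ _; apply: Rintegral_ge0 => t _; exact: susceptibility_ge0.
have Xcc : continuous (fun s => X (clamp beta s)).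
  by apply: primitive_clamp_continuous => // t _; exact: susceptibility_continuous.
have Xd s : 0 < s -> s <= beta -> is_derive s 1 X (susceptibility A s).
  move=> s0 _; apply: primitive_derive => // t _; exact: susceptibility_continuous.
have YE : Y 0 = 2^-1 by rewrite /Y primitive0 addr0.
have Y0 s : 0 <= s -> s <= beta -> 0 <= Y s.
  by move=> _ _; rewrite /Y addr_ge0// Rintegral_ge0// => t _; exact: expR_ge0.
have Ycc : continuous (fun s => Y (clamp beta s)).
  by apply: ct_add; [exact: ct_cst | exact: primitive_clamp_continuous].
have Yd s : 0 < s -> s <= beta -> is_derive s 1 Y (expR (2 * X s)).
  move=> s0 _; have := dv_add (dv_cst 2^-1 s) (primitive_derive ec s0).
  by rewrite add0r.
have d0 c : 0 <= \sum_x sqrt_jump x F c by apply: sumr_ge0 => x _; exact: sqr_ge0.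
(* Evaluation at time [beta] and tilt 0, where the tilted field is [h]. *)
have := ent_le Aoff tiltE b_contraction F0 Fn0 XE X0 Xcc Xd YE Y0 Ycc Yd d0
  (initial_fisher h b_contraction F0 Fn0) (initial_ent h b F0) (fun=> 0) beta0 (lexx beta).
by rewrite /= /ev tilted_field0.
Qed.

Lemma inverse_rhs_logsob : logsob_set A beta h rhs^-1.
Proof.
split; first by rewrite invr_gt0 rhs_gt0.
by move=> F F0; rewrite invrK; exact: ising_entropy_le.
Qed.

Lemma inverse_logsob_const_le : 1 / logsob_const A beta h <= rhs.
Proof.
(* If the set of admissible constants is unbounded, [sup] is [0] and so is [1 / sup]. *)
rewrite /logsob_const; have [hs|/sup_out ->] := pselect (has_sup (logsob_set A beta h)).
  have le : rhs^-1 <= sup (logsob_set A beta h).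
    by apply: ub_le_sup; [exact: hs.2 | exact: inverse_rhs_logsob].
  rewrite div1r -[leRHS]invrK lef_pV2// posrE ?invr_gt0 ?rhs_gt0//.
  by apply: lt_le_trans le; rewrite invr_gt0 rhs_gt0.
by rewrite invr0 mulr0 ltW// rhs_gt0.
Qed.

End ising_logsob.

Theorem theorem1p1 (R : realType) (L : finType) (A : L -> L -> R)
  (Asym : sym_mx A) (Apd : posdef_mx A) (Aoff : offdiag_nonpos A)
  (Anorm : spec_rad_le1 A) (beta : R) (hbeta : 0 <= beta) (h : L -> R) :
  1 / logsob_const A beta h <=
  2^-1 + \int[@lebesgue_measure R]_(t in `[0, beta]%classic)
           expR (2 * \int[@lebesgue_measure R]_(s in `[0, t]%classic) susceptibility A s).
Proof. exact: inverse_logsob_const_le. Qed.
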